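(* Consider the rational quadratic program $$\min_{x,y,z\in\mathbb{R}^2}\ \tfrac12x^\top Q_1x+\tfrac12y^\top Q_2y+\iota_{\mathbb{R}_+^2}(z)\quad\text{s.t.}\quad x+y+z=\bar b$$ with the data $Q_1,Q_2,\bar b$ given in the context, and the direct ADMM iteration with penalty $\beta=1$ and multiplier step $\tau>0$, viewed as a map on $w=(y,z,\lambda)\in\mathbb{R}^6$ (see context). Let $w^\star=(y^\star,z^\star,\lambda^\star)$ be the state of the unique KKT point. Then: 1. There exist a rational matrix $H\succ0$, a radius $r>0$, and a constant $\kappa\in(0,1)$, all independent of $\tau\in[49/100,51/100]$, such that for every such $\tau$ $$\|w^0-w^\star\|_H\le r\quad\Longrightarrow\quad\|w^{k+1}-w^\star\|_H\le\kappa\|w^k-w^\star\|_H\quad\text{for every }k\ge0 .$$ In particular, the KKT point is uniformly locally Q-linearly attracting throughout $\frac{49}{100}\le\tau\le\frac{51}{100}$. 2. The sequence started from the period-$66$ initialization $(y^0,z^0,\lambda^0)$ defined in the context converges to that KKT point whenever $\left|\tau-\frac12\right|\le10^{-10}$. 3. There is a number $\tau_c$ with $$0.9366061114<\tau_c<0.9366061115$$ such that, for each fixed $\tau\in(0,1)$, the KKT state $w^\star$ is locally Q-linearly attracting if and only if $0<\tau<\tau_c$. Equivalently, for $\tau\in(0,1)$, the matrix $T_{01}(\tau)$ defined in the context is Schur stable (spectral radius less than $1$) exactly for $0<\tau<\tau_c$. (For each fixed $\tau$ in this interval, the neighborhood, Lyapunov metric and contraction factor may depend on $\tau$.)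
   Context: Data. Set $$\varepsilon=\tfrac1{1000},\quad \mu=\tfrac{8957}{10000},\quad \nu=\tfrac{999}{1000},\quad d_1=(-1,20)^\top,\quad d_2=(-1,10)^\top,$$ $$M=\varepsilon I_2+(\mu-\varepsilon)\frac{d_1d_1^\top}{d_1^\top d_1},\quad Q_1=M^{-1}-I_2,\qquad N=\varepsilon I_2+(\nu-\varepsilon)\frac{d_2d_2^\top}{d_2^\top d_2},\quad Q_2=N^{-1}-I_2,$$ $$z^\star=(0,1)^\top,\quad \lambda^\star=(-1,0)^\top,\quad x^\star=Q_1^{-1}\lambda^\star,\quad y^\star=Q_2^{-1}\lambda^\star,\quad \bar b=x^\star+y^\star+z^\star .$$ The matrices $Q_1,Q_2$ are positive definite and $(x^\star,y^\star,z^\star,\lambda^\star)$ is the unique KKT point, i.e. the unique solution of $Q_1x=\lambda$, $Q_2y=\lambda$, $x+y+z=\bar b$, $z\ge0$, $\lambda\in N_{\mathbb{R}_+^2}(z)$. Write $\iota_C$ for the indicator function of $C$, $[a]_+$ and $[a]_-$ for the componentwise $\max\{a_i,0\}$ and $\min\{a_i,0\}$, and $I=I_2$. Iteration with $\beta=1$ and multiplier step $\tau$: $$x^{k+1}=M(\bar b-y^k-z^k+\lambda^k),\qquad y^{k+1}=N(\bar b-x^{k+1}-z^k+\lambda^k),$$ $$z^{k+1}=[\bar b-x^{k+1}-y^{k+1}+\lambda^k]_+,\qquad \lambda^{k+1}=\lambda^k-\tau(x^{k+1}+y^{k+1}+z^{k+1}-\bar b).$$ It does not depend on $x^k$, so it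 is a map on the state $w^k=(y^k,z^k,\lambda^k)\in\mathbb{R}^6$. Norm and local attraction. For $H\succ0$, $\|e\|_H=(e^\top He)^{1/2}$. For fixed $\tau$, $w^\star$ is locally Q-linearly attracting if there exist a neighborhood $\mathcal U_\tau$ of $w^\star$, a norm $\|\cdot\|_\tau$ and a constant $\kappa_\tau\in(0,1)$ such that every $w^0\in\mathcal U_\tau$ generates a sequence that remains in $\mathcal U_\tau$ and satisfies $\|w^{k+1}-w^\star\|_\tau\le\kappa_\tau\|w^k-w^\star\|_\tau$ for all $k\ge0$. Matrix $T_{01}(\tau)$. Put $C_y=(I-N)M$, $C_z=N+(I-N)M$, $C_\lambda=(I-N)(I-M)$, $D=\operatorname{diag}(0,1)$. Then $T_{01}(\tau)=T^{(0)}+\tau T^{(1)}\in\mathbb{R}^{6\times6}$ with $$T^{(0)}=\begin{pmatrix} NM & -N(I-M) & N(I-M) \\ D\,C_y & D\,C_z & D\,C_\lambda \\ 0 & 0 & I \end{pmatrix},\quad T^{(1)}=\begin{pmatrix} 0 & 0 & 0 \\ 0 & 0 & 0 \\ (I-D)C_y & (I-D)C_z & (I-D)C_\lambda-I \end{pmatrix}.$$ Period-66 initialization. Put $g=(I-M)\bar b$, $h=\binom{Ng}{(I-N)g}\in\mathbb{R}^4$, and for $D_{00}=\operatorname{diag}(0,0)$, $D_{01}=\operatorname{diag}(0,1)$, $S_D=2D-I$, let $$T_D=\begin{pmatrix} NM & -N(I-M)S_D \\ (I-N)M & D-(I-N)(I-M)S_D \end{pmatrix}\in\mathbb{R}^{4\times4},\qquad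 L_\omega=\begin{pmatrix} T_{D_\omega} & h \\ 0 & 1 \end{pmatrix}\in\mathbb{R}^{5\times5},\quad\omega\in\{00,01\}.$$ Write $L_{01}^{64}L_{00}^{2}=\begin{pmatrix} \mathcal P & a \\ 0 & 1 \end{pmatrix}$ with $\mathcal P\in\mathbb{Q}^{4\times4}$, $a\in\mathbb{Q}^4$; the matrix $I_4-\mathcal P$ is nonsingular. Let $(y^0,q^0)=(I_4-\mathcal P)^{-1}a\in\mathbb{Q}^2\times\mathbb{Q}^2$, $z^0=[q^0]_+$, $\lambda^0=[q^0]_-$. (For $\tau=1$ this initialization generates a sequence of minimal period $66$.) *)

(* Defs.v *)
From mathcomp Require Import all_boot all_order all_algebra.
From mathcomp Require Import all_classical all_reals all_analysis.
From mathcomp Require Import complex.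

Set Implicit Arguments.
Unset Strict Implicit.
Unset Printing Implicit Defensive.

Import Order.TTheory GRing.Theory Num.Theory.
Import numFieldNormedType.Exports.

Local Open Scope classical_set_scope.
Local Open Scope ring_scope.

Section Data.
Variable R : realFieldType.

(* The decimal number 0.s_0 s_1 s_2 ...; a numeral with ten digits would be
   elaborated to a unary natural number. *)
Definition dec (s : seq nat) : R := foldr (fun c x => (c%:R + x) / 10) 0 s.

Definition vec2 (a b : R) : 'cV[R]_2 := \col_i [:: a; b]`_i.
Definition diag2 (a b : R) : 'M[R]_2 := diag_mx (\row_i [:: a; b]`_i).

Definition eps : R := 1 / 1000.
Definition mu : R := 8957 / 10000.
Definition nu : R := 999 / 1000.
Definition d1 : 'cV[R]_2 := vec2 (-1) 20.
Definition d2 : 'cV[R]_2 := vec2 (-1) 10.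

(* Eigenvalue [c] along [d] and [eps] on the orthogonal complement of [d]. *)
Definition rank1_mx (c : R) (d : 'cV[R]_2) : 'M[R]_2 :=
  eps%:M + ((c - eps) / (d^T *m d) 0 0) *: (d *m d^T).

Definition M : 'M[R]_2 := rank1_mx mu d1.
Definition N : 'M[R]_2 := rank1_mx nu d2.
Definition Q1 : 'M[R]_2 := invmx M - 1%:M.
Definition Q2 : 'M[R]_2 := invmx N - 1%:M.

Definition zstar : 'cV[R]_2 := vec2 0 1.
Definition lstar : 'cV[R]_2 := vec2 (-1) 0.
Definition xstar : 'cV[R]_2 := invmx Q1 *m lstar.
Definition ystar : 'cV[R]_2 := invmx Q2 *m lstar.
Definition bbar : 'cV[R]_2 := xstar + ystar + zstar.

Definition posdef (n : nat) (A : 'M[R]_n) : Prop :=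
  A^T = A /\ forall v : 'cV[R]_n, v != 0 -> 0 < (v^T *m A *m v) 0 0.

Definition pos_part (n : nat) (a : 'cV[R]_n) : 'cV[R]_n :=
  map_mx (fun t => Num.max t 0) a.
Definition neg_part (n : nat) (a : 'cV[R]_n) : 'cV[R]_n :=
  map_mx (fun t => Num.min t 0) a.

Definition nonneg_orthant (n : nat) : set 'cV[R]_n :=
  [set z | forall i, 0 <= z i 0].

Definition normal_cone (n : nat) (C : set 'cV[R]_n) (z : 'cV[R]_n) :
    set 'cV[R]_n :=
  [set l | C z /\ forall u, C u -> (l^T *m (u - z)) 0 0 <= 0].

(* KKT system of
     min x^T Q1 x / 2 + y^T Q2 y / 2 + iota_{z >= 0}(z)  s.t.  x + y + z = bbar,
   with [l] the multiplier of the linear constraint. *)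
Definition is_KKT (x y z l : 'cV[R]_2) : Prop :=
  [/\ Q1 *m x = l, Q2 *m y = l, x + y + z = bbar, @nonneg_orthant 2 z
    & normal_cone (@nonneg_orthant 2) z l].

(* The state (y, z, lambda) is stored as one column of height 6. *)
Definition state (y z l : 'cV[R]_2) : 'cV[R]_(2 + 2 + 2) :=
  col_mx (col_mx y z) l.
Definition ypart (w : 'cV[R]_(2 + 2 + 2)) : 'cV[R]_2 := usubmx (usubmx w).
Definition zpart (w : 'cV[R]_(2 + 2 + 2)) : 'cV[R]_2 := dsubmx (usubmx w).
Definition lpart (w : 'cV[R]_(2 + 2 + 2)) : 'cV[R]_2 := dsubmx w.

Definition wstar : 'cV[R]_(2 + 2 + 2) := state ystar zstar lstar.

(* x^{k+1} as a function of w^k *)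
Definition admm_x (w : 'cV[R]_(2 + 2 + 2)) : 'cV[R]_2 :=
  M *m (bbar - ypart w - zpart w + lpart w).

Definition admm_step (tau : R) (w : 'cV[R]_(2 + 2 + 2)) :
    'cV[R]_(2 + 2 + 2) :=
  let x := admm_x w in
  let y := N *m (bbar - x - zpart w + lpart w) in
  let z := pos_part (bbar - x - y + lpart w) in
  let l := lpart w - tau *: (x + y + z - bbar) in
  state y z l.

Definition admm_seq (tau : R) (w0 : 'cV[R]_(2 + 2 + 2)) (k : nat) :
    'cV[R]_(2 + 2 + 2) :=
  iter k (admm_step tau) w0.

Definition D00 : 'M[R]_2 := diag2 0 0.
Definition D01 : 'M[R]_2 := diag2 0 1.

Definition block3_mx (A11 A12 A13 A21 A22 A23 A31 A32 A33 : 'M[R]_2) :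
    'M[R]_(2 + 2 + 2) :=
  block_mx (block_mx A11 A12 A21 A22) (col_mx A13 A23) (row_mx A31 A32) A33.

Definition Cy : 'M[R]_2 := (1%:M - N) *m M.
Definition Cz : 'M[R]_2 := N + (1%:M - N) *m M.
Definition Cl : 'M[R]_2 := (1%:M - N) *m (1%:M - M).

Definition T01_0 : 'M[R]_(2 + 2 + 2) :=
  block3_mx (N *m M)    (- (N *m (1%:M - M))) (N *m (1%:M - M))
            (D01 *m Cy) (D01 *m Cz)           (D01 *m Cl)
            0           0                     1%:M.

Definition T01_1 : 'M[R]_(2 + 2 + 2) :=
  block3_mx 0                     0                     0
            0                     0                     0
            ((1%:M - D01) *m Cy)  ((1%:M - D01) *m Cz)  ((1%:M - D01) *m Cl - 1%:M).

Definition T01 (tau : R) : 'M[R]_(2 + 2 + 2) := T01_0 + tau *: T01_1.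

Definition hvec : 'cV[R]_(2 + 2) :=
  let g := (1%:M - M) *m bbar in
  col_mx (N *m g) ((1%:M - N) *m g).

Definition TD (D : 'M[R]_2) : 'M[R]_(2 + 2) :=
  let S := D *+ 2 - 1%:M in
  block_mx (N *m M)            (- (N *m (1%:M - M) *m S))
           ((1%:M - N) *m M)   (D - (1%:M - N) *m (1%:M - M) *m S).

Definition LD (D : 'M[R]_2) : 'M[R]_(2 + 2 + 1) :=
  block_mx (TD D) hvec 0 1%:M.

Definition cycle66 : 'M[R]_(2 + 2 + 1) := LD D01 ^+ 64 *m LD D00 ^+ 2.
Definition cycle66_P : 'M[R]_(2 + 2) := ulsubmx cycle66.
Definition cycle66_a : 'cV[R]_(2 + 2) := ursubmx cycle66.

Definition init66_yq : 'cV[R]_(2 + 2) := invmx (1%:M - cycle66_P) *m cycle66_a.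

Definition init66 : 'cV[R]_(2 + 2 + 2) :=
  let y := usubmx init66_yq in
  let q := dsubmx init66_yq in
  state y (pos_part q) (neg_part q).

End Data.

Section Stability.
Variable R : realType.

Definition normH (n : nat) (H : 'M[R]_n) (e : 'cV[R]_n) : R :=
  Num.sqrt ((e^T *m H *m e) 0 0).

Definition is_norm (n : nat) (nrm : 'cV[R]_n -> R) : Prop :=
  [/\ forall v, nrm v = 0 -> v = 0,
      forall (a : R) v, nrm (a *: v) = `|a| * nrm v
    & forall u v, nrm (u + v) <= nrm u + nrm v].

Definition Qlin_attracting_on (tau : R) (U : set 'cV[R]_(2 + 2 + 2))
    (nrm : 'cV[R]_(2 + 2 + 2) -> R) (kappa : R) : Prop :=
  [/\ nbhs (wstar R) U, is_norm nrm, 0 < kappa < 1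
    & forall w0, U w0 -> forall k,
        U (admm_seq tau w0 k) /\
        nrm (admm_seq tau w0 k.+1 - wstar R)
          <= kappa * nrm (admm_seq tau w0 k - wstar R)].

Definition locally_Qlin_attracting (tau : R) : Prop :=
  exists U nrm kappa, Qlin_attracting_on tau U nrm kappa.

Definition spectral_radius (n : nat) (A : 'M[R]_n) : R :=
  sup [set ComplexField.Normc.normc z | z in
        [set z : R[i] | eigenvalue (map_mx (real_complex R) A) z]].

Definition schur_stable (n : nat) (A : 'M[R]_n) : Prop :=
  spectral_radius A < 1.

End Stability.

(* Main.v *)
From HB Require Import structures.
From Stdlib Require Import ZArith.
Require Import Defs.
From mathcomp Require Import all_boot all_order all_algebra.
From mathcomp Require Import all_classical all_reals all_analysis.
From mathcomp Require Import complex ssrZ zify ring lra.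

(** Write [w = wstar + e] and follow [e]. The two inner minimisations are linear
    maps ([M] and [N] are the resolvents of [Q1] and [Q2]), so the step is linear in
    [e] apart from the positive and negative part of a vector [q] with
    [q = (-1, 1)] at the KKT point. As long as the signs of [q] persist, the step is
    the linear map [T01 tau] ([err_step_T01]). The three parts of the theorem are
    three facts about this map.

    Part 1. [T01] is affine in [tau] and norms are convex, so a metric that
    contracts at [tau = 49 / 100] and at [tau = 51 / 100] contracts in between. An
    explicit [H = A^T A] with integer [A] does; contraction at the two ends and the
    inclusion of an [H]-ball in the region of constant signs are positivity
    statements for integer quadratic forms, decided by completing squares
    ([metric_contraction], [ball_in_region]).

    Part 2. It remains to see the trajectory enter that ball. The period-66 point is
    the solution of a linear system given through 66 affine steps. An approximate
    solution and an approximate inverse yield, by a Neumann series argument, both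
    the invertibility of the system ([cycle66_unit]) and a rigorous enclosure of the
    point ([init66_yq_near]). Interval arithmetic with integer end points then
    follows the nonlinear iteration, uniformly in [|tau - 1 / 2| <= 10^-10], until
    it is inside the ball ([init66_enters]).

    Part 3. Local attraction is equivalent to Schur stability of [T01 tau]
    ([attracting_schur]): a contracting norm bounds the eigenvalues, and conversely a
    Schur triangular form gives an adapted norm. Two of the six eigenvalues are [0]
    and [1 - tau]; the others are the roots of a quartic whose coefficients are
    affine in [tau] ([eigenvalue_T01], [det_red_mx]). By the Schur-Cohn criterion,
    for quartics, in both directions ([quartic_stable],
    [stable_quartic]), and because the other conditions always hold for
    [0 < tau < 1], stability is the positivity of a single cubic in [tau]
    ([schur_T01]). That cubic decreases on [[0, 1]] ([juryf_decr]) and changes sign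
    between the two given decimals ([juryf_root]); its zero is [tau_c]. *)

Set Implicit Arguments.
Unset Strict Implicit.
Unset Printing Implicit Defensive.

Import Order.TTheory GRing.Theory Num.Theory.
Import numFieldNormedType.Exports.

Local Open Scope classical_set_scope.
Local Open Scope ring_scope.
Delimit Scope Z_scope with BZ.

(** * Scalar matrices plus a rank-one matrix *)

Section KKT.
Variable R : realFieldType.
Implicit Types (a c : R) (d u v : 'cV[R]_2).

Lemma dot2E u v : (u^T *m v) 0 0 = u 0 0 * v 0 0 + u 1 0 * v 1 0.
Proof. by rewrite !mxE !big_ord_recl big_ord0 !mxE addr0; congr (_ + _ * _); congr (_ _ _); apply/val_inj. Qed.

Lemma ord2P (i : 'I_2) : i = 0 \/ i = 1.
Proof. by case: i => [[|[|//]] ?]; [left|right]; apply/val_inj. Qed.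

Lemma cv2P u v : u 0 0 = v 0 0 -> u 1 0 = v 1 0 -> u = v.
Proof.
by move=> h0 h1; apply/matrixP => i j; rewrite (ord1 j); case: (ord2P i) => ->.
Qed.

(** The symmetric matrix with eigenvalue [c] along [d] and [a] on the orthogonal
    complement of [d]; [M], [N] and their inverses are all of this kind. *)
Definition spec_mx a c d : 'M[R]_2 :=
  a%:M + ((c - a) / (d^T *m d) 0 0) *: (d *m d^T).

Lemma dot_mx11 u v : u^T *m v = ((u^T *m v) 0 0)%:M.
Proof. by rewrite -mx11_scalar. Qed.

Lemma spec_mxM a c a' c' d : (d^T *m d) 0 0 != 0 ->
  spec_mx a c d *m spec_mx a' c' d = spec_mx (a * a') (c * c') d.
Proof.
move=> d0; rewrite /spec_mx; set n := (_ *m d) 0 0 in d0 *.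
have PP : (d *m d^T) *m (d *m d^T) = n *: (d *m d^T).
  by rewrite -mulmxA (mulmxA d^T) dot_mx11 mul_scalar_mx -scalemxAr.
rewrite mulmxDl !mulmxDr -scalar_mxM mul_scalar_mx mul_mx_scalar -scalemxAl -scalemxAr PP.
rewrite !scalerA -!addrA -!scalerDl; congr (_ + _ *: _).
by field.
Qed.

Lemma spec_mx_scalar a d : spec_mx a a d = a%:M.
Proof. by rewrite /spec_mx subrr mul0r scale0r addr0. Qed.

Lemma spec_mxB a c a' c' d : spec_mx a c d - spec_mx a' c' d = spec_mx (a - a') (c - c') d.
Proof.
rewrite /spec_mx opprD addrACA -scalerBl -raddfB; congr (_ + _ *: _); ring.
Qed.

Lemma spec_mx_inv a c d : (d^T *m d) 0 0 != 0 -> a != 0 -> c != 0 ->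
  (spec_mx a c d \in unitmx) /\ invmx (spec_mx a c d) = spec_mx a^-1 c^-1 d.
Proof.
move=> d0 a0 c0.
have h : spec_mx a c d *m spec_mx a^-1 c^-1 d = 1%:M.
  by rewrite spec_mxM // !mulfV // spec_mx_scalar.
have [u _] := mulmx1_unit h; split=> //.
by rewrite -[LHS]mulmx1 -h mulmxA mulVmx // mul1mx.
Qed.

Lemma spec_mx_posdef a c d : (d^T *m d) 0 0 != 0 -> 0 < a -> 0 < c ->
  posdef (spec_mx a c d).
Proof.
move=> d0 a0 c0; split.
  by rewrite /spec_mx linearD /= tr_scalar_mx linearZ /= trmx_mul trmxK.
move=> v v0.
rewrite /spec_mx mulmxDr mulmxDl mul_mx_scalar -scalemxAl -scalemxAr -scalemxAl.
rewrite (mulmxA v^T) -(mulmxA _ d^T) (dot_mx11 d v) mul_mx_scalar.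
rewrite [X in 0 < X]mxE [X in X + _]mxE [X in _ + X]mxE [X in _ + _ * X]mxE !dot2E.
have {}v0 : 0 < v 0 0 ^+ 2 + v 1 0 ^+ 2.
  rewrite lt_neqAle addr_ge0 ?sqr_ge0 // andbT eq_sym; apply: contra v0.
  rewrite paddr_eq0 ?sqr_ge0 // !sqrf_eq0 => /andP[/eqP h0 /eqP h1].
  by apply/eqP; apply: cv2P; rewrite ?h0 ?h1 mxE.
move: d0; rewrite dot2E.
set x := v 0 0 in v0 *; set y := v 1 0 in v0 *; set p := d 0 0; set q := d 1 0 => d0.
have dp : 0 < p * p + q * q.
  by rewrite lt_neqAle eq_sym d0 /= addr_ge0 // -expr2 sqr_ge0.
(* Pythagoras along [d] and its orthogonal line. *)
have -> : a * (x * x + y * y) + (c - a) / (p * p + q * q) *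
    ((p * x + q * y) * (x * p + y * q)) =
  (a * (x * q - y * p) ^+ 2 + c * (x * p + y * q) ^+ 2) / (p * p + q * q).
  by field.
have h1 : 0 <= a * (x * q - y * p) ^+ 2 by rewrite mulr_ge0 ?sqr_ge0 ?ltW.
have h2 : 0 <= c * (x * p + y * q) ^+ 2 by rewrite mulr_ge0 ?sqr_ge0 ?ltW.
apply: divr_gt0 => //; rewrite lt_neqAle addr_ge0 // andbT eq_sym paddr_eq0 //.
rewrite !mulf_eq0 !orbb (gt_eqF a0) (gt_eqF c0) /=; apply/negP => /andP[/eqP {}h1 /eqP {}h2].
have : (p * p + q * q) * (x ^+ 2 + y ^+ 2) = 0.
  by transitivity ((x * q - y * p) ^+ 2 + (x * p + y * q) ^+ 2); [ring|rewrite h1 h2; ring].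
by move/eqP; rewrite mulf_eq0 !gt_eqF.
Qed.

Lemma posdef_unit n (A : 'M[R]_n) : posdef A -> A \in unitmx.
Proof.
move=> [As Ap]; rewrite -row_free_unit -kermx_eq0; apply/negP => /negP.
case/rowV0Pn => v /sub_kermxP vA v0.
have := Ap v^T; rewrite trmx_eq0 trmxK => /(_ v0).
by rewrite vA mul0mx mxE ltxx.
Qed.

End KKT.

(** * The KKT point and the step relative to it *)

Section Model.
Variable R : realFieldType.
Implicit Types (tau : R) (e w : 'cV[R]_(2 + 2 + 2)) (y z l : 'cV[R]_2).

Lemma d1_sqr : ((d1 R)^T *m d1 R) 0 0 = 401.
Proof. by rewrite dot2E !mxE /=; ring. Qed.

Lemma d2_sqr : ((d2 R)^T *m d2 R) 0 0 = 101.
Proof. by rewrite dot2E !mxE /=; ring. Qed.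

Lemma M_spec : M R = spec_mx (eps R) (mu R) (d1 R). Proof. by []. Qed.
Lemma N_spec : N R = spec_mx (eps R) (nu R) (d2 R). Proof. by []. Qed.

Let d1_neq0 : ((d1 R)^T *m d1 R) 0 0 != 0. Proof. by rewrite d1_sqr pnatr_eq0. Qed.
Let d2_neq0 : ((d2 R)^T *m d2 R) 0 0 != 0. Proof. by rewrite d2_sqr pnatr_eq0. Qed.
Let eps_gt0 : 0 < eps R. Proof. by rewrite /eps; lra. Qed.
Let mu_gt0 : 0 < mu R. Proof. by rewrite /mu; lra. Qed.
Let nu_gt0 : 0 < nu R. Proof. by rewrite /nu; lra. Qed.

Lemma M_unit : M R \in unitmx.
Proof. by have [] := spec_mx_inv d1_neq0 (lt0r_neq0 eps_gt0) (lt0r_neq0 mu_gt0). Qed.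

Lemma N_unit : N R \in unitmx.
Proof. by have [] := spec_mx_inv d2_neq0 (lt0r_neq0 eps_gt0) (lt0r_neq0 nu_gt0). Qed.

Lemma Q1_posdef : posdef (Q1 R).
Proof.
rewrite /Q1 M_spec (spec_mx_inv d1_neq0 (lt0r_neq0 eps_gt0) (lt0r_neq0 mu_gt0)).2.
rewrite -(spec_mx_scalar 1 (d1 R)) spec_mxB; apply: spec_mx_posdef => //.
  by rewrite subr_gt0 invf_gt1 // /eps; lra.
by rewrite subr_gt0 invf_gt1 // /mu; lra.
Qed.

Lemma Q2_posdef : posdef (Q2 R).
Proof.
rewrite /Q2 N_spec (spec_mx_inv d2_neq0 (lt0r_neq0 eps_gt0) (lt0r_neq0 nu_gt0)).2.
rewrite -(spec_mx_scalar 1 (d2 R)) spec_mxB; apply: spec_mx_posdef => //.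
  by rewrite subr_gt0 invf_gt1 // /eps; lra.
by rewrite subr_gt0 invf_gt1 // /nu; lra.
Qed.

Lemma Q1_xstar : Q1 R *m xstar R = lstar R.
Proof. by rewrite /xstar mulKVmx ?posdef_unit //; exact: Q1_posdef. Qed.

Lemma Q2_ystar : Q2 R *m ystar R = lstar R.
Proof. by rewrite /ystar mulKVmx ?posdef_unit //; exact: Q2_posdef. Qed.

(** [M] is the resolvent of [Q1] and [N] that of [Q2]: the KKT equations say that
    the two inner minimisations return the KKT point itself. *)
Lemma xstar_prox : xstar R = M R *m (xstar R + lstar R).
Proof.
rewrite -Q1_xstar /Q1 mulmxBl mul1mx addrC subrK mulmxA mulmxV ?mul1mx //.
exact: M_unit.
Qed.

Lemma ystar_prox : ystar R = N R *m (ystar R + lstar R).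
Proof.
rewrite -Q2_ystar /Q2 mulmxBl mul1mx addrC subrK mulmxA mulmxV ?mul1mx //.
exact: N_unit.
Qed.

Lemma KKT_star : is_KKT (xstar R) (ystar R) (zstar R) (lstar R).
Proof.
have z0 : nonneg_orthant (zstar R).
  by move=> i; rewrite !mxE; case: i => [[|[|[]]]] //= *; rewrite ?ler01.
split=> //; [exact: Q1_xstar|exact: Q2_ystar|split=> // u u0].
have := u0 0; rewrite dot2E !mxE /=; lra.
Qed.

Lemma posdef_ge0 n (A : 'M[R]_n) (v : 'cV[R]_n) : posdef A -> 0 <= (v^T *m A *m v) 0 0.
Proof.
move=> [_ Ap]; have [->|v0] := eqVneq v 0; last exact/ltW/Ap.
by rewrite mulmx0 mxE.
Qed.

Lemma posdef_eq0 n (A : 'M[R]_n) (v : 'cV[R]_n) : posdef A -> (v^T *m A *m v) 0 0 <= 0 -> v = 0.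
Proof.
move=> [_ Ap] h; apply/eqP/negP => /negP/Ap; rewrite ltNge; exact/negP/negPn.
Qed.

(** Monotonicity of the KKT operator: for two KKT points the two quadratic
    forms sum to [- dz^T dlambda], which the normal cone makes nonpositive. *)
Lemma KKT_unique (x y z l x' y' z' l' : 'cV[R]_2) :
  is_KKT x y z l -> is_KKT x' y' z' l' -> [/\ x = x', y = y', z = z' & l = l'].
Proof.
move=> [qx qy xyz z0 [_ nz]] [qx' qy' xyz' z0' [_ nz']].
have hz : 0 <= ((l - l')^T *m (z - z')) 0 0.
  have := nz _ z0'; have := nz' _ z0; rewrite !dot2E !mxE; lra.
have hq : ((x - x')^T *m Q1 R *m (x - x')) 0 0 + ((y - y')^T *m Q2 R *m (y - y')) 0 0
   = - ((l - l')^T *m (z - z')) 0 0.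
  rewrite -!mulmxA !mulmxBr qx qx' qy qy' -!mulmxBr.
  have -> : z - z' = - (x - x') - (y - y').
    have -> : z = bbar R - x - y by rewrite -xyz; apply/matrixP => i j; rewrite !mxE; ring.
    have -> : z' = bbar R - x' - y' by rewrite -xyz'; apply/matrixP => i j; rewrite !mxE; ring.
    by apply/matrixP => i j; rewrite !mxE; ring.
  by rewrite !dot2E !mxE; ring.
have p1 := posdef_ge0 (x - x') Q1_posdef.
have p2 := posdef_ge0 (y - y') Q2_posdef.
have ex : x = x' by apply/subr0_eq/(posdef_eq0 Q1_posdef); lra.
have ey : y = y' by apply/subr0_eq/(posdef_eq0 Q2_posdef); lra.
split=> //; last by rewrite -qx ex.
by move: xyz'; rewrite -xyz ex ey => /addrI.
Qed.

(** The perturbation of [bbar - x - z + lambda], the argument of the update of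
    [y], when the state is perturbed by [e] and [x] has been updated. *)
Definition gvec e := M R *m ypart e + (1%:M - M R) *m (lpart e - zpart e).

(** The argument of the projection in the update of [z], at the KKT point and
    at the KKT point perturbed by [e]. *)
Definition qstar := zstar R + lstar R.
Definition qvec e := qstar + ((1%:M - N R) *m gvec e + zpart e).

(** One step in the variables [w - wstar]. As [z] is the positive part of [q],
    the residual [x + y + z - bbar] is [lambda] minus the negative part of [q],
    and the multiplier moves to the mean of the two with weights [1 - tau] and
    [tau]. *)
Definition err_step tau e :=
  state (N R *m gvec e) (pos_part (qvec e) - zstar R)
    ((1 - tau) *: lpart e + tau *: (neg_part (qvec e) - lstar R)).

Lemma state_parts w : state (ypart w) (zpart w) (lpart w) = w.
Proof. by rewrite /state /ypart /zpart /lpart !vsubmxK. Qed.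

Lemma ypart_state y z l : ypart (state y z l) = y.
Proof. by rewrite /ypart /state !col_mxKu. Qed.
Lemma zpart_state y z l : zpart (state y z l) = z.
Proof. by rewrite /zpart /state col_mxKu col_mxKd. Qed.
Lemma lpart_state y z l : lpart (state y z l) = l.
Proof. by rewrite /lpart /state col_mxKd. Qed.

Lemma stateD y z l y' z' l' :
  state y z l + state y' z' l' = state (y + y') (z + z') (l + l').
Proof. by rewrite /state !add_col_mx. Qed.

Lemma ypartD e w : ypart (e + w) = ypart e + ypart w.
Proof. by rewrite /ypart !linearD. Qed.
Lemma zpartD e w : zpart (e + w) = zpart e + zpart w.
Proof. by rewrite /zpart !linearD. Qed.
Lemma lpartD e w : lpart (e + w) = lpart e + lpart w.
Proof. by rewrite /lpart !linearD. Qed.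

Lemma pos_neg_part n (q : 'cV[R]_n) : pos_part q + neg_part q = q.
Proof. by apply/matrixP => i j; rewrite !mxE addr_max_min addr0. Qed.

Lemma admm_x_err e :
  admm_x (wstar R + e) = xstar R + M R *m (lpart e - ypart e - zpart e).
Proof.
rewrite /admm_x ypartD zpartD lpartD /wstar ypart_state zpart_state lpart_state.
rewrite {1}xstar_prox -mulmxDr; congr (_ *m _); rewrite /bbar.
by apply/matrixP => i j; rewrite !mxE; ring.
Qed.

Lemma admm_step_err tau e :
  admm_step tau (wstar R + e) = wstar R + err_step tau e.
Proof.
rewrite /admm_step admm_x_err zpartD lpartD {1 2 4 5 6 7}/wstar zpart_state lpart_state.
set dx := M R *m _.
have g_dx : - dx - zpart e + lpart e = gvec e.
  rewrite /gvec mulmxBl mul1mx /dx !mulmxBr.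
  by apply/matrixP => i j; rewrite !mxE; ring.
have -> : N R *m (bbar R - (xstar R + dx) - (zstar R + zpart e) + (lstar R + lpart e))
   = ystar R + N R *m gvec e.
  rewrite {1}ystar_prox -g_dx -mulmxDr; congr (_ *m _); rewrite /bbar.
  by apply/matrixP => i j; rewrite !mxE; ring.
have -> : bbar R - (xstar R + dx) - (ystar R + N R *m gvec e) + (lstar R + lpart e) = qvec e.
  rewrite /qvec /qstar mulmxBl mul1mx; move: (N R *m _) => Ng; rewrite -g_dx /bbar.
  by apply/matrixP => i j; rewrite !mxE; ring.
have -> : xstar R + dx + (ystar R + N R *m gvec e) + pos_part (qvec e) - bbar R
    = lstar R + lpart e - neg_part (qvec e).
  rewrite -[neg_part _](addKr (pos_part (qvec e))) pos_neg_part /qvec /qstar.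
  rewrite mulmxBl mul1mx; move: (N R *m _) (pos_part _) => Ng p; rewrite -g_dx /bbar.
  by apply/matrixP => i j; rewrite !mxE; ring.
rewrite /err_step /wstar stateD; congr (state _ _ _); first by rewrite addrC subrK.
by apply/matrixP => i j; rewrite !mxE; ring.
Qed.

Lemma admm_seq_err tau e k :
  admm_seq tau (wstar R + e) k - wstar R = iter k (err_step tau) e.
Proof.
rewrite /admm_seq; elim: k => [|k IH] /=; first by rewrite addrC addKr.
have -> : iter k (admm_step tau) (wstar R + e) = wstar R + iter k (err_step tau) e.
  by rewrite -IH [RHS]addrC subrK.
by rewrite admm_step_err [LHS]addrC addKr.
Qed.

(** The blocks [Cy], [Cz], [Cl] assemble the perturbation of [q], so that
    [T01] is [err_step] with [D01] and [1 - D01] in place of the positive and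
    the negative part. *)
Lemma T01_state tau y z l :
  let s := (1%:M - N R) *m gvec (state y z l) + z in
  T01 tau *m state y z l = state (N R *m gvec (state y z l)) (D01 R *m s)
    (l + tau *: ((1%:M - D01 R) *m s - l)).
Proof.
have TE (A B C A' B' C' A2 B2 C2 : 'M[R]_2) :
    block3_mx A B C A' B' C' A2 B2 C2 *m state y z l =
    state (A *m y + B *m z + C *m l) (A' *m y + B' *m z + C' *m l)
      (A2 *m y + B2 *m z + C2 *m l).
  by rewrite /block3_mx /state !mul_block_col mul_row_col mul_col_mx add_col_mx.
move=> s; rewrite /T01 (mulmxDl (T01_0 R)) -scalemxAl /T01_0 /T01_1 !TE !mul0mx !add0r.
have -> : s = Cy R *m y + Cz R *m z + Cl R *m l.
  rewrite /s /gvec ypart_state zpart_state lpart_state /Cy /Cz /Cl !mulmxDr !mulmxA.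
  rewrite !(mulmxDl, mulmxDr, mulmxBl, mulmxBr, mulmx1, mul1mx, mulNmx, mulmxN).
  by apply/matrixP => i j; rewrite !mxE; ring.
rewrite {1}/state scale_col_mx scale_col_mx !scaler0 -/(state _ _ _) !stateD.
rewrite !addr0 mul1mx; congr (state _ _ _).
- rewrite /gvec ypart_state zpart_state lpart_state.
  rewrite !(mulmxDl, mulmxDr, mulmxBl, mulmxBr, mulmx1, mul1mx, mulNmx, mulmxN, mulmxA).
  by apply/matrixP => i j; rewrite !mxE; ring.
- by move: (Cy R) (Cz R) (Cl R) => cy cz cl; rewrite !mulmxDr !mulmxA.
- move: (Cy R) (Cz R) (Cl R) => cy cz cl; congr (_ + _ *: _).
  by rewrite !mulmxDr (mulmxBl (_ *m cl)) mul1mx !mulmxA addrA.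
Qed.

Lemma D01_0 (v : 'cV[R]_2) : (D01 R *m v) 0 0 = 0.
Proof. by rewrite mxE !big_ord_recl big_ord0 !mxE /= mul0r mulr0n mul0r !addr0. Qed.

Lemma D01_1 (v : 'cV[R]_2) : (D01 R *m v) 1 0 = v 1 0.
Proof.
rewrite mxE !big_ord_recl big_ord0 !mxE /= mul1r mulr0n mul0r add0r addr0.
by congr (v _ _); apply/val_inj.
Qed.

(** Near the KKT point the signs of [qvec] are those of [qstar], so the step
    is the linear map [T01]. *)
Lemma err_step_T01 tau e : qvec e 0 0 <= 0 -> 0 <= qvec e 1 0 ->
  err_step tau e = T01 tau *m e.
Proof.
move=> q0 q1; rewrite -[e in RHS]state_parts T01_state state_parts /err_step.
have sE : (1%:M - N R) *m gvec e + zpart e = qvec e - qstar by rewrite /qvec [RHS]addrC addKr.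
rewrite sE {sE}; move: (qvec e) (lpart e) q0 q1 => q l q0 q1.
by congr (state _ _ _); apply: cv2P;
  rewrite ?mulmxBl ?mul1mx !(D01_0, D01_1, mxE) /= ?(max_r q0) ?(max_l q1) ?(min_l q0) ?(min_r q1);
  ring.
Qed.
End Model.

(** * Integer vectors and quadratic forms *)

Local Arguments Z.mul : simpl never.
Local Arguments Z.add : simpl never.
Local Arguments Z.opp : simpl never.

(** The numerical certificates are computed on binary integers and transported
    to the field by this morphism. It is locked because unification would
    otherwise evaluate it on large constants. *)
HB.lock Definition zr (R : realFieldType) (a : Z) : R := (int_of_Z a)%:~R.

Section Reflection.
Variable R : realFieldType.
Implicit Types (a b : Z) (c d : seq Z) (x y : R) (v : seq R).

Local Notation zr := (zr R).

Lemma zrD a b : zr (a + b)%BZ = zr a + zr b.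
Proof. by rewrite !zr.unlock (rmorphD int_of_Z) rmorphD. Qed.
Lemma zrN a : zr (- a)%BZ = - zr a.
Proof. by rewrite !zr.unlock (rmorphN int_of_Z) rmorphN. Qed.
Lemma zrB a b : zr (a - b)%BZ = zr a - zr b.
Proof. by rewrite zrD zrN. Qed.
Lemma zrM a b : zr (a * b)%BZ = zr a * zr b.
Proof. by rewrite !zr.unlock (rmorphM int_of_Z) rmorphM. Qed.
Lemma zr0 : zr 0 = 0. Proof. by rewrite zr.unlock. Qed.
Lemma zr1 : zr 1 = 1. Proof. by rewrite zr.unlock. Qed.
Lemma zr_xO p : zr (Zpos p~0) = 2 * zr (Zpos p).
Proof. by rewrite Pos2Z.inj_xO zrM; congr (_ * _); rewrite zr.unlock. Qed.
Lemma zr_xI p : zr (Zpos p~1) = 2 * zr (Zpos p) + 1.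
Proof. by rewrite Pos2Z.inj_xI zrD zrM; congr (_ * _ + _); rewrite zr.unlock. Qed.
Lemma zr_neg p : zr (Zneg p) = - zr (Zpos p).
Proof. by rewrite -zrN. Qed.
Definition zrE := (zr_neg, zr_xO, zr_xI, zr1, zr0).

Lemma zr_le a b : (zr a <= zr b) = (a <=? b)%BZ.
Proof. by rewrite !zr.unlock ler_int; case: (Z.leb_spec a b); lia. Qed.
Lemma zr_lt a b : (zr a < zr b) = (a <? b)%BZ.
Proof. by rewrite !zr.unlock ltr_int; case: (Z.ltb_spec a b); lia. Qed.
Lemma zr_eq0 a : (zr a == 0) = (a =? 0)%BZ.
Proof. by rewrite !zr.unlock intr_eq0; case: (Z.eqb_spec a 0); lia. Qed.

(** Lists of different lengths are padded with zeros. *)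
Fixpoint dot (c : seq Z) v : R :=
  if c is a :: c' then (if v is x :: v' then zr a * x + dot c' v' else 0) else 0.

Lemma dot_nil c : dot c [::] = 0. Proof. by case: c. Qed.

Lemma dot_scale x c v : dot c [seq x * y | y <- v] = x * dot c v.
Proof.
elim: c v => [|a c IH] [|y v] /=; rewrite ?mulr0 //.
by rewrite IH mulrDr mulrCA.
Qed.

Definition lscale a (c : seq Z) := [seq (a * b)%BZ | b <- c].

Lemma dot_lscale a c v : dot (lscale a c) v = zr a * dot c v.
Proof.
by elim: c v => [|b c IH] [|x v] /=; rewrite ?mulr0 ?IH ?zrM ?mulrDr ?mulrA.
Qed.

Fixpoint ladd (c d : seq Z) : seq Z :=
  match c, d with
  | a :: c', b :: d' => (a + b)%BZ :: ladd c' d'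
  | [::], _ => d
  | _, [::] => c
  end.

Lemma dot_ladd c d v : dot (ladd c d) v = dot c v + dot d v.
Proof.
elim: c d v => [|a c IH] [|b d] [|x v] /=; rewrite ?(addr0, add0r) //.
by rewrite IH zrD mulrDl addrACA.
Qed.

(** A quadratic form is stored as an upper triangle: the row at the variable
    [x] lists the coefficients of [x] times the variables from [x] on. *)
Fixpoint qform (Q : seq (seq Z)) v : R :=
  if Q is c :: Q' then
    (if v is x :: v' then x * dot c v + qform Q' v' else 0)
  else 0.

Fixpoint qadd (P Q : seq (seq Z)) : seq (seq Z) :=
  match P, Q with
  | c :: P', d :: Q' => ladd c d :: qadd P' Q'
  | [::], _ => Q
  | _, [::] => P
  end.

Lemma qform_nil Q : qform Q [::] = 0. Proof. by case: Q. Qed.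

Lemma qform_qadd P Q v : qform (qadd P Q) v = qform P v + qform Q v.
Proof.
elim: P Q v => [|c P IH] [|d Q] [|x v]; rewrite ?qform_nil /= ?addr0 ?add0r //.
by rewrite IH dot_ladd mulrDr addrACA.
Qed.

Definition qscale a (Q : seq (seq Z)) := [seq lscale a c | c <- Q].

Lemma qform_qscale a Q v : qform (qscale a Q) v = zr a * qform Q v.
Proof.
elim: Q v => [|c Q IH] [|x v] /=; rewrite ?mulr0 //.
by rewrite IH (dot_lscale a c (x :: v)) mulrDr mulrCA.
Qed.

Fixpoint qsq (c : seq Z) : seq (seq Z) :=
  if c is a :: c' then ((a * a)%BZ :: lscale (2 * a)%BZ c') :: qsq c' else [::].

Lemma qform_qsq c v : qform (qsq c) v = dot c v ^+ 2.
Proof.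
elim: c v => [|a c IH] [|x v] //=; rewrite ?expr0n //.
by rewrite IH dot_lscale !zrM !zrE; ring.
Qed.

Definition qdiv (g : Z) (Q : seq (seq Z)) := [seq [seq (a / g)%BZ | a <- c] | c <- Q].
Definition qcontent (Q : seq (seq Z)) : Z :=
  Z.max 1 (foldr (fun c g => foldr Z.gcd g c) 0%BZ Q).

(** Completing the square: [4 a Q = (2 a x + b)^2 + (4 a C - b^2)]. Removing the
    content at each stage keeps the coefficients as short as fraction-free
    elimination allows. *)
Fixpoint qpos (n : nat) (Q : seq (seq Z)) : bool :=
  match n, Q with
  | 0, _ => true
  | n'.+1, (a :: b) :: C =>
      (0 <? a)%BZ &&
      let Q1 := qadd (qscale (4 * a)%BZ C) (qscale (-1)%BZ (qsq b)) in
      let g := qcontent Q1 in let Q2 := qdiv g Q1 in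
      (qscale g Q2 == Q1) && qpos n' Q2
  | _, _ => false
  end.

Lemma qcontent_gt0 Q : 0 < zr (qcontent Q).
Proof. by rewrite -zr0 zr_lt /qcontent; apply/Z.ltb_spec0; lia. Qed.

Lemma qpos_ge0 n Q v : size v = n -> qpos n Q -> 0 <= qform Q v.
Proof.
elim: n Q v => [|n IH] [|[|a b] C] [|x v] //= [sv].
have sq := IH _ _ sv.
case/and3P; rewrite -zr_lt zr0 => a0 /eqP Q12 /sq.
set Q1 := qadd _ _ in Q12 *; have g0 := qcontent_gt0 Q1.
rewrite -(pmulr_rge0 _ g0) -qform_qscale Q12 {Q12 g0} /Q1.
rewrite qform_qadd !qform_qscale qform_qsq zrM !zrE => h.
have {}h : 0 <= 4 * zr a * (x * (zr a * x + dot b v) + qform C v).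
  have -> : 4 * zr a * (x * (zr a * x + dot b v) + qform C v) =
     (2 * zr a * x + dot b v) ^+ 2 +
     (2 * (2 * 1) * zr a * qform C v + - (1) * dot b v ^+ 2) by ring.
  by rewrite addr_ge0 ?sqr_ge0.
by rewrite pmulr_rge0 in h => //; rewrite mulr_gt0.
Qed.

Lemma qpos_gt0 n Q v : size v = n -> qpos n Q -> has (fun x => x != 0) v ->
  0 < qform Q v.
Proof.
elim: n Q v => [|n IH] [|[|a b] C] [|x v] //= [sv].
have sq := IH _ _ sv.
case/and3P; rewrite -zr_lt zr0 => a0 /eqP Q12 hp.
have := qpos_ge0 sv hp; move: (sq _ hp).
set Q1 := qadd _ _ in Q12 hp *; have g0 := qcontent_gt0 Q1.
rewrite -(pmulr_rge0 _ g0) -(pmulr_rgt0 _ g0) -!qform_qscale Q12 {Q12 hp g0} /Q1.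
rewrite qform_qadd !qform_qscale qform_qsq zrM !zrE => h h' xv.
have E : 4 * zr a * (x * (zr a * x + dot b v) + qform C v) =
     (2 * zr a * x + dot b v) ^+ 2 +
     (2 * (2 * 1) * zr a * qform C v + - (1) * dot b v ^+ 2) by ring.
have a4 : 0 < 4 * zr a by rewrite mulr_gt0.
rewrite -(pmulr_rgt0 _ a4) E.
case: (boolP (has _ v)) xv => [/h {}h _|nv]; first by rewrite ltr_wpDl ?sqr_ge0.
rewrite orbF => x0; rewrite ltr_pwDl //.
have d0 c : dot c v = 0.
  elim: v nv c {sv sq h h' E} => [|y v IHv] /=; first by move=> _ c; rewrite dot_nil.
  rewrite negb_or negbK => /andP[/eqP -> nv] [|d c] //=.
  by rewrite mulr0 add0r IHv.
by rewrite d0 addr0 exprn_even_gt0 //= !mulf_eq0 pnatr_eq0 (gt_eqF a0) (negPf x0).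
Qed.

(** * Interval arithmetic *)

(** Bounds are integers, in a unit chosen at the time of use; division rounds
    outwards. *)
Definition itv := (Z * Z)%type.
Definition enc (i : itv) x := zr i.1 <= x <= zr i.2.

Fixpoint encs (s : seq itv) v : Prop :=
  match s, v with
  | i :: s', x :: v' => enc i x /\ encs s' v'
  | [::], [::] => True
  | _, _ => False
  end.

Lemma encs_nth s v (k : nat) : encs s v -> (k < size v)%N -> enc (nth (0%BZ, 0%BZ) s k) (nth 0 v k).
Proof. by elim: s v k => [|i s IH] [|x v] [|k] //= [ei es] // /IH; apply. Qed.

Definition iadd (i j : itv) : itv := ((i.1 + j.1)%BZ, (i.2 + j.2)%BZ).
Definition iscale a (i : itv) : itv :=
  if (0 <=? a)%BZ then ((a * i.1)%BZ, (a * i.2)%BZ) else ((a * i.2)%BZ, (a * i.1)%BZ).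
Definition idiv a (i : itv) : itv := ((i.1 / a)%BZ, (- ((- i.2) / a))%BZ).
Definition icst a : itv := (a, a).
Definition iabs (i : itv) : Z := Z.max (- i.1) i.2.
Definition imax0 (i : itv) : itv := (Z.max i.1 0, Z.max i.2 0).
Definition imin0 (i : itv) : itv := (Z.min i.1 0, Z.min i.2 0).

Lemma enc_iadd i j x y : enc i x -> enc j y -> enc (iadd i j) (x + y).
Proof. by move=> /andP[h1 h2] /andP[h3 h4]; rewrite /enc !zrD !lerD. Qed.

Lemma enc_iscale a i x : enc i x -> enc (iscale a i) (zr a * x).
Proof.
move=> /andP[h1 h2]; rewrite /iscale -zr_le zr0.
have [a0|a0] := leP 0 (zr a); rewrite /enc !zrM; first by rewrite !ler_wpM2l.
by rewrite !ler_nM2l // h1 h2.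
Qed.

Lemma enc_idiv a i x : (0 <? a)%BZ -> enc i x -> enc (idiv a i) (x / zr a).
Proof.
move=> a0 /andP[h1 h2]; rewrite /enc /=.
have ra : 0 < zr a by rewrite -zr0 zr_lt.
have aP : (0 < a)%BZ by apply/Z.ltb_spec0.
rewrite ler_pdivlMr // ler_pdivrMr // -!zrM.
apply/andP; split; [apply: le_trans h1|apply: (le_trans h2)]; rewrite zr_le; apply/Z.leb_spec0.
  by rewrite Z.mul_comm; apply: Z.mul_div_le.
by have := Z.mul_div_le (- i.2) a aP; lia.
Qed.

Lemma enc_icst a : enc (icst a) (zr a). Proof. by rewrite /enc lexx. Qed.

Lemma enc_iabs i x : enc i x -> `|x| <= zr (iabs i).
Proof.
move=> /andP[h1 h2]; rewrite ler_norml -zrN.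
apply/andP; split; [apply: le_trans h1|apply: (le_trans h2)]; rewrite zr_le /iabs;
  apply/Z.leb_spec0; lia.
Qed.

Lemma enc_imax0 i x : enc i x -> enc (imax0 i) (Num.max x 0).
Proof.
move=> /andP[h1 h2]; rewrite /enc /=; apply/andP; split.
  by have [[_ ->]|[_ ->]] := Z.max_spec i.1 0; rewrite le_max ?h1 // zr0 lexx orbT.
rewrite ge_max; apply/andP; split; first by rewrite (le_trans h2) // zr_le; apply/Z.leb_spec0; lia.
by rewrite -zr0 zr_le; apply/Z.leb_spec0; lia.
Qed.

Lemma enc_imin0 i x : enc i x -> enc (imin0 i) (Num.min x 0).
Proof.
move=> /andP[h1 h2]; rewrite /enc /=; apply/andP; split.
  rewrite le_min; apply/andP; split; first by rewrite (le_trans _ h1) // zr_le; apply/Z.leb_spec0; lia.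
  by rewrite -zr0 zr_le; apply/Z.leb_spec0; lia.
by have [[_ ->]|[_ ->]] := Z.min_spec i.2 0; rewrite ge_min ?h2 // zr0 lexx orbT.
Qed.

Fixpoint idot (c : seq Z) (s : seq itv) : itv :=
  if c is a :: c' then (if s is i :: s' then iadd (iscale a i) (idot c' s') else (0, 0)%BZ)
  else (0, 0)%BZ.

Lemma enc_idot c s v : encs s v -> enc (idot c s) (dot c v).
Proof.
elim: c s v => [|a c IH] [|i s] [|x v] //=; try by rewrite /enc /= zr0 lexx.
by case=> ei /IH ec; apply: enc_iadd => //; apply: enc_iscale.
Qed.

Definition iapply a (rows : seq (seq Z)) (s : seq itv) : seq itv :=
  [seq idiv a (idot c s) | c <- rows].
Definition rapply a (rows : seq (seq Z)) v : seq R := [seq dot c v / zr a | c <- rows].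

Lemma encs_iapply a rows s v : (0 <? a)%BZ -> encs s v ->
  encs (iapply a rows s) (rapply a rows v).
Proof.
move=> a0 es; elim: rows => [|c rows IH] //=; split=> //.
by apply: enc_idiv => //; apply: enc_idot.
Qed.

End Reflection.

(** * The step in coordinates *)

(** The entries of [M] over the denominator [dM], and of [N] over [dN]. *)
Definition dM : Z := (4010000)%BZ.
Definition m00 : Z := (12957)%BZ.
Definition m01 : Z := (-178940)%BZ.
Definition m11 : Z := (3582810)%BZ.
Definition dN : Z := (101000)%BZ.
Definition n00 : Z := (1099)%BZ.
Definition n01 : Z := (-9980)%BZ.
Definition n11 : Z := (99901)%BZ.
Definition dD : Z := (dM * dN)%BZ.

(** Row [i] of [gvec], then of [N *m gvec] and of [(1 - N) *m gvec + zpart],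
    in the coordinates of [coords], over the denominators [dM] and [dD]. *)
Definition row_g (i : bool) : seq Z :=
  (if i then [:: m01; m11; m01; m11 - dM; - m01; dM - m11]
   else [:: m00; m01; m00 - dM; m01; dM - m00; - m01])%BZ.
Definition row_y (i : bool) : seq Z :=
  if i then ladd (lscale n01 (row_g false)) (lscale n11 (row_g true))
  else ladd (lscale n00 (row_g false)) (lscale n01 (row_g true)).
Definition row_s (i : bool) : seq Z :=
  (if i then ladd [:: 0; 0; 0; dD; 0; 0]
    (ladd (lscale (- n01) (row_g false)) (lscale (dN - n11) (row_g true)))
  else ladd [:: 0; 0; dD; 0; 0; 0]
    (ladd (lscale (dN - n00) (row_g false)) (lscale (- n01) (row_g true))))%BZ.

Section Coordinates.
Variable R : realFieldType.
Implicit Types (tau : R) (e : 'cV[R]_(2 + 2 + 2)) (y z l : 'cV[R]_2).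

Lemma mul2E (A : 'M[R]_2) (v : 'cV[R]_2) i :
  (A *m v) i 0 = A i 0 * v 0 0 + A i 1 * v 1 0.
Proof.
rewrite mxE !big_ord_recl big_ord0 addr0; congr (_ + A i _ * v _ _); exact/val_inj.
Qed.

Lemma zr_neq0 a : (a =? 0)%BZ = false -> zr R a != 0.
Proof. by move=> h; rewrite zr_eq0 h. Qed.

Lemma M_entries : [/\ M R 0 0 = zr R m00 / zr R dM, M R 0 1 = zr R m01 / zr R dM,
  M R 1 0 = zr R m01 / zr R dM & M R 1 1 = zr R m11 / zr R dM].
Proof.
rewrite /M /rank1_mx d1_sqr /m00 /m01 /m11 /dM /eps /mu.
by split; rewrite !mxE !big_ord1 !mxE /= !zrE; field.
Qed.

Lemma N_entries : [/\ N R 0 0 = zr R n00 / zr R dN, N R 0 1 = zr R n01 / zr R dN,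
  N R 1 0 = zr R n01 / zr R dN & N R 1 1 = zr R n11 / zr R dN].
Proof.
rewrite /N /rank1_mx d2_sqr /n00 /n01 /n11 /dN /eps /nu.
by split; rewrite !mxE !big_ord1 !mxE /= !zrE; field.
Qed.

Definition coords e : seq R :=
  [:: ypart e 0 0; ypart e 1 0; zpart e 0 0; zpart e 1 0; lpart e 0 0; lpart e 1 0].

Lemma coords_inj : injective coords.
Proof.
move=> e f [y0 y1 z0 z1 l0 l1]; rewrite -[e]state_parts -[f]state_parts.
by congr (state _ _ _); apply: cv2P.
Qed.

Let dM0 : zr R dM != 0. Proof. exact: zr_neq0. Qed.
Let dN0 : zr R dN != 0. Proof. exact: zr_neq0. Qed.

Lemma gvecE e (i : bool) :
  gvec e (if i then 1 else 0) 0 = dot (row_g i) (coords e) / zr R dM.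
Proof.
have [E00 E01 E10 E11] := M_entries; move: dM0.
case: i; rewrite /gvec mulmxBl mul1mx !(E00, E01, E10, E11, mul2E, mxE) /coords /ypart /zpart /lpart /row_g
  ?mxE /dot !(zrB, zrN); move: (zr R _) (zr R m00) (zr R m01) (zr R m11) => a b c d a0; by field.
Qed.

Lemma dot_row_y e i : dot (row_y i) (coords e) / zr R dD =
  (N R *m gvec e) (if i then 1 else 0) 0.
Proof.
have [E00 E01 E10 E11] := N_entries; move: dM0 dN0.
have g0 : gvec e 0 0 = _ := gvecE e false.
have g1 : gvec e 1 0 = _ := gvecE e true.
rewrite mul2E g0 g1.
by case: i; rewrite ?E00 ?E01 ?E10 ?E11 /row_y dot_ladd !dot_lscale /dD zrM;
  move: (zr R dM) (zr R dN) => a b a0 b0; field; rewrite a0 b0.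
Qed.

Lemma dot_row_s e i : dot (row_s i) (coords e) / zr R dD =
  ((1%:M - N R) *m gvec e + zpart e) (if i then 1 else 0) 0.
Proof.
have [E00 E01 E10 E11] := N_entries; move: dM0 dN0.
have g0 : gvec e 0 0 = _ := gvecE e false.
have g1 : gvec e 1 0 = _ := gvecE e true.
rewrite mulmxBl mul1mx [RHS]mxE [X in _ = X + _]mxE [X in _ = _ + X + _]mxE mul2E.
case: i; rewrite ?g0 ?g1 ?E00 ?E01 ?E10 ?E11 /row_s !dot_ladd !dot_lscale /dD.
- rewrite [dot [:: _; _; _; _; _; _] _]/= !(zrM, zrB, zrN, zr0).
  by move: (zr R dM) (zr R dN) => a b a0 b0; field; rewrite a0 b0.
- rewrite [dot [:: _; _; _; _; _; _] _]/= !(zrM, zrB, zrN, zr0).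
  by move: (zr R dM) (zr R dN) => a b a0 b0; field; rewrite a0 b0.
Qed.

(** The step in coordinates, with all lengths multiplied by [S]. *)
Definition lstep (S tau : R) (v : seq R) : seq R :=
  let y0 := dot (row_y false) v / zr R dD in
  let y1 := dot (row_y true) v / zr R dD in
  let q0 := dot (row_s false) v / zr R dD - S in
  let q1 := dot (row_s true) v / zr R dD + S in
  [:: y0; y1; Num.max q0 0; Num.max q1 0 - S;
      (1 - tau) * nth 0 v 4 + tau * (Num.min q0 0 + S);
      (1 - tau) * nth 0 v 5 + tau * Num.min q1 0].

Lemma qvec0 e : qvec e 0 0 = dot (row_s false) (coords e) / zr R dD - 1.
Proof. by rewrite mxE dot_row_s addrC !mxE /=; congr (_ + _); ring. Qed.

Lemma qvec1 e : qvec e 1 0 = dot (row_s true) (coords e) / zr R dD + 1.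
Proof. by rewrite mxE dot_row_s addrC !mxE /=; congr (_ + _); ring. Qed.

Lemma coords_state y z l :
  coords (state y z l) = [:: y 0 0; y 1 0; z 0 0; z 1 0; l 0 0; l 1 0].
Proof. by rewrite /coords ypart_state zpart_state lpart_state. Qed.

Lemma coords_err_step (S tau : R) e : 0 <= S ->
  [seq S * x | x <- coords (err_step tau e)] = lstep S tau [seq S * x | x <- coords e].
Proof.
move=> S0; rewrite /err_step coords_state -!(dot_row_y _ false) -!(dot_row_y _ true).
have Sd c : dot c [seq S * x | x <- coords e] / zr R dD = S * (dot c (coords e) / zr R dD).
  by rewrite dot_scale mulrA.
rewrite /lstep !Sd /=.
have q0 := qvec0 e; have q1 := qvec1 e.
have mx (t : R) : Num.max (S * t) 0 = S * Num.max t 0 by rewrite maxr_pMr // mulr0.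
have mn (t : R) : Num.min (S * t) 0 = S * Num.min t 0 by rewrite minr_pMr // mulr0.
have -> : S * (dot (row_s false) (coords e) / zr R dD) - S = S * qvec e 0 0 by rewrite q0; ring.
have -> : S * (dot (row_s true) (coords e) / zr R dD) + S = S * qvec e 1 0 by rewrite q1; ring.
rewrite !mx !mn; move: (qvec e) (lpart e) => q l.
by congr [:: _; _; _; _; _; _]; rewrite !mxE /=; ring.
Qed.

(** The third row vanishes: the first slack is on its bound. *)
Definition T01_rows (tau : R) (v : seq R) : seq R :=
  [:: dot (row_y false) v / zr R dD; dot (row_y true) v / zr R dD; 0;
      dot (row_s true) v / zr R dD;
      (1 - tau) * nth 0 v 4 + tau * (dot (row_s false) v / zr R dD);
      (1 - tau) * nth 0 v 5].

Lemma coords_T01 (tau : R) e : coords (T01 tau *m e) = T01_rows tau (coords e).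
Proof.
rewrite -[X in T01 _ *m X]state_parts T01_state state_parts coords_state.
have s0 := dot_row_s e false; have s1 := dot_row_s e true.
rewrite /T01_rows -!(dot_row_y _ false) -!(dot_row_y _ true).
move: s0 s1; move: ((1%:M - N R) *m gvec e + zpart e) => s s0 s1.
rewrite s0 s1 /=; move: (lpart e) => l.
by congr [:: _; _; _; _; _; _]; rewrite ?mulmxBl ?mul1mx !(D01_0, D01_1, mxE) /=; ring.
Qed.

(** [qstar] is [(-1, 1)]: in this region the perturbed [q] still has a nonpositive
    first and a nonnegative second entry. *)
Definition in_region e :=
  (dot (row_s false) (coords e) / zr R dD <= 1) /\ (- 1 <= dot (row_s true) (coords e) / zr R dD).

Lemma err_step_region (tau : R) e : in_region e -> err_step tau e = T01 tau *m e.
Proof. by move=> [h0 h1]; apply: err_step_T01; rewrite ?qvec0 ?qvec1; lra. Qed.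

(** Encloses [(1 - tau) x + tau y = (x + y) / 2 + (tau - 1 / 2) (y - x)]
    whenever [|tau - 1 / 2| <= 10^-10]. *)
Definition imean (i j : itv) : itv :=
  let m := (iabs (iadd j (iscale (-1)%BZ i)) / 10000000000 + 1)%BZ in
  let h := idiv 2%BZ (iadd i j) in ((h.1 - m)%BZ, (h.2 + m)%BZ).

Lemma enc_imean (tau x t : R) i j : `|tau - 1 / 2| <= 10 ^- 10 ->
  enc i x -> enc j t -> enc (imean i j) ((1 - tau) * x + tau * t).
Proof.
move=> ht ei ej; rewrite /imean.
set h := idiv 2%BZ _; set A := iabs _; set m := (_ / _ + 1)%BZ.
have /andP[h1 h2] : enc h ((x + t) / 2).
  by have := enc_idiv (a := 2%BZ) isT (enc_iadd ei ej); rewrite zr_xO zr1 mulr1.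
have hm : `|(tau - 1 / 2) * (t - x)| <= zr R m.
  rewrite normrM.
  have tx : `|t - x| <= zr R A.
    by apply: enc_iabs; apply: enc_iadd => //; rewrite -mulN1r -(zr1 R) -zrN; apply: enc_iscale.
  apply: le_trans (ler_pM _ _ ht tx) _ => //.
  rewrite mulrC ler_pdivrMr ?exprn_gt0 //.
  have -> : 10 ^+ 10 = zr R 10000000000 by rewrite !zrE; ring.
  rewrite -zrM zr_le; apply/Z.leb_spec0; rewrite /m.
  have := Z.mul_succ_div_gt A 10000000000 erefl; lia.
move: hm; rewrite ler_norml => /andP[h3 h4]; rewrite /enc /= zrB zrD.
by apply/andP; split; lra.
Qed.

Definition istep (S : Z) (s : seq itv) : seq itv :=
  let d r := idiv dD (idot r s) in
  let q0 := iadd (d (row_s false)) (icst (- S)%BZ) in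
  let q1 := iadd (d (row_s true)) (icst S) in
  let l k := nth (0%BZ, 0%BZ) s k in
  [:: d (row_y false); d (row_y true); imax0 q0; iadd (imax0 q1) (icst (- S)%BZ);
      imean (l 4%N) (iadd (imin0 q0) (icst S)); imean (l 5%N) (imin0 q1)].

Lemma encs_istep (S : Z) (tau : R) s v : size v = 6%N -> `|tau - 1 / 2| <= 10 ^- 10 ->
  encs s v -> encs (istep S s) (lstep (zr R S) tau v).
Proof.
move=> sv ht es.
have ed c : enc (idiv dD (idot c s)) (dot c v / zr R dD) by apply/enc_idiv/enc_idot.
have e0 : enc (iadd (idiv dD (idot (row_s false) s)) (icst (- S)%BZ))
    (dot (row_s false) v / zr R dD - zr R S).
  by rewrite -zrN; apply: enc_iadd => //; apply: enc_icst.
have e1 : enc (iadd (idiv dD (idot (row_s true) s)) (icst S))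
    (dot (row_s true) v / zr R dD + zr R S).
  by apply: enc_iadd => //; apply: enc_icst.
have el k : (k < 6)%N -> enc (nth (0%BZ, 0%BZ) s k) (nth 0 v k).
  by move=> k6; apply: encs_nth => //; rewrite sv.
have eS := enc_icst R S.
split=> //; split=> //; split; first exact: enc_imax0.
split; first by rewrite -zrN; apply: enc_iadd; [apply: enc_imax0|apply: enc_icst].
split; first by apply: enc_imean => //; [apply: el|apply: enc_iadd => //; apply: enc_imin0].
by split=> //; apply: enc_imean => //; [apply: el|apply: enc_imin0].
Qed.
End Coordinates.

(** * Norms, eigenvalues and convergence *)

Section Norms.
Variables (R : realType) (n : nat).
Implicit Types (nrm : 'cV[R]_n -> R) (e : 'cV[R]_n) (A H : 'M[R]_n).

Lemma is_norm0 nrm : is_norm nrm -> nrm 0 = 0.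
Proof. by move=> [_ hZ _]; rewrite -(scale0r 0) hZ normr0 mul0r. Qed.

Lemma is_norm_ge0 nrm e : is_norm nrm -> 0 <= nrm e.
Proof.
move=> hn; have [_ hZ hD] := hn; have := hD e (- e).
by rewrite subrr is_norm0 // -scaleN1r hZ normrN1 mul1r; lra.
Qed.

Lemma is_norm_gt0 nrm e : is_norm nrm -> e != 0 -> 0 < nrm e.
Proof.
move=> hn e0; rewrite lt_neqAle is_norm_ge0 // andbT eq_sym.
by apply: contra e0 => /eqP h; case: hn => h0 _ _; rewrite (h0 _ h).
Qed.

Lemma is_norm_sum nrm (I : finType) (F : I -> 'cV[R]_n) : is_norm nrm ->
  nrm (\sum_i F i) <= \sum_i nrm (F i).
Proof.
move=> hn; have [_ _ hD] := hn.
elim/big_ind2: _ => // [|x y u v h1 h2]; first by rewrite is_norm0.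
by apply: le_trans (hD _ _) _; rewrite lerD.
Qed.

Lemma is_norm_le_entries nrm e (b : R) : is_norm nrm -> (forall i, `|e i 0| <= b) ->
  nrm e <= b * \sum_i nrm (delta_mx i 0).
Proof.
move=> hn hb; have [_ hZ _] := hn.
have -> : e = \sum_i e i 0 *: delta_mx i 0.
  by rewrite [LHS]matrix_sum_delta; apply: eq_bigr => i _; rewrite big_ord1.
apply: le_trans (is_norm_sum _ hn) _; rewrite mulr_sumr.
by apply: ler_sum => i _; rewrite hZ ler_wpM2r // is_norm_ge0.
Qed.

(** Every norm is dominated by the largest entry, so its balls are
    neighbourhoods. *)
Lemma nbhs_norm_ball nrm (c : 'cV[R]_n) (r : R) : is_norm nrm -> 0 < r ->
  nbhs c [set w | nrm (w - c) <= r].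
Proof.
move=> hn r0; set K := \sum_i nrm (delta_mx i 0).
have K0 : 0 <= K by apply: sumr_ge0 => i _; apply: is_norm_ge0.
apply/nbhs_ballP; exists (r / (K + 1)) => /=; first by rewrite divr_gt0 // ltr_wpDl.
move=> w [_ hw] /=.
apply: (le_trans (is_norm_le_entries (b := r / (K + 1)) hn _)) => [i|].
  by rewrite !mxE distrC; apply/ltW; apply: (hw i 0).
rewrite -/K mulrAC ler_pdivrMr ?ltr_wpDl // ler_wpM2l ?ltW //.
by rewrite ltrDl.
Qed.

Lemma nbhs_segment (c e : 'cV[R]_n) (U : set 'cV[R]_n) : nbhs c U ->
  exists2 t : R, 0 < t & forall s, 0 <= s <= t -> U (c + s *: e).
Proof.
case/nbhs_ballP => d /= d0 dU.
pose K := \sum_i `|e i 0|.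
have K0 : 0 <= K by apply: sumr_ge0.
exists (d / 2 / (K + 1)); first by rewrite !divr_gt0 // ltr_wpDl.
move=> s /andP[s0 st]; apply: dU; split=> // i j; rewrite (ord1 j).
rewrite /ball /= !mxE opprD addNKr normrN normrM (ger0_norm s0).
have eK : `|e i 0| <= K by rewrite /K (bigD1 i) //= lerDl sumr_ge0.
apply: (@le_lt_trans _ _ (d / 2 / (K + 1) * (K + 1))).
  by apply: ler_pM => //; rewrite (le_trans eK) // lerDl.
rewrite divfK ?gt_eqF ?ltr_wpDl //; lra.
Qed.

Lemma cvg_entries (u : nat -> 'cV[R]_n) (l : 'cV[R]_n) (g : nat -> R) :
  (forall k i, `|u k i 0 - l i 0| <= g k) -> g @ \oo --> 0 -> u @ \oo --> l.
Proof.
move=> ug g0; apply/cvgrPdist_lt => eps eps0.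
have [N _ hN] := (cvgrPdist_lt _ _).1 g0 _ eps0.
exists N => // k Nk /=.
have gk : g k < eps.
  by have := hN k Nk; rewrite /= sub0r normrN; apply: le_lt_trans; apply: ler_norm.
rewrite -[l - u k]opprB normrN.
have : ball (0 : 'cV[R]_n) eps (u k - l).
  split=> // i j; rewrite (ord1 j) /ball /= !mxE sub0r normrN.
  exact: le_lt_trans (ug _ _) gk.
by rewrite mx_norm_ball /ball_ /= sub0r normrN.
Qed.

(** Cauchy-Schwarz for the form of [H], which makes [normH H] a norm. *)
Lemma normH_is_norm H : posdef H -> is_norm (normH H).
Proof.
move=> pH; have [Hs Hp] := pH.
pose B (u v : 'cV[R]_n) : R := (u^T *m H *m v) 0 0.
have Bs u v : B u v = B v u.
  rewrite /B (_ : u^T *m H *m v = (v^T *m H *m u)^T) ?mxE //.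
  by rewrite !trmx_mul Hs trmxK mulmxA.
have Bd u v w : B (u + v) w = B u w + B v w.
  by rewrite /B linearD /= !mulmxDl mxE.
have Bz a u w : B (a *: u) w = a * B u w.
  by rewrite /B linearZ /= -!scalemxAl mxE.
have BE s u t v : B (s *: u + t *: v) (s *: u + t *: v) =
    s ^+ 2 * B u u + 2 * s * t * B u v + t ^+ 2 * B v v.
  rewrite Bd !Bz (Bs u) (Bs v) !Bd !Bz (Bs v u); ring.
have B0 u : 0 <= B u u by apply: posdef_ge0.
have CS u v : B u v ^+ 2 <= B u u * B v v.
  have [->|v0] := eqVneq v 0.
    by rewrite Bs -(scale0r (0 : 'cV_n)) !Bz !mul0r expr0n mulr0.
  have bv : 0 < B v v := Hp _ v0.
  have := B0 (B v v *: u + (- B u v) *: v); rewrite BE.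
  have -> : B v v ^+ 2 * B u u + 2 * B v v * - B u v * B u v + (- B u v) ^+ 2 * B v v
    = B v v * (B u u * B v v - B u v ^+ 2) by ring.
  by rewrite pmulr_rge0 // subr_ge0.
split.
- move=> v /eqP; rewrite /normH -/(B v v) sqrtr_eq0 => h.
  exact: posdef_eq0 h.
- move=> a v; rewrite /normH -/(B _ _) -/(B _ _) Bz Bs Bz mulrA -expr2.
  by rewrite sqrtrM ?sqr_ge0 // sqrtr_sqr.
- move=> u v; rewrite /normH -!/(B _ _).
  rewrite -(@ler_pXn2r _ 2) ?nnegrE ?addr_ge0 ?sqrtr_ge0 // sqrrD !sqr_sqrtr //.
  have -> : B (u + v) (u + v) = B u u + 2 * B u v + B v v.
    by rewrite !Bd (Bs u) (Bs v) !Bd (Bs v u); ring.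
  rewrite lerD2r lerD2l -[leRHS]mulr_natl ler_pM2l ?ltr0n // -sqrtrM //.
  apply: le_trans (ler_norm _) _; rewrite -sqrtr_sqr ler_wsqrtr //.
Qed.

Lemma normH_sqr H e : posdef H -> normH H e ^+ 2 = (e^T *m H *m e) 0 0.
Proof. by move=> pH; rewrite sqr_sqrtr // posdef_ge0. Qed.

End Norms.

Section Spectrum.
Variables (R : realType) (n : nat).
Implicit Types (A : 'M[R]_n.+1) (z : R[i]).
Local Notation C := R[i].
Local Notation toC := (map_mx (real_complex R)).
Local Notation normc := ComplexField.Normc.normc.

Lemma normcE_lt1 z : (`|z| < 1) = (normc z < 1).
Proof. by rewrite -(ltcR (normc z)). Qed.

Lemma eigenvalue_colP A z :
  reflect (exists2 v : 'cV[C]_n.+1, v != 0 & toC A *m v = z *: v) (eigenvalue (toC A) z).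
Proof.
have -> : eigenvalue (toC A) z = eigenvalue (toC A)^T z.
  rewrite !eigenvalue_root_char; congr (root _ z).
  by rewrite /char_poly -[LHS]det_tr /char_poly_mx linearB /= tr_scalar_mx -map_trmx.
apply: (iffP eigenvalueP) => [[v vA v0]|[v v0 Av]].
  exists v^T; first by rewrite trmx_eq0.
  by apply: trmx_inj; rewrite trmx_mul linearZ /= trmxK.
exists v^T; last by rewrite trmx_eq0.
by rewrite -trmx_mul Av linearZ.
Qed.

(** The spectrum is finite and nonempty, so the supremum is attained and the
    strict inequality passes to it. *)
Lemma schur_stableP A :
  schur_stable A <-> forall z, eigenvalue (toC A) z -> `|z| < 1.
Proof.
have [rs rsE] := closed_field_poly_normal (char_poly (toC A)).
have ev z : eigenvalue (toC A) z = (z \in rs).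
  by rewrite eigenvalue_root_char rsE (monicP (char_poly_monic _)) scale1r root_prod_XsubC.
rewrite /schur_stable /spectral_radius; set S := (X in sup X); pose b := \sum_(z <- rs) normc z.
have n0 z : 0 <= normc z by rewrite -lecR; apply: (normr_ge0 z).
have zb z : z \in rs -> normc z <= b.
  by move=> zr; rewrite /b (big_rem z) //= lerDl sumr_ge0.
have Sb : has_ubound S by exists b => _ [z /= hz <-]; apply: zb; rewrite -ev.
clear zb b.
have S0 : S !=set0.
  case: rs rsE ev => [|z0 rs] rsE ev.
    have := size_char_poly (toC A); rewrite rsE big_nil (monicP (char_poly_monic _)).
    by rewrite scale1r size_poly1.
  by exists (normc z0), z0 => //=; rewrite ev mem_head.
split.
  move=> h z hz; rewrite normcE_lt1; apply: le_lt_trans h.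
  by apply: ub_le_sup => //; exists z.
move=> h.
have [m m1 hm] : exists2 m : R, m < 1 & forall z, z \in rs -> normc z <= m.
  have {}h z : z \in rs -> normc z < 1 by rewrite -ev -normcE_lt1; apply: h.
  elim: rs h {rsE ev} => [|z rs IH] h; first by exists 0.
  case: IH => [y yr|m m1 hm]; first by apply: h; rewrite inE yr orbT.
  exists (Num.max (normc z) m); first by rewrite gt_max m1 h // mem_head.
  move=> y; rewrite inE le_max => /orP[/eqP ->|/hm ->]; rewrite ?lexx ?orbT //.
apply: le_lt_trans m1; apply: ge_sup => // _ [z /= hz <-]; apply: hm; by rewrite -ev.
Qed.

(** For an eigenvector [a + i b] of [z], the supremum of [nrm] over the real
    points [s a + t b] of the unit circle is multiplied by [|z|] by [A]. *)
Lemma contraction_eigenvalue A (nrm : 'cV[R]_n.+1 -> R) (kappa : R) z :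
  is_norm nrm -> kappa < 1 -> (forall e, nrm (A *m e) <= kappa * nrm e) ->
  eigenvalue (toC A) z -> `|z| < 1.
Proof.
move=> hn k1 hA /eigenvalue_colP[v v0 vz]; have [_ hZ hD] := hn.
pose a := map_mx (@complex.Re R) v; pose b := map_mx (@complex.Im R) v.
have vE i : v i 0 = (a i 0 +i* b i 0)%C by rewrite !mxE; case: (v i 0).
case: z vz => x y vz.
have AE : A *m a = x *: a - y *: b /\ A *m b = y *: a + x *: b.
  have hi i : \sum_j (A i j)%:C%C * v j 0 = (x +i* y)%C * v i 0.
    by have /matrixP/(_ i 0) := vz; rewrite !mxE => <-; apply: eq_bigr => j _; rewrite mxE.
  have ReS (F : 'I_n.+1 -> C) : complex.Re (\sum_j F j) = \sum_j complex.Re (F j).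
    by apply: (big_morph (@complex.Re R)) => // [[? ?] [? ?]].
  have ImS (F : 'I_n.+1 -> C) : complex.Im (\sum_j F j) = \sum_j complex.Im (F j).
    by apply: (big_morph (@complex.Im R)) => // [[? ?] [? ?]].
  split; apply/matrixP => i j; rewrite (ord1 j).
    have := congr1 (@complex.Re R) (hi i); rewrite ReS vE /= !mxE => h.
    rewrite -h; apply: eq_bigr => k _.
    by rewrite !mxE; case: (v k 0) => p q /=; rewrite mul0r subr0.
  have := congr1 (@complex.Im R) (hi i); rewrite ImS vE /= !mxE => h.
  rewrite [RHS]addrC -h; apply: eq_bigr => k _.
  by rewrite !mxE; case: (v k 0) => p q /=; rewrite mul0r addr0.
have [Aa Ab] := AE.
pose S := [set nrm (p.1 *: a + p.2 *: b) | p in [set p : R * R | p.1 ^+ 2 + p.2 ^+ 2 = 1]].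
have Sb : has_ubound S.
  exists (nrm a + nrm b) => _ [[s t] /= st <-].
  have s1 : `|s| <= 1 by rewrite -(ler_pXn2r (n := 2)) ?nnegrE // expr1n real_normK ?num_real //; nra.
  have t1 : `|t| <= 1 by rewrite -(ler_pXn2r (n := 2)) ?nnegrE // expr1n real_normK ?num_real //; nra.
  apply: le_trans (hD _ _) _; rewrite !hZ lerD // ler_piMl // is_norm_ge0 //.
have S1 s t : s ^+ 2 + t ^+ 2 = 1 -> nrm (s *: a + t *: b) <= sup S.
  by move=> st; apply: ub_le_sup => //; exists (s, t).
have supS0 : 0 < sup S.
  have [a0|a0] := eqVneq a 0; last first.
    apply: lt_le_trans (is_norm_gt0 hn a0) _.
    by have := S1 1 0; rewrite scale1r scale0r addr0; apply; ring.
  have b0 : b != 0.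
    apply: contra v0 => /eqP b0; apply/eqP/matrixP => i j; rewrite (ord1 j) vE a0 b0 !mxE //.
  apply: lt_le_trans (is_norm_gt0 hn b0) _.
  by have := S1 0 1; rewrite scale1r scale0r add0r; apply; ring.
rewrite normcE_lt1 /=; set rho := Num.sqrt _.
have rho2 : rho ^+ 2 = x ^+ 2 + y ^+ 2 by rewrite sqr_sqrtr // addr_ge0 ?sqr_ge0.
have [r0|r0] := eqVneq rho 0; first by rewrite r0 ltr01.
have rp : 0 < rho by rewrite lt_neqAle eq_sym r0 sqrtr_ge0.
suff : rho * sup S <= kappa * sup S by rewrite ler_pM2r // => /le_lt_trans; apply.
have k0 : 0 <= kappa.
  have [a0|a0] := eqVneq a 0; last first.
    by have := le_trans (is_norm_ge0 (A *m a) hn) (hA a); rewrite pmulr_lge0 ?is_norm_gt0.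
  have b0 : b != 0.
    apply: contra v0 => /eqP b0; apply/eqP/matrixP => i j; rewrite (ord1 j) vE a0 b0 !mxE //.
  by have := le_trans (is_norm_ge0 (A *m b) hn) (hA b); rewrite pmulr_lge0 ?is_norm_gt0.
rewrite -ler_pdivlMl //; apply: ge_sup; first by exists (nrm (1 *: a + 0 *: b)), (1, 0) => //=; ring.
move=> _ [[s t] /= st <-]; rewrite ler_pdivlMl //.
pose s' := (x * s - y * t) / rho; pose t' := (y * s + x * t) / rho.
have st' : s' ^+ 2 + t' ^+ 2 = 1.
  have -> : s' ^+ 2 + t' ^+ 2 = (x ^+ 2 + y ^+ 2) * (s ^+ 2 + t ^+ 2) / rho ^+ 2.
    by rewrite /s' /t'; field.
  by rewrite st mulr1 -rho2 divff // expf_eq0 /= (negPf r0).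
apply: le_trans (_ : kappa * nrm (s' *: a + t' *: b) <= _); last by rewrite ler_wpM2l // S1.
apply: le_trans (hA _); rewrite mulmxDr -!scalemxAr Aa Ab.
have -> : s' *: (x *: a - y *: b) + t' *: (y *: a + x *: b) = rho *: (s *: a + t *: b).
  apply/matrixP => i j; rewrite !mxE /s' /t'.
  move: (complex.Re _) (complex.Im _) => p q.
  transitivity ((x ^+ 2 + y ^+ 2) / rho * (s * p + t * q)); first by field.
  by rewrite -rho2 expr2 mulfK.
by rewrite hZ gtr0_norm.
Qed.

End Spectrum.

Section AdaptedNorm.
Variables (R : realType) (n : nat).
Implicit Types (A : 'M[R]_n.+1) (e : 'cV[R]_n.+1).
Local Notation C := R[i].
Local Notation toC := (map_mx (real_complex R)).
Local Notation normc := (@ComplexField.Normc.normc R).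

Lemma normc_ge0 (z : C) : 0 <= normc z.
Proof. by rewrite -lecR; apply: (normr_ge0 z). Qed.

Lemma normcD (z w : C) : normc (z + w) <= normc z + normc w.
Proof. by rewrite -lecR rmorphD; apply: (ler_normD z w). Qed.

Lemma normc_sum (I : finType) (F : I -> C) : normc (\sum_i F i) <= \sum_i normc (F i).
Proof.
elim/big_ind2: _ => // [|x y u v h1 h2]; first by rewrite ComplexField.Normc.normc0.
by apply: le_trans (normcD _ _) _; rewrite lerD.
Qed.

Lemma normc_real (x : R) : normc (x%:C)%C = `|x|.
Proof. by rewrite /= expr0n addr0 sqrtr_sqr. Qed.

(** In a basis where the matrix is lower triangular, weighting the [i]-th
    coordinate by [delta ^ i] makes the off-diagonal part as small as wished. *)
Lemma adapted_norm A : (forall z, eigenvalue (toC A) z -> `|z| < 1) ->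
  exists (nrm : 'cV[R]_n.+1 -> R) (kappa c : R),
    [/\ is_norm nrm, 0 < kappa < 1, forall e, nrm (A *m e) <= kappa * nrm e
      & forall e i, `|e i 0| <= c * nrm e].
Proof.
move=> hA.
have [P Pun Ptrig] := Schur (toC A) (ltn0Sn n).
have Pu : P \in unitmx := unitarymx_unit Pun.
pose U := P *m toC A *m invmx P.
have Ut : is_trig_mx U by move: Ptrig; rewrite /similar_to conjumx.
have UP v : P *m (toC A *m v) = U *m (P *m v).
  by rewrite /U !mulmxA mulmxKV.
have Ud i : normc (U i i) < 1.
  rewrite -normcE_lt1; apply: hA.
  have : eigenvalue U (U i i).
    rewrite eigenvalue_root_char char_poly_trig // /root horner_prod (bigD1 i) //=.
    by rewrite !hornerE subrr mul0r.
  case/eigenvalueP => v vU v0; apply/eigenvalueP; exists (v *m P).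
    by rewrite -mulmxA -[P *m _](mulmxKV Pu) -/U mulmxA vU -scalemxAl.
  by apply: contra v0 => /eqP h; rewrite -[v](mulmxK Pu) h mul0mx.
have [rho rho1 rhoP] : exists2 rho : R, 0 <= rho < 1 & forall i, normc (U i i) <= rho.
  exists (\big[Num.max/0]_i normc (U i i)).
    apply/andP; split; first by apply: (big_ind (fun x => 0 <= x)) => // [x y x0 y0|i _];
      rewrite ?le_max ?x0 // normc_ge0.
    by apply: (big_ind (fun x => x < 1)) => // x y x1 y1; rewrite gt_max x1.
  by move=> i; apply: le_bigmax_cond.
have /andP[rho0 rho_lt1] := rho1.
pose K := \sum_i \sum_j normc (U i j).
have K0 : 0 <= K by apply: sumr_ge0 => i _; apply: sumr_ge0 => j _; apply: normc_ge0.
pose d := (1 - rho) / (2 * (K + 1)).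
have d0 : 0 < d by rewrite divr_gt0 ?subr_gt0 // mulr_gt0 // ltr_wpDl.
have dK : d * K <= (1 - rho) / 2.
  rewrite /d mulrAC ler_pdivrMr ?mulr_gt0 ?ltr_wpDl //.
  have -> : (1 - rho) / 2 * (2 * (K + 1)) = (1 - rho) * (K + 1) by field.
  by rewrite ler_wpM2l ?lerDl // subr_ge0 ltW.
have d1 : d <= 1.
  rewrite /d ler_pdivrMr ?mulr_gt0 ?ltr_wpDl // mul1r; lra.
pose nrm (e : 'cV[R]_n.+1) : R := \sum_(i < n.+1) d ^+ i * normc ((P *m toC e) i 0).
pose kappa := (1 + rho) / 2.
have w0 (i : nat) : 0 < d ^+ i by rewrite exprn_gt0.
have nrm_ge (i : 'I_n.+1) e : normc ((P *m toC e) i 0) <= (d ^+ i)^-1 * nrm e.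
  rewrite ler_pdivlMl // /nrm (bigD1 i) //= lerDl sumr_ge0 // => j _.
  by rewrite mulr_ge0 ?normc_ge0 // ltW.
pose c : R := \sum_(i < n.+1) \sum_(j < n.+1) normc (invmx P i j) / d ^+ j.
have cP e i : `|e i 0| <= c * nrm e.
  rewrite -normc_real.
  have -> : ((e i 0)%:C)%C = \sum_j invmx P i j * (P *m toC e) j 0.
    have : toC e i 0 = (invmx P *m (P *m toC e)) i 0 by rewrite mulKmx.
    by rewrite !mxE.
  have ne0 : 0 <= nrm e.
    by apply: sumr_ge0 => j _; rewrite mulr_ge0 ?normc_ge0 // ltW.
  apply: le_trans (normc_sum _) _.
  apply: (@le_trans _ _ ((\sum_(j < n.+1) normc (invmx P i j) / d ^+ j) * nrm e)).
    rewrite mulr_suml; apply: ler_sum => j _.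
    by rewrite ComplexField.Normc.normcM -mulrA ler_wpM2l // normc_ge0.
  rewrite ler_wpM2r // /c [leRHS](bigD1 i) //= lerDl; apply: sumr_ge0 => k _.
  by apply: sumr_ge0 => j _; rewrite divr_ge0 ?normc_ge0 // ltW.
exists nrm, kappa, c; split=> //.
- split.
  + move=> v v0; apply/matrixP => i j; rewrite (ord1 j) mxE; apply/eqP.
    by rewrite -normr_le0; apply: le_trans (cP v i) _; rewrite v0 mulr0.
  + move=> a v; rewrite /nrm mulr_sumr; apply: eq_bigr => i _.
    rewrite map_mxZ -scalemxAr mxE ComplexField.Normc.normcM -normc_real.
    by rewrite mulrCA.
  + move=> u v; rewrite /nrm -big_split; apply: ler_sum => i _ /=.
    by rewrite map_mxD mulmxDr mxE -mulrDr ler_wpM2l ?(ltW (w0 i)) // normcD.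
- by rewrite /kappa; apply/andP; split; lra.
- move=> e; rewrite /nrm map_mxM UP; move: (P *m toC e) => x.
  apply: (@le_trans _ _ (\sum_(i < n.+1) \sum_(j < n.+1) d ^+ i * (normc (U i j) * normc (x j 0)))).
    apply: ler_sum => i _; rewrite -mulr_sumr ler_wpM2l ?(ltW (w0 i)) // mxE.
    by apply: le_trans (normc_sum _) _; apply: ler_sum => j _; rewrite ComplexField.Normc.normcM.
  rewrite exchange_big mulr_sumr /=; apply: ler_sum => j _.
  rewrite (eq_bigr (fun i : 'I_n.+1 => (d ^+ i * normc (U i j)) * normc (x j 0))) => [|i _]; last by rewrite mulrA.
  rewrite -mulr_suml mulrA ler_wpM2r ?normc_ge0 //.
  apply: (@le_trans _ _ (d ^+ j * (rho + d * K))); last first.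
    by rewrite mulrC ler_wpM2r ?(ltW (w0 j)) // /kappa; lra.
  rewrite (bigD1 j) //= mulrDr lerD ?ler_wpM2l ?(ltW (w0 j)) //.
  apply: (@le_trans _ _ (\sum_(i < n.+1) d ^+ j * d * normc (U i j))).
    rewrite [leRHS](bigD1 j) //=; apply: ler_wpDl.
      by rewrite mulr_ge0 ?normc_ge0 // mulr_ge0 // ltW.
    apply: ler_sum => i ij; have [lij|] := ltnP i j.
      move/is_trig_mxP: Ut => -> //.
      by rewrite ComplexField.Normc.normc0 !mulr0.
    move=> ji; have {}ji : (j < i)%N.
      by rewrite ltn_neqAle ji andbT; apply: contra ij => /eqP/val_inj ->.
    rewrite ler_wpM2r ?normc_ge0 // -exprSr; apply: ler_wiXn2l => //; exact: ltW.
  rewrite -mulr_sumr -mulrA ler_wpM2l ?(ltW (w0 j)) // ler_wpM2l ?(ltW d0) //.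
  rewrite /K exchange_big [leRHS](bigD1 j) //= lerDl; apply: sumr_ge0 => k _.
  by apply: sumr_ge0 => i _; apply: normc_ge0.
Qed.

End AdaptedNorm.

(** * The Schur-Cohn criterion for quartics *)

Section SchurCohn.
Variable C : numClosedFieldType.
Implicit Types (p : {poly C}) (z a b : C).

(** One step of the Schur-Cohn recursion at a point [z] outside the disc: [P],
    [Q] are the values of a polynomial and of its reduction, [Ps], [Qs] those
    of their reversals. *)
Lemma schur_cohn_step (a b z P Ps Q Qs : C) : a \is Num.real -> b \is Num.real ->
  b ^+ 2 < a ^+ 2 -> 1 <= `|z| ->
  z * Q = a * P - b * Ps -> Qs = a * Ps - b * P ->
  Q != 0 -> `|Qs| <= `|Q| -> P != 0 /\ `|Ps| <= `|P|.
Proof.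
move=> ar br ab z1 EQ EQs Q0 QQ.
have aC : a^* = a by apply/CrealP.
have bC : b^* = b by apply/CrealP.
have zQ : `|Qs| ^+ 2 <= `|z * Q| ^+ 2.
  by rewrite lerXn2r ?nnegrE // (le_trans QQ) // normrM ler_peMl.
have E : `|z * Q| ^+ 2 - `|Qs| ^+ 2 = (a ^+ 2 - b ^+ 2) * (`|P| ^+ 2 - `|Ps| ^+ 2).
  by rewrite EQ EQs !normCK !rmorphB !rmorphM /= aC bC; ring.
have PP : `|Ps| ^+ 2 <= `|P| ^+ 2.
  by move: zQ; rewrite -subr_ge0 E pmulr_rge0 ?subr_gt0 // subr_ge0.
have {}PP : `|Ps| <= `|P| by rewrite -(ler_pXn2r (n := 2)) ?nnegrE.
split=> //; apply: contraNneq Q0 => P0; move: PP; rewrite P0 normr0 normr_le0 => /eqP Ps0.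
have z0 : z != 0 by rewrite -normr_gt0 (lt_le_trans _ z1).
by rewrite -(mulrI_eq0 _ (mulfI z0)) EQ P0 Ps0 !mulr0 subrr.
Qed.

(** For [p] with real coefficients, the value at [z] of the polynomial with the
    coefficients in reverse order. *)
Definition reversal p z := z ^+ (size p).-1 * (p.[(z^*)^-1])^*.

(** [p] and its reversal factor over the roots [w] of [p], and
    [|1 - w^* z| <= |z - w|] when [|w| < 1 <= |z|]. *)
Lemma blaschke p z : p != 0 -> (forall w, root p w -> `|w| < 1) -> 1 <= `|z| ->
  `|reversal p z| <= `|p.[z]|.
Proof.
move=> p0 hp z1; have z0 : z != 0 by rewrite -normr_gt0 (lt_le_trans _ z1).
have [rs pE] := closed_field_poly_normal p.
have lp : lead_coef p != 0 by rewrite lead_coef_eq0.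
have sp : (size p).-1 = size rs by rewrite pE size_scale // size_prod_XsubC.
have {}hp w : w \in rs -> `|w| < 1.
  by move=> wr; apply: hp; rewrite pE rootZ // root_prod_XsubC.
rewrite /reversal sp pE !hornerZ rmorphM mulrCA !normrM norm_conjC ler_wpM2l // -normrM {pE sp lp}.
elim: rs hp => [|w rs IH] hp; first by rewrite !big_nil !hornerE rmorph1 /= ?expr0 ?mulr1.
rewrite !big_cons !hornerM rmorphM exprS mulrACA !normrM ler_pM //; last first.
  by rewrite -normrM IH // => u ur; apply: hp; rewrite inE ur orbT.
have w1 : `|w| < 1 by apply: hp; rewrite mem_head.
rewrite -normrM !hornerE rmorphB /= fmorphV /= conjCK mulrBr divff //.
rewrite -(ler_pXn2r (n := 2)) ?nnegrE // -subr_ge0.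
have -> : `|z - w| ^+ 2 - `|1 - z * w^*| ^+ 2 = (`|z| ^+ 2 - 1) * (1 - `|w| ^+ 2).
  by rewrite !normCK !(rmorphB, rmorphM) /= rmorph1 conjCK; ring.
by rewrite mulr_ge0 // subr_ge0 ?expr_ge1 // ?exprn_ile1 // ltW.
Qed.

(** Up to sign the quotient of the two coefficients is the product of the roots. *)
Lemma stable_coef0 p : (1 < size p)%N -> (forall w, root p w -> `|w| < 1) ->
  `|p`_0| < `|lead_coef p|.
Proof.
move=> sp hp; have p0 : p != 0 by rewrite -size_poly_gt0 ltnW.
have [rs pE] := closed_field_poly_normal p.
have lp : lead_coef p != 0 by rewrite lead_coef_eq0.
have {}hp w : w \in rs -> `|w| < 1.
  by move=> wr; apply: hp; rewrite pE rootZ // root_prod_XsubC.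
have rs0 : (0 < size rs)%N.
  by move: sp; rewrite pE size_scale // size_prod_XsubC.
have -> : p`_0 = lead_coef p * (\prod_(w <- rs) ('X - w%:P)).[0].
  by rewrite -horner_coef0 {1}pE hornerZ.
rewrite normrM.
rewrite gtr_pMr ?normr_gt0 //; case: rs hp rs0 {pE} => // w rs hp _.
elim: rs w hp => [|u rs IH] w hp.
  by rewrite big_seq1 !hornerE normrN hp // mem_head.
rewrite big_cons hornerM normrM mulr_ilt1 //.
  by rewrite !hornerE normrN hp // mem_head.
by apply: IH => v vr; apply: hp; rewrite inE vr orbT.
Qed.
End SchurCohn.

Section Quartic.
Variable C : numClosedFieldType.

Lemma reversal_Poly (l : seq C) z : all (fun c => c \is Num.real) l -> z != 0 ->
  size (Poly l) = size l -> reversal (Poly l) z = (Poly (rev l)).[z].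
Proof.
move=> lr z0 sl; rewrite /reversal sl; case: l lr {sl} => [|c l] lr.
  by rewrite !horner_Poly /= conjC0 mulr0.
rewrite horner_Poly [size _]/=.
elim: l c lr => [|d l IH] c /andP[cr lr].
  by rewrite horner_Poly /rev /= !mul0r !add0r expr0 mul1r (CrealP cr).
rewrite rev_cons -cats1 horner_Poly.
have hc (s : seq C) x y : horner_rec (s ++ [:: x]) y = horner_rec s y + x * y ^+ size s.
  elim: s => [|t s IHs] /=; first by rewrite mul0r !add0r expr0 mulr1.
  by rewrite IHs exprS; ring.
rewrite hc -[horner_rec (rev _) _]horner_Poly -IH // size_rev [horner_rec (c :: _) _]/= rmorphD rmorphM /=.
rewrite fmorphV /= conjCK (CrealP cr) exprS.
by move: (_ ^* ) (z ^+ size l) => X Y; field.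
Qed.

(** The reduction [q] of a stable polynomial [p], [X q = a p - b p#], has no
    root outside the disc: there [|p#| <= |p|] and [|b| < |a|] would force [p = 0]. *)
Lemma stable_reduction (p : {poly C}) (a b z Q : C) :
  p != 0 -> (forall w, root p w -> `|w| < 1) -> `|b| < `|a| -> 1 <= `|z| ->
  z * Q = a * p.[z] - b * reversal p z -> Q != 0.
Proof.
move=> p0 hp ba z1 EQ; apply: contraTneq ba => Q0; rewrite Q0 mulr0 in EQ.
have pz : p.[z] != 0.
  by apply: contraL z1 => pz; rewrite -real_ltNge ?num_real ?normr_real // hp // /root.
have := blaschke p0 hp z1; rewrite -real_leNgt ?normr_real //.
move/esym/eqP: EQ; rewrite subr_eq0 => /eqP EQ.
move=> h; rewrite -(ler_pM2r (x := `|p.[z]|)) ?normr_gt0 // -normrM EQ normrM.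
exact: ler_wpM2l.
Qed.

End Quartic.

Section QuarticR.
Variable R : realType.
Variables a0 a1 a2 a3 : R.
Local Notation C := R[i].
Local Notation "x %:c" := (real_complex R x) (at level 2, format "x %:c").

Let b3 := 1 - a0 ^+ 2.
Let b2 := a3 - a0 * a1.
Let b1 := a2 - a0 * a2.
Let b0 := a1 - a0 * a3.
Let c2 := b3 ^+ 2 - b0 ^+ 2.
Let c1 := b3 * b2 - b0 * b1.
Let c0 := b3 * b1 - b0 * b2.

(** The last of Jury's inequalities for
    [X^4 + a3 X^3 + a2 X^2 + a1 X + a0]; [b] and [c] above are the coefficients of
    the first and the second Schur-Cohn reduction. *)
Definition jury := (1 - a0) ^+ 2 * (1 + a0 - a2) + (a1 - a0 * a3) * (a3 - a1).

Let c2Bc0 : c2 - c0 = (1 + a0) * jury.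
Proof. rewrite /jury /c2 /c0 /b0 /b1 /b2 /b3; ring. Qed.

Definition quartic (z : C) := z ^+ 4 + a3%:c * z ^+ 3 + a2%:c * z ^+ 2 + a1%:c * z + a0%:c.

Hypothesis a0_lt1 : `|a0| < 1.
Hypothesis b0_lt : `|b0| < b3.

Let sqr_lt (x y : R) : `|x| < y -> x%:c ^+ 2 < y%:c ^+ 2.
Proof.
move=> xy; rewrite -!rmorphXn ltcR -(real_normK (num_real x)).
by rewrite ltr_pXn2r // nnegrE (le_trans _ (ltW xy)).
Qed.

Let creal (x : R) : x%:c \is Num.real.
Proof. by rewrite complex_real. Qed.

(** Schur-Cohn recursion from degree 1 up to degree 4: each level is nonzero at
    [z] and dominates its reversal there, as soon as its leading coefficient
    dominates its constant one. The values at [1] and [-1] settle degree 1 and,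
    with [jury], degree 2. *)
Lemma quartic_stable (z : C) : 0 < 1 + a3 + a2 + a1 + a0 -> 0 < 1 - a3 + a2 - a1 + a0 ->
  0 < jury -> 1 <= `|z| -> quartic z != 0.
Proof.
move=> p1 pm1 j0 z1.
have [a0m a0p] : -1 < a0 /\ a0 < 1 by move: a0_lt1; rewrite ltr_norml => /andP.
have [b0m b0p] : - b3 < b0 /\ b0 < b3 by move: b0_lt; rewrite ltr_norml => /andP.
have d1 : 0 < c2 - c0 by rewrite c2Bc0 mulr_gt0 //; lra.
have s1 : 0 < c2 + c1 + c0.
  have -> : c2 + c1 + c0 = (b3 - b0) * ((1 - a0) * (1 + a3 + a2 + a1 + a0)).
    rewrite /c2 /c1 /c0 /b0 /b1 /b2 /b3; ring.
  by rewrite !mulr_gt0 // subr_gt0.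
have s2 : 0 < c2 - c1 + c0.
  have -> : c2 - c1 + c0 = (b3 + b0) * ((1 - a0) * (1 - a3 + a2 - a1 + a0)).
    rewrite /c2 /c1 /c0 /b0 /b1 /b2 /b3; ring.
  by rewrite !mulr_gt0 // ?subr_gt0 //; lra.
have hc0 : `|c0| < c2 by rewrite ltr_norml; apply/andP; split; lra.
have hc1 : `|c1| < c2 + c0 by rewrite ltr_norml; apply/andP; split; lra.
have cp : 0 < c2 + c0 by apply: le_lt_trans hc1.
pose P := quartic z.
pose Ps := 1 + a3%:c * z + a2%:c * z ^+ 2 + a1%:c * z ^+ 3 + a0%:c * z ^+ 4.
pose Q := b3%:c * z ^+ 3 + b2%:c * z ^+ 2 + b1%:c * z + b0%:c.
pose Qs := b3%:c + b2%:c * z + b1%:c * z ^+ 2 + b0%:c * z ^+ 3.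
pose S := c2%:c * z ^+ 2 + c1%:c * z + c0%:c.
pose Ss := c2%:c + c1%:c * z + c0%:c * z ^+ 2.
pose L := (c2 + c0)%:c * z + c1%:c.
pose Ls := (c2 + c0)%:c + c1%:c * z.
pose K := ((c2 + c0) ^+ 2 - c1 ^+ 2)%:c.
have [L0 LL] : L != 0 /\ `|Ls| <= `|L|.
  apply: (@schur_cohn_step _ (c2 + c0)%:c c1%:c z L Ls K K) => //.
  - exact: sqr_lt.
  - by rewrite /K /L /Ls !(rmorphB, rmorphXn, rmorphD) /=; ring.
  - by rewrite /K /L /Ls !(rmorphB, rmorphXn, rmorphD) /=; ring.
  - rewrite /K fmorph_eq0 gt_eqF // subr_gt0 -(real_normK (num_real c1)).
    by rewrite ltr_pXn2r // nnegrE ltW.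
have [S0 SS] : S != 0 /\ `|Ss| <= `|S|.
  apply: (@schur_cohn_step _ c2%:c c0%:c z S Ss ((c2 - c0)%:c * L) ((c2 - c0)%:c * Ls)) => //.
  - exact: sqr_lt.
  - by rewrite /S /Ss /L !(rmorphB, rmorphXn, rmorphD) /=; ring.
  - by rewrite /S /Ss /Ls !(rmorphB, rmorphXn, rmorphD) /=; ring.
  - by rewrite mulf_neq0 // fmorph_eq0 gt_eqF.
  - by rewrite !normrM ler_wpM2l.
have [Q0 QQ] : Q != 0 /\ `|Qs| <= `|Q|.
  apply: (@schur_cohn_step _ b3%:c b0%:c z Q Qs S Ss) => //.
  - exact: sqr_lt.
  - by rewrite /S /Q /Qs /c2 /c1 /c0 !(rmorphB, rmorphM, rmorphXn, rmorphD) /=; ring.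
  - by rewrite /Ss /Q /Qs /c2 /c1 /c0 !(rmorphB, rmorphM, rmorphXn, rmorphD) /=; ring.
have [] // : P != 0 /\ `|Ps| <= `|P|.
apply: (@schur_cohn_step _ 1%:c a0%:c z P Ps Q Qs) => //.
- exact: sqr_lt.
- by rewrite /P /quartic /Ps /Q /b3 /b2 /b1 /b0 !(rmorphB, rmorphM, rmorphXn, rmorphD, rmorph1) /=; ring.
- by rewrite /P /quartic /Ps /Qs /b3 /b2 /b1 /b0 !(rmorphB, rmorphM, rmorphXn, rmorphD, rmorph1) /=; ring.
Qed.

(** Conversely the first two reductions of a stable quartic are stable, and
    stability of the quadratic bounds its constant coefficient. *)
Lemma stable_quartic : (forall z, quartic z = 0 -> `|z| < 1) -> 0 < jury.
Proof.
move=> hq.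
have [a0m a0p] : -1 < a0 /\ a0 < 1 by move: a0_lt1; rewrite ltr_norml => /andP.
have [b0m b0p] : - b3 < b0 /\ b0 < b3 by move: b0_lt; rewrite ltr_norml => /andP.
have b3p : 0 < b3 by lra.
have c2p : 0 < c2.
  by rewrite subr_gt0 -(real_normK (num_real b0)) ltr_pXn2r // nnegrE ltW.
have normc (x : R) : `|x%:c| = `|x|%:c by rewrite normc_def /= expr0n addr0 sqrtr_sqr.
have out (p : {poly C}) : (forall z, 1 <= `|z| -> p.[z] != 0) -> forall w, root p w -> `|w| < 1.
  move=> h w; rewrite real_ltNge ?normr_real ?real1 //; apply: contraL => /h.
  by rewrite /root.
have sz (l : seq C) x : x != 0 -> size (Poly (rcons l x)) = size (rcons l x).
  by move=> x0; rewrite (@PolyK _ 0) // last_rcons.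
have p0 (l : seq C) x : x != 0 -> Poly (rcons l x) != 0.
  by move=> x0; rewrite -size_poly_gt0 sz // size_rcons.
pose lp := [:: a0%:c; a1%:c; a2%:c; a3%:c; 1].
pose lq := [:: b0%:c; b1%:c; b2%:c; b3%:c].
pose lr := [:: c0%:c; c1%:c; c2%:c].
have b3c : b3%:c != 0 by rewrite fmorph_eq0 gt_eqF.
have c2c : c2%:c != 0 by rewrite fmorph_eq0 gt_eqF.
have Pp w : root (Poly lp) w -> `|w| < 1.
  move=> /eqP h; apply: hq; rewrite -h /quartic horner_Poly /=; ring.
have Qp : forall w, root (Poly lq) w -> `|w| < 1.
  apply: out => z z1; have z0 : z != 0 by rewrite -normr_gt0 (lt_le_trans _ z1).
  apply: (@stable_reduction _ (Poly lp) 1 a0%:c z) => //.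
  - exact: (p0 [:: _; _; _; _]) (oner_neq0 _).
  - by rewrite normc normr1 -(rmorph1 (real_complex R)) ltcR.
  - rewrite reversal_Poly //; last exact: (sz [:: _; _; _; _]) (oner_neq0 _).
    + rewrite !horner_Poly /rev /= /b0 /b1 /b2 /b3 !(rmorphB, rmorphM, rmorphXn, rmorphD, rmorph1) /=; ring.
    + by rewrite /= !creal ?real1.
have Rp : forall w, root (Poly lr) w -> `|w| < 1.
  apply: out => z z1; have z0 : z != 0 by rewrite -normr_gt0 (lt_le_trans _ z1).
  apply: (@stable_reduction _ (Poly lq) b3%:c b0%:c z) => //.
  - exact: (p0 [:: _; _; _]) b3c.
  - by rewrite !normc ltcR (ltr_normr _ b3) b0_lt orTb.
  - rewrite reversal_Poly //; last exact: (sz [:: _; _; _]) b3c.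
    + rewrite !horner_Poly /rev /= /c0 /c1 /c2 !(rmorphB, rmorphM, rmorphXn, rmorphD, rmorph1) /=; ring.
    + by rewrite /= !creal.
have szr : size (Poly lr) = 3%N := sz [:: _; _] _ c2c.
have := stable_coef0 _ Rp; rewrite szr lead_coefE szr !coef_Poly /= => /(_ isT).
rewrite !normc ltcR (gtr0_norm c2p) ltr_norml => /andP[_ h].
have : 0 < (1 + a0) * jury by rewrite -c2Bc0 subr_gt0.
by rewrite pmulr_rgt0 //; lra.
Qed.

End QuarticR.

(** * Characteristic polynomials of matrices of size 4 *)

Section Det4.
Variable K : comNzRingType.

Lemma det_funS n (b : nat -> nat -> K) :
  \det (\matrix_(i < n.+1, j < n.+1) b i j) =
  \sum_(j < n.+1) (-1) ^+ j * b 0%N j * \det (\matrix_(i < n, k < n) b i.+1 (bump j k)).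
Proof.
rewrite (expand_det_row _ ord0); apply: eq_bigr => j _.
rewrite /cofactor mxE /= add0n mulrCA mulrA; congr (_ * \det _).
by apply/matrixP => i k; rewrite !mxE.
Qed.

(** The Laplace expansion along the first row, in a form that computes. *)
Fixpoint laplace n (b : nat -> nat -> K) : K :=
  if n is n'.+1 then
    foldr (fun j s => (-1) ^+ j * b 0%N j * laplace n' (fun i k => b i.+1 (bump j k)) + s)
      0 (iota 0 n'.+1)
  else 1.

Lemma det_laplace n (b : nat -> nat -> K) :
  \det (\matrix_(i < n, j < n) b i j) = laplace n b.
Proof.
elim: n b => [|n IH] b; first by rewrite det_mx00.
rewrite det_funS -(big_mkord xpredT (fun j => (-1) ^+ j * b 0%N j *
  \det (\matrix_(i < n, k < n) b i.+1 (bump j k)))) /index_iota subn0 /=.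
rewrite unlock /reducebig /=; congr (_ + _); first by rewrite (IH (fun i k => b i.+1 (bump 0 k))).
elim: (iota 1 n) => [//|j s IHs] /=.
by rewrite IHs (IH (fun i k => b i.+1 (bump j k))).
Qed.

(** The coefficients of the characteristic polynomial of a 4 x 4 matrix, as
    signed sums of principal minors. *)
Definition pm1 (b : nat -> nat -> K) i := b i i.
Definition pm2 (b : nat -> nat -> K) i j := b i i * b j j - b i j * b j i.
Definition pm3 (b : nat -> nat -> K) i j k :=
  b i i * (b j j * b k k - b j k * b k j) - b i j * (b j i * b k k - b j k * b k i)
  + b i k * (b j i * b k j - b j j * b k i).
Definition cp3 b := - (pm1 b 0%N + pm1 b 1%N + pm1 b 2%N + pm1 b 3%N).
Definition cp2 b := pm2 b 0%N 1%N + pm2 b 0%N 2%N + pm2 b 0%N 3%N + pm2 b 1%N 2%N + pm2 b 1%N 3%N + pm2 b 2%N 3%N.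
Definition cp1 b := - (pm3 b 0%N 1%N 2%N + pm3 b 0%N 1%N 3%N + pm3 b 0%N 2%N 3%N + pm3 b 1%N 2%N 3%N).
Definition cp0 (b : nat -> nat -> K) :=
  b 0%N 0%N * (b 1%N 1%N * (b 2%N 2%N * b 3%N 3%N - b 2%N 3%N * b 3%N 2%N)
    - b 1%N 2%N * (b 2%N 1%N * b 3%N 3%N - b 2%N 3%N * b 3%N 1%N)
    + b 1%N 3%N * (b 2%N 1%N * b 3%N 2%N - b 2%N 2%N * b 3%N 1%N))
  - b 0%N 1%N * (b 1%N 0%N * (b 2%N 2%N * b 3%N 3%N - b 2%N 3%N * b 3%N 2%N)
    - b 1%N 2%N * (b 2%N 0%N * b 3%N 3%N - b 2%N 3%N * b 3%N 0%N)
    + b 1%N 3%N * (b 2%N 0%N * b 3%N 2%N - b 2%N 2%N * b 3%N 0%N))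
  + b 0%N 2%N * (b 1%N 0%N * (b 2%N 1%N * b 3%N 3%N - b 2%N 3%N * b 3%N 1%N)
    - b 1%N 1%N * (b 2%N 0%N * b 3%N 3%N - b 2%N 3%N * b 3%N 0%N)
    + b 1%N 3%N * (b 2%N 0%N * b 3%N 1%N - b 2%N 1%N * b 3%N 0%N))
  - b 0%N 3%N * (b 1%N 0%N * (b 2%N 1%N * b 3%N 2%N - b 2%N 2%N * b 3%N 1%N)
    - b 1%N 1%N * (b 2%N 0%N * b 3%N 2%N - b 2%N 2%N * b 3%N 0%N)
    + b 1%N 2%N * (b 2%N 0%N * b 3%N 1%N - b 2%N 1%N * b 3%N 0%N)).

Lemma det_char4 (b : nat -> nat -> K) z :
  \det (\matrix_(i < 4, j < 4) (z *+ (i == j :> nat) - b i j)) =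
  z ^+ 4 + cp3 b * z ^+ 3 + cp2 b * z ^+ 2 + cp1 b * z + cp0 b.
Proof.
rewrite (det_laplace _ (fun i j => z *+ (i == j) - b i j)) /= /bump /=.
rewrite !mulr1n !mulr0n /cp3 /cp2 /cp1 /cp0 /pm3 /pm2 /pm1 /=.
move: (b 0%N 0%N) (b 0%N 1%N) (b 0%N 2%N) (b 0%N 3%N) (b 1%N 0%N) (b 1%N 1%N) (b 1%N 2%N) (b 1%N 3%N)
 (b 2%N 0%N) (b 2%N 1%N) (b 2%N 2%N) (b 2%N 3%N) (b 3%N 0%N) (b 3%N 1%N) (b 3%N 2%N) (b 3%N 3%N) =>
 b00 b01 b02 b03 b10 b11 b12 b13 b20 b21 b22 b23 b30 b31 b32 b33.
ring.
Qed.
Lemma cp_scale (b : nat -> nat -> K) d :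
  [/\ cp3 (fun i j => b i j * d) = cp3 b * d, cp2 (fun i j => b i j * d) = cp2 b * d ^+ 2,
      cp1 (fun i j => b i j * d) = cp1 b * d ^+ 3 & cp0 (fun i j => b i j * d) = cp0 b * d ^+ 4].
Proof. by rewrite /cp3 /cp2 /cp1 /cp0 /pm3 /pm2 /pm1; split; ring. Qed.

(** All four coefficients are affine in the last row. *)
Lemma cp_affine (b u w : nat -> nat -> K) t :
  (forall i j, b i j = if i == 3%N then (1 - t) * u i j + t * w i j else u i j) ->
  (forall i j, i != 3%N -> w i j = u i j) ->
  [/\ cp3 b = (1 - t) * cp3 u + t * cp3 w, cp2 b = (1 - t) * cp2 u + t * cp2 w,
      cp1 b = (1 - t) * cp1 u + t * cp1 w & cp0 b = (1 - t) * cp0 u + t * cp0 w].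
Proof.
move=> hb hw; rewrite /cp3 /cp2 /cp1 /cp0 /pm3 /pm2 /pm1 !hb /=.
rewrite !(hw 0%N) // !(hw 1%N) // !(hw 2%N) //.
by split; ring.
Qed.
End Det4.

(** Stated for bare functions, so as to apply to integers seen inside the
    complex numbers. *)
Lemma cp_morph (K L : comNzRingType) (h : K -> L) (b : nat -> nat -> K) :
  {morph h : x y / x + y} -> {morph h : x y / x * y} -> {morph h : x / - x} ->
  let hb i j := h (b i j) in
  [/\ cp3 hb = h (cp3 b), cp2 hb = h (cp2 b), cp1 hb = h (cp1 b) & cp0 hb = h (cp0 b)].
Proof.
by move=> hD hM hN hb; rewrite /hb /cp3 /cp2 /cp1 /cp0 /pm3 /pm2 /pm1 !(hD, hM, hN).
Qed.

(** * Eigenvalues of the linearised step outside the disc *)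

Section ComplexT01.
Variable R : realType.
Local Notation C := R[i].
Local Notation toC := (map_mx (real_complex R)).
Local Notation "x %:c" := (real_complex R x) (at level 2, format "x %:c").
Implicit Types (v : 'cV[C]_(2 + 2 + 2)) (V : seq C).

Definition zc (a : Z) : C := (zr R a)%:c.

Fixpoint dotC (c : seq Z) V : C :=
  if c is a :: c' then (if V is x :: V' then zc a * x + dotC c' V' else 0) else 0.

Lemma complex_split (x : C) : x = (complex.Re x)%:c + 'i%C * (complex.Im x)%:c.
Proof. by case: x => x y; rewrite [LHS]complexE /= mulrC. Qed.

Lemma dotC_split c V :
  dotC c V = (dot c [seq complex.Re x | x <- V])%:c + 'i%C * (dot c [seq complex.Im x | x <- V])%:c.
Proof.
elim: c V => [|a c IH] [|x V] /=; rewrite ?rmorph0 ?mulr0 ?addr0 //.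
by rewrite IH {1}[x]complex_split /zc !(rmorphD, rmorphM) /=; ring.
Qed.

Definition coordsC v : seq C :=
  [:: v (lshift 2 (lshift 2 0)) 0; v (lshift 2 (lshift 2 1)) 0;
      v (lshift 2 (rshift 2 0)) 0; v (lshift 2 (rshift 2 1)) 0;
      v (rshift (2 + 2) 0) 0; v (rshift (2 + 2) 1) 0].

Definition T01_rowsC (tau : R) V : seq C :=
  [:: dotC (row_y false) V / zc dD; dotC (row_y true) V / zc dD; 0;
      dotC (row_s true) V / zc dD;
      (1 - tau)%:c * nth 0 V 4 + tau%:c * (dotC (row_s false) V / zc dD);
      (1 - tau)%:c * nth 0 V 5].

(** [T01] is real, so it acts separately on real and imaginary parts. *)
Lemma coordsC_T01 tau v : coordsC (toC (T01 tau) *m v) = T01_rowsC tau (coordsC v).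
Proof.
pose a := map_mx (@complex.Re R) v; pose b := map_mx (@complex.Im R) v.
have vE : v = toC a + 'i%C *: toC b.
  by apply/matrixP => i j; rewrite !mxE -complex_split.
have ca : [seq complex.Re x | x <- coordsC v] = coords a by rewrite /coords /ypart /zpart /lpart !mxE.
have cb : [seq complex.Im x | x <- coordsC v] = coords b by rewrite /coords /ypart /zpart /lpart !mxE.
have TE : toC (T01 tau) *m v = toC (T01 tau *m a) + 'i%C *: toC (T01 tau *m b).
  by rewrite {1}vE mulmxDr -scalemxAr !map_mxM.
have Ta := coords_T01 tau a; have Tb := coords_T01 tau b.
have cC (e f : 'cV[R]_(2 + 2 + 2)) k : nth 0 (coordsC (toC e + 'i%C *: toC f)) k =
    (nth 0 (coords e) k)%:c + 'i%C * (nth 0 (coords f) k)%:c.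
  by rewrite /coordsC /coords /ypart /zpart /lpart; case: k => [|[|[|[|[|[|k]]]]]];
    rewrite /= ?mxE // !nth_nil !rmorph0 mulr0 addr0.
apply: (@eq_from_nth _ 0) => // k k6; rewrite TE cC Ta Tb /T01_rowsC !dotC_split ca cb.
have n4 k' : nth 0 (coordsC v) k' = (nth 0 (coords a) k')%:c + 'i%C * (nth 0 (coords b) k')%:c.
  by rewrite {1}vE cC.
rewrite !n4 /T01_rows /zc; move: (coords a) (coords b) => la lb.
move: (dot (row_y false) la) (dot (row_y true) la) (dot (row_s false) la) (dot (row_s true) la)
  (dot (row_y false) lb) (dot (row_y true) lb) (dot (row_s false) lb) (dot (row_s true) lb)
  (nth 0 la) (nth 0 lb) (zr R dD) => p0 p1 p2 p3 q0 q1 q2 q3 na nb d.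
by case: k k6 => [|[|[|[|[|[|//]]]]]] _;
   rewrite /= !(rmorphD, rmorphM, fmorphV, rmorph0, rmorphB, rmorph1) /=; ring.
Qed.

Section Reduced.
Variable tau : R.

(** The coordinates on which the linearised step acts with eigenvalues other
    than [0] (second slack) and [1 - tau] (second multiplier). *)
Definition keep := [:: 0; 1; 3; 4]%N.

(** Entries, over [dD], of the matrix on these coordinates at [tau = 1]; for
    [red_int0] at [tau = 0], where the multiplier does not move. *)
Definition red_int (i j : nat) : Z :=
  nth 0%BZ (nth [::] [:: row_y false; row_y true; row_s true; row_s false] i) (nth 0%N keep j).
Definition red_int0 (i j : nat) : Z :=
  if i == 3%N then (if j == 3%N then dD else 0%BZ) else red_int i j.

Definition red_mx (i j : nat) : C :=
  if i == 3%N then (1 - tau)%:c * (zc (red_int0 i j) / zc dD) + tau%:c * (zc (red_int i j) / zc dD)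
  else zc (red_int i j) / zc dD.

Lemma zc_dD : zc dD != 0.
Proof. by rewrite /zc fmorph_eq0 zr_eq0. Qed.

Lemma zc0 : zc 0 = 0. Proof. by rewrite /zc zr0 rmorph0. Qed.

Lemma dotC_keep i x0 x1 x3 x4 : (i < 4)%N ->
  dotC (nth [::] [:: row_y false; row_y true; row_s true; row_s false] i)
    [:: x0; x1; 0; x3; x4; 0] =
  zc (red_int i 0%N) * x0 + zc (red_int i 1%N) * x1 + zc (red_int i 2%N) * x3 + zc (red_int i 3%N) * x4.
Proof. by case: i => [|[|[|[|//]]]] _; rewrite /red_int /keep /=; ring. Qed.

Definition vec4 (x0 x1 x3 x4 : C) : 'rV[C]_4 := \row_(i < 4) nth 0 [:: x0; x1; x3; x4] i.

Lemma red_mx_kernel z x0 x1 x3 x4 :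
  (T01_rowsC tau [:: x0; x1; 0; x3; x4; 0] = [seq z * x | x <- [:: x0; x1; 0; x3; x4; 0]]) <->
  vec4 x0 x1 x3 x4 *m (\matrix_(i < 4, j < 4) (z *+ (i == j :> nat) - red_mx i j))^T = 0.
Proof.
have dD0 := zc_dD.
have E (i : 'I_4) : (vec4 x0 x1 x3 x4 *m
    (\matrix_(i < 4, j < 4) (z *+ (i == j :> nat) - red_mx i j))^T) 0 i =
  x0 * (z *+ (i == 0%N :> nat) - red_mx i 0%N) + x1 * (z *+ (i == 1%N :> nat) - red_mx i 1%N) +
  x3 * (z *+ (i == 2%N :> nat) - red_mx i 2%N) + x4 * (z *+ (i == 3%N :> nat) - red_mx i 3%N).
  by rewrite !mxE !big_ord_recl big_ord0 !mxE /= addr0 !addrA.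
have K := dotC_keep x0 x1 x3 x4.
have K0 := K 0%N isT; have K1 := K 1%N isT; have K2 := K 2%N isT; have K3 := K 3%N isT.
rewrite [nth _ _ _]/= in K0; rewrite [nth _ _ _]/= in K1.
rewrite [nth _ _ _]/= in K2; rewrite [nth _ _ _]/= in K3.
rewrite /T01_rowsC K0 K1 K2 K3 {K K0 K1 K2 K3}.
rewrite [nth _ _ 4]/= [nth _ _ 5]/= mulr0 [map _ _]/= mulr0.
have R30 j : red_mx 3 j = (1 - tau)%:c * (if j == 3%N then 1 else 0) + tau%:c * (zc (red_int 3 j) / zc dD).
  rewrite /red_mx /red_int0 /=; case: (j == 3%N); first by rewrite divff.
  by rewrite zc0 mul0r.
have Rlt i j : i != 3%N -> red_mx i j = zc (red_int i j) / zc dD.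
  by move=> /negPf i3; rewrite /red_mx i3.
split.
  case=> h0 h1 h2 h3; apply/matrixP => i j; rewrite (ord1 i) E mxE.
  case: j => [[|[|[|[|//]]]] _] /=; rewrite ?R30 ?Rlt // ?mulr1n ?mulr0n.
  - by rewrite -[RHS](subrr (z * x0)) -{2}h0; ring.
  - by rewrite -[RHS](subrr (z * x1)) -{2}h1; ring.
  - by rewrite -[RHS](subrr (z * x3)) -{2}h2; ring.
  - by rewrite -[RHS](subrr (z * x4)) -{2}h3 /=; ring.
move=> h; have {}E (i : 'I_4) := esym (E i); rewrite h in E.
have := E (Ordinal (isT : (0 < 4)%N)); have := E (Ordinal (isT : (1 < 4)%N)).
have := E (Ordinal (isT : (2 < 4)%N)); have := E (Ordinal (isT : (3 < 4)%N)).
rewrite /= !mxE !R30 !Rlt // ?mulr1n ?mulr0n /= => e3 e2 e1 e0.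
congr [:: _; _; _; _; _; _].
- by rewrite -[RHS]subr0 -e0; ring.
- by rewrite -[RHS]subr0 -e1; ring.
- by rewrite -[RHS]subr0 -e2; ring.
- by rewrite -[RHS]subr0 -e3; ring.
Qed.
Lemma coordsC_inj : injective coordsC.
Proof.
move=> u v [h0 h1 h2 h3 h4 h5]; apply/matrixP => i j; rewrite (ord1 j).
case: (split_ordP i) => k ->; last by case: (ord2P k) => ->.
by case: (split_ordP k) => l ->; case: (ord2P l) => ->.
Qed.

Lemma coordsCZ z v : coordsC (z *: v) = [seq z * x | x <- coordsC v].
Proof. by rewrite /coordsC /= !mxE. Qed.

(** In an eigenvector for [z] outside the disc the two coordinates dropped by
    [keep] vanish, as their eigenvalues [0] and [1 - tau] lie inside. *)
Lemma eigenvalue_T01 z : 0 < tau < 2 -> 1 <= `|z| ->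
  eigenvalue (toC (T01 tau)) z =
  (\det (\matrix_(i < 4, j < 4) (z *+ (i == j :> nat) - red_mx i j)) == 0).
Proof.
move=> /andP[t0 t1] z1; rewrite -det_tr.
apply/(@eigenvalue_colP R 5 (T01 tau) z)/det0P => [[v v0 Tv]|[u u0 uA]].
  have := coordsC_T01 tau v; rewrite [X in coordsC X]Tv coordsCZ.
  have : coordsC v != nseq 6 0.
    apply: contra v0 => /eqP h; apply/eqP/coordsC_inj; rewrite h /coordsC.
    by rewrite !mxE.
  rewrite /coordsC; set x0 := v _ 0; set x1 := v _ 0; set x2 := v _ 0.
  set x3 := v _ 0; set x4 := v _ 0; set x5 := v _ 0 => V0 hV.
  have z0 : z != 0 by rewrite -normr_gt0 (lt_le_trans _ z1).
  have x20 : x2 = 0.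
    have /eqP := congr1 (nth 0 ^~ 2%N) hV; rewrite /= mulf_eq0 (negPf z0).
    by move/eqP.
  have x50 : x5 = 0.
    have /eqP := congr1 (nth 0 ^~ 5%N) hV; rewrite /= -subr_eq0 -mulrBl mulf_eq0.
    case/orP => [|/eqP //]; rewrite subr_eq0 => /eqP zt; move: z1.
    rewrite zt normc_def /= expr0n addr0 sqrtr_sqr -(rmorph1 (real_complex R)) lecR leNgt.
    by move/negP; case; rewrite ltr_norml; apply/andP; split; lra.
  rewrite x20 x50 in hV V0; exists (vec4 x0 x1 x3 x4); last exact/red_mx_kernel/esym.
  apply: contra V0 => /eqP /matrixP h.
  have := h 0 (Ordinal (isT : (0 < 4)%N)); have := h 0 (Ordinal (isT : (1 < 4)%N)).
  have := h 0 (Ordinal (isT : (2 < 4)%N)); have := h 0 (Ordinal (isT : (3 < 4)%N)).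
  by rewrite !mxE /= => -> -> -> ->.
pose x i := u 0 (inord i : 'I_4).
pose V := [:: x 0%N; x 1%N; 0; x 2%N; x 3%N; 0].
pose v : 'cV[C]_(2 + 2 + 2) := \col_i nth 0 V i.
have vE : coordsC v = V by rewrite /coordsC !mxE.
have uE : u = vec4 (x 0%N) (x 1%N) (x 2%N) (x 3%N).
  apply/matrixP => i j; rewrite (ord1 i) mxE.
  by case: j => [[|[|[|[|//]]]] ?] /=; congr (u 0 _); apply/val_inj; rewrite /= inordK.
exists v.
  apply: contra u0 => /eqP v0; rewrite uE.
  have : coordsC v = nseq 6 0 by rewrite v0 /coordsC !mxE.
  rewrite vE /V => -[-> -> -> ->]; apply/eqP/matrixP => i j; rewrite !mxE.
  by case: j => [[|[|[|[|//]]]] ?].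
apply: coordsC_inj; rewrite coordsC_T01 coordsCZ vE; apply/red_mx_kernel.
by rewrite -uE.
Qed.
End Reduced.
End ComplexT01.

(** * The critical multiplier step *)

Section Critical.

(** Products and differences of polynomials in [tau] with integer coefficients,
    constant term first. *)
Fixpoint zmul (p q : seq Z) : seq Z :=
  if p is a :: p' then ladd (lscale a q) (0%BZ :: zmul p' q) else [::].
Definition zsub p q := ladd p (lscale (-1)%BZ q).

Variable R : realType.
Implicit Types (t tau : R).

Definition peval (p : seq Z) t : R := foldr (fun a x => zr R a + t * x) 0 p.

Lemma peval_ladd p q t : peval (ladd p q) t = peval p t + peval q t.
Proof.
elim: p q => [|a p IH] [|b q] /=; rewrite ?addr0 ?add0r //.
by rewrite IH zrD; ring.
Qed.

Lemma peval_lscale a p t : peval (lscale a p) t = zr R a * peval p t.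
Proof. by elim: p => [|b p IH] /=; rewrite ?mulr0 // IH zrM; ring. Qed.

Lemma peval_zmul p q t : peval (zmul p q) t = peval p t * peval q t.
Proof.
elim: p => [|a p IH]; rewrite /= ?mul0r // peval_ladd peval_lscale /= IH zr0; ring.
Qed.

Lemma peval_zsub p q t : peval (zsub p q) t = peval p t - peval q t.
Proof. by rewrite peval_ladd peval_lscale !zrE; ring. Qed.

Definition dW : Z := (dD * dD * dD * dD)%BZ.

(** Coefficients, over the denominator [dW], of the quartic at [tau = 0] and
    at [tau = 1]; in between they are affine. *)
Definition charcoef (b : nat -> nat -> Z) : seq Z :=
  [:: cp0 b; (cp1 b * dD)%BZ; (cp2 b * dD * dD)%BZ; (cp3 b * dD * dD * dD)%BZ].
Definition alpha := Eval vm_compute in charcoef red_int0.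
Definition beta := Eval vm_compute in charcoef red_int.
Lemma alphaE : [/\ nth 0%BZ alpha 0 = cp0 red_int0,
  nth 0%BZ alpha 1 = (cp1 red_int0 * dD)%BZ, nth 0%BZ alpha 2 = (cp2 red_int0 * dD * dD)%BZ
  & nth 0%BZ alpha 3 = (cp3 red_int0 * dD * dD * dD)%BZ].
Proof. by split; vm_compute. Qed.

Lemma betaE : [/\ nth 0%BZ beta 0 = cp0 red_int,
  nth 0%BZ beta 1 = (cp1 red_int * dD)%BZ, nth 0%BZ beta 2 = (cp2 red_int * dD * dD)%BZ
  & nth 0%BZ beta 3 = (cp3 red_int * dD * dD * dD)%BZ].
Proof. by split; vm_compute. Qed.

Definition cpoly k : seq Z := [:: nth 0%BZ alpha k; (nth 0%BZ beta k - nth 0%BZ alpha k)%BZ].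
Definition coef k tau : R := peval (cpoly k) tau / zr R dW.

Lemma dW_gt0 : 0 < zr R dW. Proof. by rewrite -zr0 zr_lt. Qed.

Lemma coefE k tau : coef k tau =
  ((1 - tau) * zr R (nth 0%BZ alpha k) + tau * zr R (nth 0%BZ beta k)) / zr R dW.
Proof.
rewrite /coef /cpoly; move: (nth _ alpha k) (nth _ beta k) => a b.
by rewrite /= mulr0 addr0 zrB; congr (_ / _); ring.
Qed.

Lemma det_red_mx tau (z : R[i]) :
  \det (\matrix_(i < 4, j < 4) (z *+ (i == j :> nat) - red_mx tau i j)) =
  quartic (coef 0 tau) (coef 1 tau) (coef 2 tau) (coef 3 tau) z.
Proof.
rewrite det_char4 /quartic.
pose u i j := zc R (red_int0 i j) * (zc R dD)^-1.
pose w i j := zc R (red_int i j) * (zc R dD)^-1.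
have [] := @cp_affine _ (red_mx tau) u w (real_complex R tau).
- by move=> i j; rewrite /red_mx /red_int0 /u rmorphB rmorph1 /= /red_int0; case: eqP.
- by move=> i j /negPf i3; rewrite /w /u /red_int0 i3.
have [] := cp_scale (fun i j => zc R (red_int0 i j)) (zc R dD)^-1.
have [] := cp_scale (fun i j => zc R (red_int i j)) (zc R dD)^-1.
have zD : {morph zc R : x y / x + y} by move=> x y; rewrite /zc zrD rmorphD.
have zM : {morph zc R : x y / x * y} by move=> x y; rewrite /zc zrM rmorphM.
have zN : {morph zc R : x / - x} by move=> x; rewrite /zc zrN rmorphN.
have [] := cp_morph red_int0 zD zM zN; have [] := cp_morph red_int zD zM zN.
rewrite /u /w => -> -> -> -> -> -> -> -> -> -> -> -> -> -> -> -> -> -> -> ->.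
have dD0 : real_complex R (zr R dD) != 0 by apply: zc_dD.
rewrite !coefE; have [-> -> -> ->] := alphaE; have [-> -> -> ->] := betaE.
move: dD0; generalize (cp0 red_int0) (cp1 red_int0) (cp2 red_int0) (cp3 red_int0)
  (cp0 red_int) (cp1 red_int) (cp2 red_int) (cp3 red_int) => x0 x1 x2 x3 y0 y1 y2 y3.
rewrite /dW /zc; move: dD => d d0.
rewrite !zrM; move: (zr R d) (zr R x0) (zr R x1) (zr R x2) (zr R x3)
  (zr R y0) (zr R y1) (zr R y2) (zr R y3) d0 => {x0 x1 x2 x3 y0 y1 y2 y3}e x0 x1 x2 x3 y0 y1 y2 y3 e0.
rewrite !(rmorphD, rmorphM, rmorphN) !fmorphV !(rmorphD, rmorphM, rmorphN) !rmorph1 /=.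
move: e0. move: (real_complex R e) (real_complex R tau) (real_complex R x0) (real_complex R x1) (real_complex R x2) (real_complex R x3)
 (real_complex R y0) (real_complex R y1) (real_complex R y2) (real_complex R y3).
move=> E t X0 X1 X2 X3 Y0 Y1 Y2 Y3 E0.
by field.
Qed.

Lemma coef_bounds k (lo hi : Z) tau : 0 <= tau <= 1 ->
  [&& (lo * dW <=? 1000 * nth 0%BZ alpha k)%BZ, (1000 * nth 0%BZ alpha k <=? hi * dW)%BZ,
      (lo * dW <=? 1000 * nth 0%BZ beta k)%BZ & (1000 * nth 0%BZ beta k <=? hi * dW)%BZ] ->
  zr R lo / 1000 <= coef k tau <= zr R hi / 1000.
Proof.
move=> /andP[t0 t1] /and4P[]; rewrite -!(zr_le R) (@zrM R lo) (@zrM R hi) !(@zrM R 1000) coefE.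
have -> : zr R 1000 = 1000 by rewrite !zrE; ring.
have K0 : 0 < 1000 :> R by lra.
move: K0 dW_gt0; move: (zr R lo) (zr R hi) (zr R (nth _ alpha k)) (zr R (nth _ beta k)).
move: (1000 : R) (zr R dW) => K W l h a b K0 W0 h1 h2 h3 h4.
have s1 : 0 <= 1 - tau by rewrite subr_ge0.
have lin x y : l * W <= K * x <= h * W -> l * W <= K * y <= h * W ->
    l * W <= K * ((1 - tau) * x + tau * y) <= h * W.
  move=> /andP[x1 x2] /andP[y1 y2].
  move: (ler_wpM2l s1 x1) (ler_wpM2l s1 x2) (ler_wpM2l t0 y1) (ler_wpM2l t0 y2).
  by move=> *; apply/andP; split; lra.
have := lin a b; rewrite h1 h2 h3 h4 => /(_ isT isT) /andP[r1 r2].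
apply/andP; split.
  by rewrite ler_pdivlMr // mulrAC ler_pdivrMr // (mulrC _ K).
by rewrite ler_pdivrMr // mulrAC ler_pdivlMr // (mulrC _ K).
Qed.

(** All Jury conditions but the last. The coefficients are affine in [tau], so
    bounds at the two ends suffice; the value at [1] vanishes at [tau = 0], where
    [1] is an eigenvalue, and is positive at [tau = 1]. *)
Lemma coef_hyps tau : 0 < tau < 1 ->
  [/\ `|coef 0 tau| < 1,
      `|coef 1 tau - coef 0 tau * coef 3 tau| < 1 - coef 0 tau ^+ 2,
      0 < 1 + coef 3 tau + coef 2 tau + coef 1 tau + coef 0 tau
    & 0 < 1 - coef 3 tau + coef 2 tau - coef 1 tau + coef 0 tau].
Proof.
move=> /andP[t0 t1]; have t01 : 0 <= tau <= 1 by rewrite !ltW.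
have /andP[l0 h0] : zr R 0 / 1000 <= coef 0 tau <= zr R 1 / 1000.
  by apply: coef_bounds => //; vm_compute.
have /andP[l1 h1] : zr R (-900) / 1000 <= coef 1 tau <= zr R (-880) / 1000.
  by apply: coef_bounds => //; vm_compute.
have /andP[l2 h2] : zr R 0 / 1000 <= coef 2 tau <= zr R 3000 / 1000.
  by apply: coef_bounds => //; vm_compute.
have /andP[l3 h3] : zr R (-3000) / 1000 <= coef 3 tau <= zr R 0 / 1000.
  by apply: coef_bounds => //; vm_compute.
rewrite !zrE in l0 h0 l1 h1 l2 h2 l3 h3.
split; last by lra.
- by rewrite ltr_norml; apply/andP; split; lra.
- rewrite ltr_norml; move: (coef 0 tau) (coef 1 tau) (coef 3 tau) l0 h0 l1 h1 l3 h3 => a0 a1 a3 *.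
  by apply/andP; split; nra.
- rewrite !coefE.
  pose s (l : seq Z) := (nth 0%BZ l 0%N + nth 0%BZ l 1%N + nth 0%BZ l 2%N + nth 0%BZ l 3%N)%BZ.
  have sa : zr R (dW + s alpha)%BZ = 0 by rewrite -zr0; congr zr; vm_compute.
  have sb : 0 < zr R (dW + s beta)%BZ by rewrite -zr0 zr_lt.
  move: sa sb dW_gt0; rewrite /s.
  generalize dW (nth 0%BZ alpha 0) (nth 0%BZ alpha 1) (nth 0%BZ alpha 2) (nth 0%BZ alpha 3)
    (nth 0%BZ beta 0) (nth 0%BZ beta 1) (nth 0%BZ beta 2) (nth 0%BZ beta 3).
  move=> ZW A0 A1 A2 A3 B0 B1 B2 B3; rewrite !zrD.
  move: (zr R ZW) (zr R A0) (zr R A1) (zr R A2) (zr R A3) (zr R B0) (zr R B1) (zr R B2) (zr R B3).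
  move=> W a0 a1 a2 a3 b0 b1 b2 b3 sa sb W0.
  have -> : 1 + ((1 - tau) * a3 + tau * b3) / W + ((1 - tau) * a2 + tau * b2) / W +
      ((1 - tau) * a1 + tau * b1) / W + ((1 - tau) * a0 + tau * b0) / W =
    ((1 - tau) * (W + (a0 + a1 + a2 + a3)) + tau * (W + (b0 + b1 + b2 + b3))) / W.
    by field; rewrite gt_eqF.
  by rewrite sa mulr0 add0r divr_gt0 // mulr_gt0.
Qed.

(** [jury] of four polynomials over a common denominator [w]. *)
Definition jury_of (w : Z) (p0 p1 p2 p3 : seq Z) : seq Z :=
  ladd (zmul (zmul (zsub [:: w] p0) (zsub [:: w] p0)) (zsub (ladd [:: w] p0) p2))
       (zmul (zsub (zmul p1 [:: w]) (zmul p0 p3)) (zsub p3 p1)).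

Lemma jury_ofE w p0 p1 p2 p3 t : 0 < zr R w ->
  jury (peval p0 t / zr R w) (peval p1 t / zr R w) (peval p2 t / zr R w) (peval p3 t / zr R w)
  = peval (jury_of w p0 p1 p2 p3) t / zr R w ^+ 3.
Proof.
move=> w0; rewrite /jury /jury_of !(peval_ladd, peval_zmul, peval_zsub).
have -> : peval [:: w] t = zr R w by rewrite /= mulr0 addr0.
move: (peval p0 t) (peval p1 t) (peval p2 t) (peval p3 t) (zr R w) w0 => *.
by field; rewrite gt_eqF.
Qed.

Definition jury_poly : seq Z :=
  Eval vm_compute in jury_of dW (cpoly 0) (cpoly 1) (cpoly 2) (cpoly 3).

Definition juryf tau := jury (coef 0 tau) (coef 1 tau) (coef 2 tau) (coef 3 tau).

Lemma juryfE tau : juryf tau = peval jury_poly tau / zr R dW ^+ 3.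
Proof.
have -> : jury_poly = jury_of dW (cpoly 0) (cpoly 1) (cpoly 2) (cpoly 3) by vm_compute.
exact: jury_ofE dW_gt0.
Qed.

Lemma peval4 a b c d t :
  peval [:: a; b; c; d] t = zr R a + t * (zr R b + t * (zr R c + t * zr R d)).
Proof. by rewrite /= mulr0 addr0. Qed.

(** The signs that make the cubic decrease. Its coefficients, of well over a
    hundred digits, stay abstract. *)
Lemma jury_polyE : exists a b c d : Z,
  [/\ jury_poly = [:: a; b; c; d], (b + 2 * c + 3 * d <? 0)%BZ, (0 <=? c)%BZ & (0 <=? d)%BZ].
Proof. by do 4 eexists; split; [reflexivity|vm_compute..]. Qed.

(** The linear coefficient dominates, so the cubic decreases on [[0, 1]]. *)
Lemma juryf_decr s t : 0 <= s -> s < t -> t <= 1 -> juryf t < juryf s.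
Proof.
move=> s0 st t1; rewrite !juryfE ltr_pM2r ?invr_gt0 ?exprn_gt0 ?dW_gt0 //.
have [a [b [c [d [-> bcd c0 d0]]]]] := jury_polyE; rewrite !peval4.
move: bcd c0 d0; rewrite -(zr_lt R) -!(zr_le R) !zrD !zrM !zrE.
move: (zr R a) (zr R b) (zr R c) (zr R d) => {}a {}b {}c {}d bcd c0 d0.
rewrite -subr_lt0.
have -> : a + t * (b + t * (c + t * d)) - (a + s * (b + s * (c + s * d))) =
  (t - s) * (b + c * (s + t) + d * (s * s + s * t + t * t)) by ring.
rewrite pmulr_rlt0 ?subr_gt0 //.
have t0 : 0 <= t by lra.
have h1 : s + t <= 2 by lra.
have h2 : s * s + s * t + t * t <= 3 by nra.
apply: le_lt_trans bcd.
have := ler_wpM2l c0 h1; have := ler_wpM2l d0 h2; lra.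
Qed.

(** The cubic [p] at [n / q], multiplied by [q^3]. *)
Definition jury_num (n q : Z) (p : seq Z) : Z :=
  (nth 0%BZ p 0 * q * q * q + nth 0%BZ p 1 * n * q * q + nth 0%BZ p 2 * n * n * q
   + nth 0%BZ p 3 * n * n * n)%BZ.

Lemma juryf_frac (n q : Z) : (0 <? q)%BZ ->
  exists2 w : R, 0 < w & juryf (zr R n / zr R q) = w * zr R (jury_num n q jury_poly).
Proof.
rewrite -(zr_lt R) zr0 => q0; exists ((zr R q ^+ 3 * zr R dW ^+ 3)^-1).
  by rewrite invr_gt0 mulr_gt0 // exprn_gt0 // dW_gt0.
rewrite juryfE; have [a [b [c [d [-> _ _ _]]]]] := jury_polyE.
rewrite peval4 /jury_num [nth _ _ 0]/= [nth _ _ 1]/= [nth _ _ 2]/= [nth _ _ 3]/=.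
move: dW_gt0 q0; move: dW => w; rewrite !(zrD, zrM).
move: (zr R a) (zr R b) (zr R c) (zr R d) (zr R n) (zr R q) (zr R w) => A B C D n' q' W W0 q0.
by field; rewrite (gt_eqF W0) (gt_eqF q0).
Qed.

Definition tau_lo : R := zr R 9366061114 / zr R 10000000000.
Definition tau_hi : R := zr R 9366061115 / zr R 10000000000.

Lemma tau_loE : dec R [:: 9; 3; 6; 6; 0; 6; 1; 1; 1; 4]%N = tau_lo.
Proof. by rewrite /tau_lo !zrE /dec /=; field. Qed.

Lemma tau_hiE : dec R [:: 9; 3; 6; 6; 0; 6; 1; 1; 1; 5]%N = tau_hi.
Proof. by rewrite /tau_hi !zrE /dec /=; field. Qed.

Lemma tau_lo_hi : [/\ 0 < tau_lo, tau_lo < tau_hi & tau_hi < 1].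
Proof.
have q0 : 0 < zr R 10000000000 by rewrite -zr0 zr_lt.
rewrite /tau_lo /tau_hi; split.
- by rewrite divr_gt0 // -zr0 zr_lt.
- by rewrite ltr_pM2r ?invr_gt0 // zr_lt.
- by rewrite ltr_pdivrMr // mul1r zr_lt.
Qed.

Lemma juryf_root : exists2 tau_c : R, tau_lo < tau_c < tau_hi & juryf tau_c = 0.
Proof.
have [l0 lh h1] := tau_lo_hi.
have jl : 0 < juryf tau_lo.
  have [//|w w0 ->] := @juryf_frac 9366061114 10000000000.
  by rewrite mulr_gt0 // -zr0 zr_lt; vm_compute.
have jh : juryf tau_hi < 0.
  have [//|w w0 ->] := @juryf_frac 9366061115 10000000000.
  by rewrite pmulr_rlt0 // -zr0 zr_lt; vm_compute.
have [a [b [c [d [jE _ _ _]]]]] := jury_polyE.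
pose p : {poly R} := Poly [:: - zr R a; - zr R b; - zr R c; - zr R d].
have pE t : p.[t] = - (juryf t * zr R dW ^+ 3).
  rewrite juryfE divfK ?gt_eqF ?exprn_gt0 ?dW_gt0 // jE peval4 horner_Poly /=.
  by move: (zr R a) (zr R b) (zr R c) (zr R d) => *; ring.
have W3 : 0 < zr R dW ^+ 3 by rewrite exprn_gt0 ?dW_gt0.
have [x /andP[xl xh] /eqP] : exists2 x, tau_lo <= x <= tau_hi & root p x.
  apply: poly_ivt; first by rewrite ltW.
  by rewrite !pE oppr_le0 oppr_ge0 pmulr_lge0 // pmulr_lle0 // !ltW.
rewrite pE => /eqP; rewrite oppr_eq0 mulf_eq0 (gt_eqF W3) orbF => /eqP jx.
exists x => //; rewrite !lt_neqAle xl xh !andbT; apply/andP; split; apply/eqP => xE.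
  by move: jl; rewrite xE jx ltxx.
by move: jh; rewrite -xE jx ltxx.
Qed.

(** Between [0] and [1] the only Jury condition that can fail is the last. *)
Lemma schur_T01 tau : 0 < tau < 1 -> schur_stable (T01 tau) <-> 0 < juryf tau.
Proof.
move=> t01; have [h0 h1 h2 h3] := coef_hyps t01.
have t02 : 0 < tau < 2 by move: t01 => /andP[-> ?] /=; lra.
have S := @schur_stableP R 5 (T01 tau).
split=> [/S.1 hs|j0].
  apply: (stable_quartic h0 h1) => z qz.
  rewrite real_ltNge ?normr_real ?real1 //; apply/negP => z1.
  have : eigenvalue (map_mx (real_complex R) (T01 tau)) z.
    by rewrite eigenvalue_T01 // det_red_mx qz.
  by move/hs; rewrite real_ltNge ?normr_real ?real1 // z1.
apply/S => z hz; rewrite real_ltNge ?normr_real ?real1 //; apply/negP => z1.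
have := quartic_stable h0 h1 h2 h3 j0 z1; rewrite -det_red_mx -eigenvalue_T01 //.
by rewrite hz.
Qed.

End Critical.

(** * Local attraction and Schur stability *)

Section LocalAttraction.
Variable R : realType.
Implicit Types (tau kappa r : R) (e w : 'cV[R]_(2 + 2 + 2)).

Definition zabs_sum (c : seq Z) : Z := foldr (fun a s => (Z.abs a + s)%BZ) 0%BZ c.

Lemma dot_bound (c : seq Z) (v : seq R) b : 0 <= b -> all (fun x => `|x| <= b) v ->
  `|dot c v| <= zr R (zabs_sum c) * b.
Proof.
move=> b0; elim: c v => [|a c IH] v; first by rewrite normr0 zr0 mul0r.
have s0 : 0 <= zr R (zabs_sum (a :: c)).
  rewrite -zr0 zr_le; apply/Z.leb_spec0.
  by elim: (a :: c) => [|d l IHl] /=; lia.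
case: v => [|x v] /=; first by rewrite normr0 mulr_ge0.
case/andP => xb vb; apply: le_trans (ler_normD _ _) _.
rewrite zrD mulrDl lerD ?IH // normrM ler_pM //.
rewrite ler_norml -zrN !zr_le; apply/andP; split; apply/Z.leb_spec0; lia.
Qed.

(** The rows of the perturbation of [q] have [l^1] norm at most [3]. *)
Lemma small_in_region e : (forall i, `|e i 0| <= 1 / 3) -> in_region e.
Proof.
move=> he; have D0 : 0 < zr R dD by rewrite -zr0 zr_lt.
have hb i : `|dot (row_s i) (coords e) / zr R dD| <= 1.
  rewrite normrM normfV (gtr0_norm D0) ler_pdivrMr // mul1r.
  have := @dot_bound (row_s i) (coords e) (1 / 3).
  rewrite /coords /ypart /zpart /lpart !mxE /= !he => /(_ _ isT) h.
  apply: le_trans (h _) _; first by lra.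
  have : zr R (zabs_sum (row_s i)) <= zr R (3 * dD)%BZ by rewrite zr_le; case: i {h}; vm_compute.
  rewrite (zrM _ 3) (_ : zr R 3 = 3); last by rewrite !zrE; ring.
  move: (zr R dD) (zr R (zabs_sum _)) => d s; lra.
have := hb false; have := hb true; rewrite !ler_norml => /andP[h1 _] /andP[_ h2].
by split.
Qed.

Lemma in_region_scale e : exists2 t : R, 0 < t & forall s, 0 <= s <= t -> in_region (s *: e).
Proof.
pose K := \sum_i `|e i 0|.
have K0 : 0 <= K by apply: sumr_ge0.
exists (1 / 3 / (K + 1)); first by rewrite !divr_gt0 // ltr_wpDl.
move=> s /andP[s0 st]; apply: small_in_region => i; rewrite mxE normrM (ger0_norm s0).
have eK : `|e i 0| <= K by rewrite /K (bigD1 i) //= lerDl sumr_ge0.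
apply: le_trans (_ : 1 / 3 / (K + 1) * (K + 1) <= _); last by rewrite divfK ?gt_eqF ?ltr_wpDl.
by apply: ler_pM => //; rewrite (le_trans eK) // lerDl.
Qed.

Lemma local_contraction tau kappa r (nrm : 'cV[R]_(2 + 2 + 2) -> R) w :
  is_norm nrm -> 0 < kappa < 1 -> (forall e, nrm (T01 tau *m e) <= kappa * nrm e) ->
  (forall e, nrm e <= r -> in_region e) -> nrm (w - wstar R) <= r ->
  forall k, nrm (admm_seq tau w k - wstar R) <= r /\
    nrm (admm_seq tau w k.+1 - wstar R) <= kappa * nrm (admm_seq tau w k - wstar R).
Proof.
move=> hn /andP[k0 k1] hT hr hw k.
have we : w = wstar R + (w - wstar R) by rewrite [RHS]addrC subrK.
rewrite we !admm_seq_err {we}; move: (w - wstar R) hw => e hw.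
have step f : nrm f <= r -> nrm (err_step tau f) <= kappa * nrm f.
  by move=> fr; rewrite err_step_region ?hT //; apply: hr.
have inr j : nrm (iter j (err_step tau) e) <= r.
  elim: j => //= j IH; apply: le_trans (step _ IH) _.
  by apply: le_trans IH; rewrite ler_piMl ?is_norm_ge0 // ltW.
by split => //=; apply: step.
Qed.

Lemma contraction_attracting tau kappa r (nrm : 'cV[R]_(2 + 2 + 2) -> R) :
  is_norm nrm -> 0 < kappa < 1 -> (forall e, nrm (T01 tau *m e) <= kappa * nrm e) ->
  (forall e, nrm e <= r -> in_region e) -> 0 < r ->
  Qlin_attracting_on tau [set w | nrm (w - wstar R) <= r] nrm kappa.
Proof.
move=> hn hk hT hr r0; split=> //; first exact: nbhs_norm_ball.
by move=> w hw; apply: local_contraction.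
Qed.

(** By homogeneity: the contraction holds on a segment from [0] towards [e], where
    the step is linear. *)
Lemma attracting_contraction tau (U : set 'cV[R]_(2 + 2 + 2)) nrm kappa :
  Qlin_attracting_on tau U nrm kappa -> forall e, nrm (T01 tau *m e) <= kappa * nrm e.
Proof.
case=> hU hn hk hq e; have [_ hZ _] := hn.
have [t t0 tU] := nbhs_segment e hU.
have [s s0 sr] := in_region_scale e.
pose a := Num.min s t; have a0 : 0 < a by rewrite lt_min s0.
have Ua : U (wstar R + a *: e) by apply: tU; rewrite (ltW a0) ge_min lexx orbT.
have ra : in_region (a *: e) by apply: sr; rewrite (ltW a0) ge_min lexx.
have [_] := hq _ Ua 0%N; rewrite !admm_seq_err /= err_step_region // -scalemxAr !hZ.
by rewrite gtr0_norm // mulrCA ler_pM2l.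
Qed.

(** A contracting norm bounds the spectrum, and conversely an adapted norm gives
    a ball on which the step is linear and contracting. *)
Lemma attracting_schur tau : locally_Qlin_attracting tau <-> schur_stable (T01 tau).
Proof.
have S := @schur_stableP R 5 (T01 tau).
split=> [[U [nrm [kappa hq]]]|/S.1 /(@adapted_norm R 5)].
  apply/S => z; have [_ hn /andP[_ k1] _] := hq.
  by apply: (contraction_eigenvalue hn k1); apply: attracting_contraction hq.
case=> nrm [kappa [c [hn hk hT hc]]].
pose r := 1 / 3 / (`|c| + 1).
have r0 : 0 < r by rewrite !divr_gt0 // ltr_wpDl.
exists [set w | nrm (w - wstar R) <= r], nrm, kappa; apply: contraction_attracting => //.
move=> e er; apply: small_in_region => i.
apply: le_trans (hc e i) _; apply: le_trans (_ : (`|c| + 1) * r <= _); last first.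
  by rewrite /r mulrC divfK ?gt_eqF ?ltr_wpDl.
apply: le_trans (_ : (`|c| + 1) * nrm e <= _); last by rewrite ler_wpM2l // addr_ge0.
rewrite ler_wpM2r ?is_norm_ge0 //; apply: le_trans (ler_norm c) _; rewrite lerDl //.
Qed.

End LocalAttraction.

(** * A metric for all multiplier steps near 1/2 *)

(** The factor [A] of the metric [H = A^T A]. Up to rounding, [H] solves the
    discrete Lyapunov equation [H = W + rho^-2 T^T H T] for [T = T01 (1 / 2)] and
    [rho = 9999 / 10000], with a diagonal [W] tuned so that the trajectory from
    [init66] is soon inside the ball of radius [radius2 ^ (1 / 2)], which is about
    the largest one inside the region of fixed activity. *)
Definition rows_A : seq (seq Z) := [::
  [:: 1268; -795; -121; 781; -2893; -325]; [:: 0; 4653; 631; -3967; 16376; 1805];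
  [:: 0; 0; 29784; -655; -386; -14]; [:: 0; 0; 0; 13990; 8535; 332];
  [:: 0; 0; 0; 0; 12544; 749]; [:: 0; 0; 0; 0; 0; 23919]]%BZ.
Definition radius2 : Z := 145579502%BZ.

Definition qsum (rows : seq (seq Z)) : seq (seq Z) := foldr (fun c Q => qadd (qsq c) Q) [::] rows.

(** Rows of [T01] at [tau = t / 100] over the denominator [100 dD]. *)
Definition rows_T (t : Z) : seq (seq Z) :=
  [:: lscale 100%BZ (row_y false); lscale 100%BZ (row_y true); [::];
      lscale 100%BZ (row_s true);
      ladd [:: 0; 0; 0; 0; (100 - t) * dD; 0]%BZ (lscale t (row_s false));
      [:: 0; 0; 0; 0; 0; (100 - t) * dD]%BZ].

Definition lcomb (c : seq Z) (rows : seq (seq Z)) : seq Z :=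
  foldr (fun p s => ladd (lscale p.1 p.2) s) [::] (zip c rows).

(** Forms whose positivity says, in turn, that [T01] contracts [H] with rate
    [9999 / 10000] at [tau = t / 100], that the ball is inside the half-space of
    one constraint, and that the norm bounds a coordinate. *)
Definition contraction_gap (t : Z) : seq (seq Z) :=
  qadd (qscale (9999 * 9999 * (100 * dD) * (100 * dD))%BZ (qsum rows_A))
       (qscale (- (10000 * 10000))%BZ (qsum [seq lcomb c (rows_T t) | c <- rows_A])).

Definition region_gap (i : bool) : seq (seq Z) :=
  qadd (qscale (dD * dD)%BZ (qsum rows_A)) (qscale (- radius2)%BZ (qsq (row_s i))).

Definition coord_gap (i : nat) : seq (seq Z) :=
  qadd (qsum rows_A) (qscale (-1)%BZ (qsq (ncons i 0%BZ [:: 1%BZ]))).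

Section Metric.
Variable R : realType.
Implicit Types (tau : R) (e : 'cV[R]_(2 + 2 + 2)).

Definition mxA (K : realFieldType) : 'M[K]_(2 + 2 + 2) :=
  \matrix_(k, i) zr K (nth 0%BZ (nth [::] rows_A k) i).
Definition mxH (K : realFieldType) : 'M[K]_(2 + 2 + 2) := (mxA K)^T *m mxA K.

Lemma ratr_zr a : ratr (zr rat a) = zr R a.
Proof. by rewrite !zr.unlock ratr_int. Qed.

Lemma map_mxH : map_mx ratr (mxH rat) = mxH R.
Proof.
rewrite /mxH map_mxM -map_trmx; congr (_^T *m _);
  by apply/matrixP => i j; rewrite !mxE; apply: ratr_zr.
Qed.

Lemma sum6 (F : 'I_(2 + 2 + 2) -> R) : \sum_i F i =
  F (lshift 2 (lshift 2 0)) + (F (lshift 2 (lshift 2 1)) + (F (lshift 2 (rshift 2 0)) +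
  (F (lshift 2 (rshift 2 1)) + (F (rshift (2 + 2) 0) + F (rshift (2 + 2) 1))))).
Proof.
rewrite !big_split_ord /= !big_ord_recl !big_ord0 !addr0 -!addrA.
by do ![congr (_ + _)]; congr (F _); apply/val_inj.
Qed.

Lemma dot_sum6 (c : seq Z) e : size c = 6%N -> \sum_(i < 2 + 2 + 2) zr R (nth 0%BZ c i) * e i 0 = dot c (coords e).
Proof.
case: c => [|c0 [|c1 [|c2 [|c3 [|c4 [|c5 [|]]]]]]] // _.
by rewrite sum6 /= /coords /ypart /zpart /lpart !mxE addr0.
Qed.

Lemma qform_qsum rows (v : seq R) : qform (qsum rows) v = \sum_(c <- rows) dot c v ^+ 2.
Proof.
elim: rows => [|c rows IH]; first by rewrite big_nil.
by rewrite big_cons /= qform_qadd qform_qsq IH.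
Qed.

Lemma mxH_form e : (e^T *m mxH R *m e) 0 0 = qform (qsum rows_A) (coords e).
Proof.
have -> : e^T *m mxH R *m e = (mxA R *m e)^T *m (mxA R *m e).
  by rewrite trmx_mul /mxH !mulmxA.
have E (k : 'I_(2 + 2 + 2)) n : k = n :> nat ->
    (mxA R *m e) k 0 = dot (nth [::] rows_A n) (coords e).
  move=> <-; rewrite mxE -dot_sum6; first by apply: eq_bigr => i _; rewrite mxE.
  by case: k => [[|[|[|[|[|[|//]]]]]] ?].
rewrite mxE qform_qsum !big_cons big_nil sum6.
have T (B : 'M[R]_(2 + 2 + 2, 1)) i : B^T 0 i = B i 0 by rewrite mxE.
by rewrite !T (E _ 0%N) // (E _ 1%N) // (E _ 2%N) // (E _ 3%N) // (E _ 4%N) // (E _ 5%N) // addr0 -!expr2.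
Qed.

Lemma normH_form e : normH (mxH R) e = Num.sqrt (qform (qsum rows_A) (coords e)).
Proof. by rewrite /normH mxH_form. Qed.

Lemma size_coords e : size (coords e) = 6%N. Proof. by []. Qed.

Lemma mxH_posdef : posdef (mxH R).
Proof.
split=> [|v v0]; first by rewrite /mxH trmx_mul trmxK.
rewrite mxH_form; apply: (qpos_gt0 (size_coords v)); first by vm_compute.
apply: contraR v0 => /hasPn h; apply/eqP/coords_inj.
have z x : x \in coords v -> x = 0 by move/h; rewrite negbK => /eqP.
rewrite [RHS]/coords /ypart /zpart /lpart !mxE /coords.
by congr [:: _; _; _; _; _; _]; apply: z; rewrite !inE eqxx ?orbT.
Qed.

Let normE e : normH (mxH R) e ^+ 2 = qform (qsum rows_A) (coords e).
Proof. by rewrite (normH_sqr _ mxH_posdef) mxH_form. Qed.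

Let norm_ge0 e : 0 <= normH (mxH R) e := is_norm_ge0 e (normH_is_norm mxH_posdef).

Lemma dot_lcomb c rows (v : seq R) :
  dot (lcomb c rows) v = dot c [seq dot r v | r <- rows].
Proof.
by rewrite /lcomb; elim: c rows => [|a c IH] [|r rows] //=; rewrite dot_ladd dot_lscale IH.
Qed.

Lemma dot_rows_T (t : Z) e : [seq dot r (coords e) | r <- rows_T t] =
  [seq zr R (100 * dD)%BZ * x | x <- coords (T01 (zr R t / zr R 100) *m e)].
Proof.
rewrite coords_T01 /rows_T /T01_rows.
move: (row_y false) (row_y true) (row_s false) (row_s true) => r0 r1 r2 r3.
rewrite !map_cons !dot_ladd !dot_lscale.
have D0 : zr R dD != 0 by rewrite zr_eq0.
have h0 : zr R 100 != 0 by rewrite zr_eq0.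
have e4 x : dot [:: 0; 0; 0; 0; x; 0]%BZ (coords e) = zr R x * nth 0 (coords e) 4.
  by rewrite /= !zr0 !mul0r !add0r addr0.
have e5 x : dot [:: 0; 0; 0; 0; 0; x]%BZ (coords e) = zr R x * nth 0 (coords e) 5.
  by rewrite /= !zr0 !mul0r !add0r addr0.
rewrite e4 e5; move: (nth 0 _ 4) (nth 0 _ 5) D0 h0.
move: (dot r0 _) (dot r1 _) (dot r2 _) (dot r3 _).
move: dD => D y0 y1 s0 s1 n4 n5; rewrite !zrM !zrB.
move: (zr R D) (zr R 100) (zr R t) => d h s D0 h0 /=.
by congr [:: _; _; _; _; _; _]; field; rewrite ?D0 ?h0.
Qed.

Definition rate : R := zr R 9999 / zr R 10000.

Lemma contraction_at (t : Z) e : qpos 6 (contraction_gap t) ->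
  normH (mxH R) (T01 (zr R t / zr R 100) *m e) <= rate * normH (mxH R) e.
Proof.
move=> /(qpos_ge0 (size_coords e)); rewrite /contraction_gap qform_qadd !qform_qscale.
set T := T01 _; have D0 : 0 < zr R (100 * dD) by rewrite -zr0 zr_lt.
have -> : qform (qsum [seq lcomb c (rows_T t) | c <- rows_A]) (coords e) =
    zr R (100 * dD) ^+ 2 * qform (qsum rows_A) (coords (T *m e)).
  rewrite !qform_qsum big_map mulr_sumr; apply: eq_bigr => c _.
  by rewrite dot_lcomb dot_rows_T dot_scale exprMn.
have h0 : 0 < zr R 10000 by rewrite -zr0 zr_lt.
have g0 : 0 < zr R 9999 by rewrite -zr0 zr_lt.
rewrite -!normE => h.
have r0 : 0 <= rate by rewrite divr_ge0 ?ltW.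
rewrite -(ler_pXn2r (n := 2)) ?nnegrE ?(mulr_ge0 r0) ?norm_ge0 //.
move: h D0 h0 g0 {r0}; rewrite /rate (zrM _ (_ * _)) (zrM _ _ (100 * dD)) (zrM _ 9999) zrN (zrM _ 10000).
move: (zr R (100 * dD)) (zr R 10000) (zr R 9999) => d h g hh D0 h0 g0.
rewrite exprMn expr_div_n mulrAC ler_pdivlMr ?exprn_gt0 //.
rewrite -(ler_pM2l (x := d ^+ 2)) ?exprn_gt0 // -subr_ge0; apply: le_trans hh _.
by rewrite le_eqVlt; apply/orP; left; apply/eqP; ring.
Qed.

(** [T01 tau] is affine in [tau] and the norm is convex, so the two ends of the
    interval suffice. *)
Lemma metric_contraction tau e : 49 / 100 <= tau <= 51 / 100 ->
  normH (mxH R) (T01 tau *m e) <= rate * normH (mxH R) e.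
Proof.
move=> /andP[t0 t1].
have c0 := contraction_at (t := 49%BZ) e ltac:(vm_compute; reflexivity).
have c1 := contraction_at (t := 51%BZ) e ltac:(vm_compute; reflexivity).
have E49 : zr R 49 / zr R 100 = 49 / 100 by rewrite !zrE; field.
have E51 : zr R 51 / zr R 100 = 51 / 100 by rewrite !zrE; field.
rewrite E49 in c0; rewrite E51 in c1.
have [_ hZ hD] := normH_is_norm mxH_posdef.
pose s := (tau - 49 / 100) * 50.
have s0 : 0 <= s by rewrite /s; lra.
have s1 : 0 <= 1 - s by rewrite /s; lra.
have TE : T01 tau *m e = (1 - s) *: (T01 (49 / 100) *m e) + s *: (T01 (51 / 100) *m e).
  rewrite /T01 !mulmxDl -!scalemxAl.
  move: (T01_0 R *m e) (T01_1 R *m e) => x y; by apply/matrixP => i j; rewrite !mxE /s; field.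
rewrite TE; apply: le_trans (hD _ _) _; rewrite !hZ !ger0_norm //.
have := ler_wpM2l s1 c0; have := ler_wpM2l s0 c1; lra.
Qed.

Definition radius : R := Num.sqrt (zr R radius2).

Lemma radius_gt0 : 0 < radius. Proof. by rewrite sqrtr_gt0 -zr0 zr_lt. Qed.

Lemma ball_in_region e : normH (mxH R) e <= radius -> in_region e.
Proof.
move=> he; have r0 : 0 < zr R radius2 by rewrite -zr0 zr_lt.
have D0 : 0 < zr R dD by rewrite -zr0 zr_lt.
have hq : qform (qsum rows_A) (coords e) <= zr R radius2.
  by rewrite -normE -(sqr_sqrtr (ltW r0)) ler_pXn2r ?nnegrE // ltW // radius_gt0.
have hi i : `|dot (row_s i) (coords e) / zr R dD| <= 1.
  have : qpos 6 (region_gap i) by case: i; vm_compute.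
  move=> /(qpos_ge0 (size_coords e)); rewrite /region_gap qform_qadd !qform_qscale qform_qsq zrN mulNr subr_ge0 => h.
  rewrite -(ler_pXn2r (n := 2)) ?nnegrE // expr1n real_normK ?num_real // expr_div_n.
  rewrite ler_pdivrMr ?exprn_gt0 // mul1r -(ler_pM2l r0); apply: le_trans h _.
  by rewrite zrM -expr2 mulrC ler_wpM2r // exprn_ge0 // ltW.
have := hi false; have := hi true; rewrite !ler_norml => /andP[h1 _] /andP[_ h2].
by split.
Qed.

Lemma coord_le_norm e i : `|e i 0| <= normH (mxH R) e.
Proof.
have hk (k : nat) : (k < 6)%N -> `|nth 0 (coords e) k| <= normH (mxH R) e.
  move=> k6; have : qpos 6 (coord_gap k) by case: k k6 => [|[|[|[|[|[|//]]]]]] _; vm_compute.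
  move=> /(qpos_ge0 (size_coords e)); rewrite /coord_gap qform_qadd qform_qscale qform_qsq.
  have -> : dot (ncons k 0%BZ [:: 1%BZ]) (coords e) = nth 0 (coords e) k.
    by case: k k6 => [|[|[|[|[|[|//]]]]]] _; rewrite /= ?zr0 ?zr1 ?mul0r ?mul1r ?add0r ?addr0.
  rewrite !zrE mulN1r subr_ge0 -normE => h.
  by rewrite -(ler_pXn2r (n := 2)) ?nnegrE // real_normK ?num_real.
case: (split_ordP i) => k ->.
  case: (split_ordP k) => l ->; case: (ord2P l) => ->.
  - by have := hk 0%N isT; rewrite /= /ypart !mxE.
  - by have := hk 1%N isT; rewrite /= /ypart !mxE.
  - by have := hk 2%N isT; rewrite /= /zpart !mxE.
  - by have := hk 3%N isT; rewrite /= /zpart !mxE.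
case: (ord2P k) => ->.
  by have := hk 4%N isT; rewrite /= /lpart !mxE.
by have := hk 5%N isT; rewrite /= /lpart !mxE.
Qed.

End Metric.

(** * The affine map of the period-66 cycle *)

(** In the variables [(y, q)] the step with a frozen activity [D] is affine: it is
    the step of the state with [z = D q] and [lambda = (1 - D) q]. Its linear part
    therefore reads the coordinates [y0], [y1], [lambda0] and, in place of [q1],
    [z1] or [lambda1] according to [D]. *)
Definition restrict (idx : seq nat) (c : seq Z) : seq Z := [seq nth 0%BZ c i | i <- idx].
Definition rows_yq : seq (seq Z) := [:: row_y false; row_y true; row_s false; row_s true].
Definition rows01 := [seq restrict [:: 0; 1; 4; 3]%N c | c <- rows_yq].
Definition rows00 := [seq restrict [:: 0; 1; 4; 5]%N c | c <- rows_yq].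

Section Cycle.
Variable R : realType.
Implicit Types (u v : 'cV[R]_(2 + 2)) (y q : 'cV[R]_2) (D : 'M[R]_2).

(** Difference of the states that [D00] and [D01] associate with [qstar]. *)
Definition shift_state : 'cV[R]_(2 + 2 + 2) := state 0 (vec2 0 (-1)) (vec2 0 1).

Definition yq_step (e : 'cV[R]_(2 + 2 + 2)) : 'cV[R]_(2 + 2) :=
  col_mx (N R *m gvec e) ((1%:M - N R) *m gvec e + zpart e).

Definition lift_state D u := state (usubmx u) (D *m dsubmx u) (dsubmx u - D *m dsubmx u).

Lemma TD_lift D u : TD D *m u = yq_step (lift_state D u).
Proof.
rewrite -{1}[u]vsubmxK /TD mul_block_col /yq_step /lift_state.
rewrite /gvec ypart_state zpart_state lpart_state.
set y := usubmx u; set q := dsubmx u.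
have qE : q - D *m q - D *m q = - ((D *+ 2 - 1%:M) *m q).
  rewrite mulmxBl mulr2n mulmxDl mul1mx.
  by apply/matrixP => i j; rewrite !mxE; ring.
rewrite qE; move: (1%:M - M R) (1%:M - N R) (D *+ 2 - 1%:M) => IM IN S.
congr col_mx; first by rewrite mulmxDr !(mulmxN, mulNmx) !mulmxA.
by rewrite mulmxDr mulmxBl !mulmxN !mulmxA -!addrA; congr (_ + _); rewrite addrC.
Qed.

Lemma gvecD e f : gvec (e + f) = gvec e + gvec f :> 'cV[R]_2.
Proof.
rewrite /gvec ypartD zpartD lpartD.
have -> : lpart e + lpart f - (zpart e + zpart f) = (lpart e - zpart e) + (lpart f - zpart f).
  by rewrite opprD addrACA.
by rewrite (mulmxDr (M R)) (mulmxDr (1%:M - M R)) addrACA.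
Qed.

Lemma yq_stepD e f : yq_step (e + f) = yq_step e + yq_step f.
Proof.
rewrite /yq_step gvecD zpartD add_col_mx (mulmxDr (N R)) (mulmxDr (1%:M - N R)).
by congr col_mx; rewrite addrACA.
Qed.

Definition coords4 u : seq R :=
  [:: usubmx u 0 0; usubmx u 1 0; dsubmx u 0 0; dsubmx u 1 0].

Lemma coords4_yq e : coords4 (yq_step e) = rapply dD rows_yq (coords e).
Proof.
rewrite /coords4 /yq_step col_mxKu col_mxKd /rapply /rows_yq !map_cons.
by rewrite !(dot_row_y _ false) !(dot_row_y _ true) !(dot_row_s _ false) !(dot_row_s _ true).
Qed.

Lemma coords4D u v : coords4 (u + v) = [seq p.1 + p.2 | p <- zip (coords4 u) (coords4 v)].
Proof. by rewrite /coords4 /= !linearD !mxE. Qed.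

Lemma dot_restrict (c : seq Z) (x0 x1 x2 x3 : R) : size c = 6%N ->
  dot c [:: x0; x1; 0; x3; x2; 0] = dot (restrict [:: 0; 1; 4; 3]%N c) [:: x0; x1; x2; x3] /\
  dot c [:: x0; x1; 0; 0; x2; x3] = dot (restrict [:: 0; 1; 4; 5]%N c) [:: x0; x1; x2; x3].
Proof.
case: c => [|c0 [|c1 [|c2 [|c3 [|c4 [|c5 [|]]]]]]] // _.
by rewrite /=; split; ring.
Qed.

Lemma size_rows_yq c : c \in rows_yq -> size c = 6%N.
Proof. by rewrite !inE => /or4P[] /eqP ->. Qed.

Lemma coords4_T01 u : coords4 (TD (D01 R) *m u) = rapply dD rows01 (coords4 u).
Proof.
rewrite TD_lift coords4_yq /rapply /rows01 -map_comp; apply/eq_in_map => c /size_rows_yq hc.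
rewrite /lift_state coords_state /=; congr (_ / _).
move: (usubmx u) (dsubmx u) => y q.
have sub (w : 'cV[R]_2) i : (q - w) i 0 = q i 0 - w i 0 by rewrite !mxE.
rewrite !sub D01_0 D01_1 subrr subr0.
exact: (dot_restrict _ _ _ _ hc).1.
Qed.

Lemma coords4_T00 u : coords4 (TD (D00 R) *m u) = rapply dD rows00 (coords4 u).
Proof.
rewrite TD_lift coords4_yq /rapply /rows00 -map_comp; apply/eq_in_map => c /size_rows_yq hc.
rewrite /lift_state coords_state /=; congr (_ / _).
have D0 (w : 'cV[R]_2) : D00 R *m w = 0.
  rewrite (_ : D00 R = 0) ?mul0mx //; apply/matrixP => i j; rewrite !mxE.
  by case: i => [[|[|//]] ?]; rewrite /= mul0rn.
rewrite !D0 subr0 !mxE.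
exact: (dot_restrict _ _ _ _ hc).2.
Qed.

(** The KKT point in the variables [(y, q)], a fixed point of [LD D01]. *)
Definition ustar : 'cV[R]_(2 + 2) := col_mx (ystar R) (qstar R).

Definition aff D u := TD D *m u + hvec R.

Lemma aff_yq D u : aff D u =
  yq_step (lift_state D u) + col_mx (N R *m ((1%:M - M R) *m bbar R)) ((1%:M - N R) *m ((1%:M - M R) *m bbar R)).
Proof. by rewrite /aff TD_lift. Qed.

Lemma aff01_star : aff (D01 R) ustar = ustar.
Proof.
rewrite aff_yq /lift_state /ustar col_mxKu col_mxKd.
have -> : D01 R *m qstar R = zstar R.
  by apply: cv2P; rewrite ?D01_0 ?D01_1 !mxE /= ?addr0.
have -> : qstar R - zstar R = lstar R by rewrite /qstar addrC addKr.
rewrite /yq_step add_col_mx zpart_state.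
have gE : gvec (state (ystar R) (zstar R) (lstar R)) + (1%:M - M R) *m bbar R = ystar R + lstar R.
  rewrite /gvec ypart_state zpart_state lpart_state -addrA -mulmxDr.
  have -> : lstar R - zstar R + bbar R = xstar R + lstar R + ystar R.
    by rewrite /bbar; apply/matrixP => i j; rewrite !mxE; ring.
  rewrite mulmxBl mul1mx mulmxDr -xstar_prox.
  by apply/matrixP => i j; rewrite !mxE; ring.
congr col_mx; first by rewrite -mulmxDr gE -ystar_prox.
rewrite addrAC -mulmxDr gE mulmxBl mul1mx -ystar_prox.
by apply/matrixP => i j; rewrite !mxE; ring.
Qed.

Lemma aff_err01 v : aff (D01 R) (ustar + v) = ustar + TD (D01 R) *m v.
Proof. by rewrite -{2}aff01_star /aff mulmxDr addrAC. Qed.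

Lemma aff_err00 v : aff (D00 R) (ustar + v) = ustar + (TD (D00 R) *m v + yq_step shift_state).
Proof.
have key : TD (D00 R) *m ustar = TD (D01 R) *m ustar + yq_step shift_state.
  rewrite [LHS]TD_lift [X in X + _]TD_lift -[RHS]yq_stepD; congr yq_step.
  rewrite /lift_state /shift_state /ustar col_mxKu col_mxKd stateD addr0.
  by congr (state _ _ _); apply: cv2P;
    rewrite !(mxE, big_ord_recl, big_ord0) /=; ring.
have E : TD (D01 R) *m ustar + hvec R = ustar := aff01_star.
rewrite /aff (mulmxDr (TD (D00 R)) ustar v) key -{2}E {key E}.
generalize (TD (D01 R) *m ustar) (TD (D00 R) *m v) (yq_step shift_state) (hvec R) => a b c d.
by apply/matrixP => i j; rewrite !mxE; ring.
Qed.

Lemma LD_col D u : LD D *m col_mx u 1%:M = col_mx (aff D u) 1%:M.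
Proof. by rewrite /LD mul_block_col mul0mx add0r !mulmx1. Qed.

Lemma LD_iter D n u : LD D ^+ n *m col_mx u 1%:M = col_mx (iter n (aff D) u) 1%:M.
Proof.
elim: n u => [|n IH] u; first by rewrite expr0 mul1mx.
by rewrite exprSr -mulmxA LD_col IH -iterSr.
Qed.

(** The period-66 cycle, then its linear part and the cycle relative to the KKT
    point, as iterations of single steps: the matrix power itself is never
    computed. *)
Definition cycle_map u := iter 64 (aff (D01 R)) (iter 2 (aff (D00 R)) u).

Lemma cycle66E u : cycle66_P R *m u + cycle66_a R = cycle_map u.
Proof.
have := LD_iter (D01 R) 64 (iter 2 (aff (D00 R)) u); rewrite -LD_iter mulmxA.
rewrite -[X in X *m col_mx u _]/(cycle66 R) -{1}[cycle66 R]submxK mul_block_col.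
by move/eq_col_mx => [+ _]; rewrite mulmx1.
Qed.

Definition lin_map v := iter 64 (mulmx (TD (D01 R))) (iter 2 (mulmx (TD (D00 R))) v).
Definition err_map v :=
  iter 64 (mulmx (TD (D01 R))) (iter 2 (fun v => TD (D00 R) *m v + yq_step shift_state) v).

Lemma cycle_map_err v : cycle_map (ustar + v) = ustar + err_map v.
Proof.
have h n w : iter n (aff (D01 R)) (ustar + w) = ustar + iter n (mulmx (TD (D01 R))) w.
  by elim: n => //= n ->; rewrite aff_err01.
rewrite /cycle_map (_ : iter 2 _ _ = ustar +
  iter 2 (fun v => TD (D00 R) *m v + yq_step shift_state) v); last by rewrite /= !aff_err00.
exact: h.
Qed.

Lemma err_map_lin v : err_map v = lin_map v + err_map 0.
Proof.
have h n (A : 'M[R]_(2 + 2)) u w : iter n (mulmx A) (u + w) = iter n (mulmx A) u + iter n (mulmx A) w.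
  by elim: n => //= n ->; rewrite mulmxDr.
rewrite /err_map /lin_map -h; congr iter => /=.
by rewrite mulmx0 add0r !mulmxDr addrA.
Qed.

(** [cycle66_P] and [cycle66_a] are blocks of one matrix; they are separated by
    applying it at the KKT point and at a second point. *)
Lemma cycle66_P_lin v : cycle66_P R *m v = lin_map v.
Proof.
have h0 := cycle66E (ustar + 0); have hv := cycle66E (ustar + v).
rewrite !cycle_map_err err_map_lin in hv h0.
apply: (addrI (cycle66_P R *m ustar + cycle66_a R)).
have -> : cycle66_P R *m ustar + cycle66_a R + cycle66_P R *m v =
  cycle66_P R *m (ustar + v) + cycle66_a R by rewrite mulmxDr addrAC.
have -> : cycle66_P R *m ustar + cycle66_a R = ustar + err_map 0.
  by rewrite -[ustar in LHS]addr0 cycle66E cycle_map_err.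
rewrite hv; generalize (err_map 0) (lin_map v) => p q.
by rewrite -addrA [p + q]addrC.
Qed.

Lemma cycle66_a_err : cycle66_a R = (1%:M - cycle66_P R) *m ustar + err_map 0.
Proof.
have := cycle66E (ustar + 0); rewrite cycle_map_err addr0 mulmxBl mul1mx.
move: (err_map 0) (cycle66_P R *m ustar) (cycle66_a R) => e p a E.
by rewrite addrAC -E [p + a]addrC addrK.
Qed.
End Cycle.

(** * Enclosure of the trajectory from the period-66 point *)

(** All intervals below are in units of [1 / unitS], and relative to the KKT
    point. *)
Definition unitS : Z := (10 ^ 18)%BZ.

Definition ilin (s : seq itv) : seq itv :=
  iter 64 (iapply dD rows01) (iter 2 (iapply dD rows00) s).
Definition ishift : seq itv :=
  iapply dD rows_yq [seq icst a | a <- [:: 0; 0; 0; - unitS; 0; unitS]%BZ].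
Definition iadds (s t : seq itv) : seq itv := [seq iadd p.1 p.2 | p <- zip s t].
Definition ierr (s : seq itv) : seq itv :=
  iter 64 (iapply dD rows01) (iter 2 (fun s => iadds (iapply dD rows00 s) ishift) s).

(** A floating-point approximation of the period-66 point. *)
Definition center : seq Z :=
  [:: -77920805114000000; 777674455446000000; -151767163424000000; -1008619166161000000]%BZ.

(** An approximate inverse of [1 - cycle66_P], over the denominator [10^4]. *)
Definition unitB : Z := (10 ^ 4)%BZ.
Definition rows_B : seq (seq Z) := [::
  [:: 9098; 19412; 68342; 5683]; [:: 9310; -190376; -705271; -58651];
  [:: 28785; -619164; -2151659; -180349]; [:: -2788; 60126; 216962; 27866]]%BZ.

Definition ineg (s : seq itv) : seq itv := [seq iscale (-1)%BZ i | i <- s].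

Definition unit_vec (j : nat) : seq Z := [seq (if i == j then unitS else 0)%BZ | i <- iota 0 4].

(** Column [j] of [1 - B (1 - cycle66_P)] for the matrix [B] of [rows_B], and [B]
    applied to the residual of [center]. *)
Definition idefect (j : nat) : seq itv :=
  let d := [seq icst a | a <- unit_vec j] in
  iadds d (ineg (iapply unitB rows_B (iadds d (ineg (ilin d))))).

Definition iresidual : seq itv :=
  let c := [seq icst a | a <- center] in iapply unitB rows_B (iadds (ierr c) (ineg c)).

(** In units of [1 / unitS], hence an accuracy of [2 * 10^-12]. *)
Definition residual_bound : Z := 2000000%BZ.

(** The factor [8] is the one of [defect_bound]. *)
Definition iinit : seq itv :=
  let v i := let c := nth 0%BZ center i in
    ((c - 8 * residual_bound)%BZ, (c + 8 * residual_bound)%BZ) in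
  let q0 := iadd (v 2%N) (icst (- unitS)%BZ) in
  let q1 := iadd (v 3%N) (icst unitS) in
  [:: v 0%N; v 1%N; imax0 q0; iadd (imax0 q1) (icst (- unitS)%BZ);
      iadd (imin0 q0) (icst unitS); imin0 q1].

(** By then the enclosure is inside the ball, and its width still below [10^-5]. *)
Definition entry_time : nat := 176.

(** An upper bound for the squared norm on a box, in units of [unitS ^ -2]. *)
Definition iform (s : seq itv) : Z :=
  foldr (fun c x => let b := iabs (idot c s) in (b * b + x)%BZ) 0%BZ rows_A.

Lemma defect_small : all (fun j => all (fun i => (8 * iabs i <=? unitS)%BZ) (idefect j)) (iota 0 4).
Proof. by vm_compute. Qed.

Lemma residual_small : all (fun i => (iabs i <=? residual_bound)%BZ) iresidual.
Proof. by vm_compute. Qed.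

Lemma entry_small : (iform (iter entry_time (istep unitS) iinit) <=? radius2 * unitS * unitS)%BZ.
Proof. by vm_compute. Qed.

Section Trajectory.
Variable R : realType.
Local Notation S := (zr R unitS).
Implicit Types (u v : 'cV[R]_(2 + 2)) (s : seq itv).

Let S0 : 0 < S. Proof. by rewrite -zr0 zr_lt. Qed.

Definition scaled (l : seq R) := [seq S * x | x <- l].

Lemma rapply_scaled a rows l : rapply a rows (scaled l) = scaled (rapply a rows l).
Proof.
rewrite /rapply /scaled -map_comp; apply: eq_map => c /=.
by rewrite dot_scale mulrA.
Qed.

Lemma encs_iadds s t (l m : seq R) : encs s l -> encs t m ->
  encs (iadds s t) [seq p.1 + p.2 | p <- zip l m].
Proof.
elim: s t l m => [|i s IH] [|j t] [|x l] [|y m] //= [ei es] [ej et].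
by split; [apply: enc_iadd|apply: IH].
Qed.

Lemma encs_ineg s (l : seq R) : encs s l -> encs (ineg s) [seq - x | x <- l].
Proof.
elim: s l => [|i s IH] [|x l] //= [ei es]; split; last exact: IH.
by rewrite -mulN1r -(zr1 R) -zrN; apply: enc_iscale.
Qed.

Lemma encs_icst (c : seq Z) : encs [seq icst a | a <- c] [seq zr R a | a <- c].
Proof. by elim: c => //= a c IH; split => //; apply: enc_icst. Qed.

Lemma encs_T01 s v : encs s (scaled (coords4 v)) ->
  encs (iapply dD rows01 s) (scaled (coords4 (TD (D01 R) *m v))).
Proof. by move=> es; rewrite coords4_T01 -rapply_scaled; apply: encs_iapply. Qed.

Lemma encs_T00 s v : encs s (scaled (coords4 v)) ->
  encs (iapply dD rows00 s) (scaled (coords4 (TD (D00 R) *m v))).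
Proof. by move=> es; rewrite coords4_T00 -rapply_scaled; apply: encs_iapply. Qed.

Lemma encs_iter (f : seq itv -> seq itv) (g : 'cV[R]_(2 + 2) -> 'cV[R]_(2 + 2)) n s v :
  (forall s v, encs s (scaled (coords4 v)) -> encs (f s) (scaled (coords4 (g v)))) ->
  encs s (scaled (coords4 v)) -> encs (iter n f s) (scaled (coords4 (iter n g v))).
Proof. by move=> fg es; elim: n => //= n IH; apply: fg. Qed.

Lemma scaledD u v : scaled (coords4 (u + v)) =
  [seq p.1 + p.2 | p <- zip (scaled (coords4 u)) (scaled (coords4 v))].
Proof. by rewrite coords4D /scaled /= !mulrDr. Qed.

Lemma scaledN u : scaled (coords4 (- u)) = [seq - x | x <- scaled (coords4 u)].
Proof. by rewrite /coords4 !linearN /scaled /= !mxE !mulrN. Qed.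

Lemma encs_ilin s v : encs s (scaled (coords4 v)) -> encs (ilin s) (scaled (coords4 (lin_map v))).
Proof.
move=> es; apply: encs_iter; first exact: encs_T01.
by apply: encs_iter => //; apply: encs_T00.
Qed.

Lemma encs_ishift : encs ishift (scaled (coords4 (yq_step (shift_state R)))).
Proof.
rewrite coords4_yq -rapply_scaled; apply: encs_iapply => //.
have -> : scaled (coords (shift_state R)) = [seq zr R a | a <- [:: 0; 0; 0; - unitS; 0; unitS]%BZ].
  rewrite /shift_state coords_state !mxE /scaled; move: unitS => s.
  by rewrite !map_cons zrN zr0 /= !mulr0 mulrN mulr1.
exact: encs_icst.
Qed.

Lemma encs_ierr s v : encs s (scaled (coords4 v)) -> encs (ierr s) (scaled (coords4 (err_map v))).
Proof.
move=> es; apply: encs_iter; first exact: encs_T01.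
apply: encs_iter => // t w ew; rewrite scaledD; apply: encs_iadds; last exact: encs_ishift.
exact: encs_T00.
Qed.

Definition vec4r (l : seq R) : 'cV[R]_(2 + 2) :=
  col_mx (vec2 (nth 0 l 0) (nth 0 l 1)) (vec2 (nth 0 l 2) (nth 0 l 3)).

Lemma coords4_vec4r x0 x1 x2 x3 : coords4 (vec4r [:: x0; x1; x2; x3]) = [:: x0; x1; x2; x3].
Proof. by rewrite /coords4 /vec4r col_mxKu col_mxKd !mxE. Qed.

Lemma coords4_entries u (b : R) : all (fun x => `|x| <= b) (coords4 u) -> forall i, `|u i 0| <= b.
Proof.
rewrite /coords4 /= !mxE => /and5P[h0 h1 h2 h3 _] i.
by case: (split_ordP i) => k ->; case: (ord2P k) => ->.
Qed.

Lemma entries_coords4 s u (m : Z) : encs s (scaled (coords4 u)) ->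
  all (fun i => (iabs i <=? m)%BZ) s -> forall i, `|u i 0| <= zr R m / S.
Proof.
move=> es hs; apply: coords4_entries.
elim: s (coords4 u) es hs => [|j s IH] [|x l] //= [ej es] /andP[jm sm].
rewrite IH // andbT ler_pdivlMr // mulrC.
have -> : S * `|x| = `|S * x| by rewrite normrM (gtr0_norm S0).
by apply: le_trans (enc_iabs ej) _; rewrite zr_le.
Qed.

Definition mxB : 'M[R]_(2 + 2) :=
  \matrix_(i, j) (zr R (nth 0%BZ (nth [::] rows_B i) j) / zr R unitB).

Lemma coords4_mxB u : coords4 (mxB *m u) = rapply unitB rows_B (coords4 u).
Proof.
rewrite /coords4 /rapply /= !mxE !big_split_ord /= !big_ord_recl !big_ord0 !mxE /=.
have -> : lift ord0 ord0 = 1 :> 'I_2 by apply/val_inj.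
move: (zr R unitB)^-1 => b; move: (u _ 0) (u _ 0) (u _ 0) (u _ 0) => u0 u1 u2 u3.
by congr [:: _; _; _; _]; ring.
Qed.

Lemma encs_mxB s v : encs s (scaled (coords4 v)) ->
  encs (iapply unitB rows_B s) (scaled (coords4 (mxB *m v))).
Proof. by move=> es; rewrite coords4_mxB -rapply_scaled; apply: encs_iapply. Qed.

(** How far [mxB] is from inverting [1 - cycle66_P]. *)
Definition defect : 'M[R]_(2 + 2) := 1%:M - mxB *m (1%:M - cycle66_P R).

Lemma defect_col v : defect *m v = v - mxB *m (v - lin_map v).
Proof. by rewrite /defect mulmxBl mul1mx -mulmxA mulmxBl mul1mx cycle66_P_lin. Qed.

Lemma scaled_delta (j : 'I_(2 + 2)) :
  scaled (coords4 (delta_mx j 0)) = [seq zr R a | a <- unit_vec j].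
Proof.
case: j => [[|[|[|[|//]]]] ?]; rewrite /scaled /coords4 /unit_vec /= !mxE /= ?mulr1 ?mulr0 ?zr0 //.
Qed.

Lemma zr_div8 (s : Z) : 0 < zr R s -> zr R (s / 8)%BZ / zr R s <= 1 / 8.
Proof.
move=> s0; have : zr R (8 * (s / 8))%BZ <= zr R s.
  by rewrite zr_le; apply/Z.leb_spec0; exact: Z.mul_div_le.
rewrite zrM !zrE ler_pdivrMr //; lra.
Qed.

Lemma defect_entry i j : `|defect i j| <= 1 / 8.
Proof.
have es := encs_icst (unit_vec j); rewrite -scaled_delta in es.
have := encs_ilin es => el.
have e1 := encs_iadds es (encs_ineg el); rewrite -scaledN -scaledD in e1.
have e2 := encs_iadds es (encs_ineg (encs_mxB e1)); rewrite -scaledN -scaledD -defect_col in e2.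
have hs : all (fun i => (iabs i <=? unitS / 8)%BZ) (idefect j).
  apply/allP => k hk; have /allP/(_ j) := defect_small.
  rewrite mem_iota ltn_ord => /(_ isT)/allP/(_ k hk)/Z.leb_spec0 h.
  by apply/Z.leb_spec0/Z.div_le_lower_bound.
have := entries_coords4 e2 hs i; rewrite -colE mxE => h; apply: le_trans h _.
exact: zr_div8.
Qed.

(** The entries of [defect] are at most [1 / 8], so it halves the [l^1] norm, and a
    vector is controlled by its image under [mxB *m (1 - cycle66_P)]. *)
Lemma defect_bound v (m : R) : (forall i, `|(mxB *m (v - lin_map v)) i 0| <= m) ->
  forall i, `|v i 0| <= 8 * m.
Proof.
move=> hm; pose b := \sum_i `|v i 0|.
have vE : v = defect *m v + mxB *m (v - lin_map v) by rewrite defect_col subrK.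
have hi i : `|v i 0| <= b / 8 + m.
  rewrite {1}vE mxE; apply: le_trans (ler_normD _ _) _; apply: lerD (hm i).
  rewrite mxE; apply: le_trans (ler_norm_sum _ _ _) _.
  rewrite /b mulr_suml; apply: ler_sum => j _; rewrite normrM mulrC ler_wpM2l //.
  by have := defect_entry i j; rewrite div1r.
have hb : b <= 4 * (b / 8 + m).
  rewrite /b; apply: le_trans (ler_sum _ (fun i _ => hi i)) _.
  rewrite sumr_const card_ord -[X in X <= _]mulr_natl; exact: lexx.
by move=> i; have m0 := le_trans (normr_ge0 _) (hm i); apply: le_trans (hi i) _; lra.
Qed.

Lemma cycle66_unit : 1%:M - cycle66_P R \in unitmx.
Proof.
rewrite -unitmx_tr -row_free_unit -kermx_eq0; apply/negP => /negP.
case/rowV0Pn => v /sub_kermxP vA v0.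
have {}vA : v^T - lin_map v^T = 0.
  by rewrite -cycle66_P_lin -{1}[v^T]mul1mx -mulmxBl -[1%:M - _]trmxK -trmx_mul vA trmx0.
move/negP: v0; apply; rewrite -trmx_eq0; apply/eqP/matrixP => i j; rewrite (ord1 j) [RHS]mxE.
apply/eqP; rewrite -normr_le0 -(mulr0 8); apply: defect_bound => k.
by rewrite vA mulmx0 mxE normr0.
Qed.

Lemma err_yq : init66_yq R - ustar R = lin_map (init66_yq R - ustar R) + err_map 0.
Proof.
have : (1%:M - cycle66_P R) *m (init66_yq R - ustar R) = err_map 0.
  rewrite mulmxBr /init66_yq mulKVmx ?cycle66_unit // cycle66_a_err.
  by rewrite [LHS]addrAC subrr add0r.
rewrite mulmxBl mul1mx cycle66_P_lin => <-.
by generalize (init66_yq R - ustar R) (lin_map (init66_yq R - ustar R)) => a b; rewrite addrC subrK.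
Qed.

(** A posteriori bound: the error [init66_yq - ustar - center] solves the linear
    system whose right-hand side is the residual of [center]. *)
Lemma init66_yq_near (i : 'I_(2 + 2)) :
  `|(init66_yq R - ustar R - vec4r [seq zr R a / S | a <- center]) i 0|
    <= zr R (8 * residual_bound) / S.
Proof.
set c := vec4r _; set v := init66_yq R - ustar R.
have cE : scaled (coords4 c) = [seq zr R a | a <- center].
  rewrite /c /center [map _ _]/= coords4_vec4r /scaled /=.
  by rewrite ![S * _]mulrC !divfK // gt_eqF.
have ec := encs_icst center; rewrite -cE in ec.
have er := encs_iadds (encs_ierr ec) (encs_ineg ec); rewrite -scaledN -scaledD in er.
have vc : (v - c) - lin_map (v - c) = err_map c - c.
  have lB : lin_map (v - c) = lin_map v - lin_map c by rewrite -!cycle66_P_lin mulmxBr.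
  rewrite lB {1}/v err_yq -/v [err_map c]err_map_lin.
  generalize (lin_map v) (lin_map c) (@err_map R 0) => a b d.
  by apply/matrixP => k j; rewrite !mxE; ring.
have hr := entries_coords4 (encs_mxB er) residual_small.
rewrite zrM -mulrA (_ : zr R 8 = 8); last by rewrite !zrE; ring.
by apply: (defect_bound (v := v - c)) => k; rewrite vc; apply: hr.
Qed.

Lemma init66_state : init66 R - wstar R =
  state (usubmx (init66_yq R) - ystar R) (pos_part (dsubmx (init66_yq R)) - zstar R)
    (neg_part (dsubmx (init66_yq R)) - lstar R).
Proof. by rewrite /init66 /wstar /state !opp_col_mx !add_col_mx. Qed.

Lemma init66_yq_enc (k : nat) : (k < 4)%N ->
  enc ((nth 0%BZ center k - 8 * residual_bound)%BZ, (nth 0%BZ center k + 8 * residual_bound)%BZ)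
    (S * nth 0 (coords4 (init66_yq R - ustar R)) k).
Proof.
move=> k4; move: (init66_yq R - ustar R) init66_yq_near => v near.
have : `|nth 0 (coords4 v) k - zr R (nth 0%BZ center k) / S| <= zr R (8 * residual_bound) / S.
  have -> : zr R (nth 0%BZ center k) / S = nth 0 (coords4 (vec4r [seq zr R a / S | a <- center])) k.
    have -> : coords4 (vec4r [seq zr R a / S | a <- center]) = [seq zr R a / S | a <- center].
      by rewrite /center [map _ _]/= coords4_vec4r.
    by rewrite (nth_map 0%BZ).
  move: near; generalize (vec4r [seq zr R a / S | a <- center]) => c near.
  by case: k k4 => [|[|[|[|//]]]] _; [have := near (lshift 2 0)|have := near (lshift 2 1)|
    have := near (rshift 2 0)|have := near (rshift 2 1)]; rewrite /coords4 /= !mxE.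
move: (8 * residual_bound)%BZ (nth 0%BZ center k) (nth 0 _ k) => r c x.
rewrite ler_pdivlMr // -{2}(gtr0_norm S0) -normrM mulrBl divfK ?gt_eqF // ler_norml mulrC.
by case/andP=> h1 h2; rewrite /enc /= zrB zrD; apply/andP; split; lra.
Qed.

Lemma encs_iinit : encs iinit (scaled (coords (init66 R - wstar R))).
Proof.
have mx (t : R) : S * Num.max t 0 = Num.max (S * t) 0 by rewrite maxr_pMr ?ltW // mulr0.
have mn (t : R) : S * Num.min t 0 = Num.min (S * t) 0 by rewrite minr_pMr ?ltW // mulr0.
have hv := init66_yq_enc.
have u0E : init66_yq R = ustar R + (init66_yq R - ustar R) by rewrite [RHS]addrC subrK.
have hS := enc_icst R unitS.
have hN : enc (icst (- unitS)%BZ) (- S) by rewrite -zrN; apply: enc_icst.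
rewrite init66_state {}u0E; move: (init66_yq R - ustar R) hv => v hv.
have h0 := hv 0%N isT; have h1 := hv 1%N isT; have h2 := hv 2%N isT; have h3 := hv 3%N isT.
have -> : usubmx (ustar R + v) = ystar R + usubmx v by rewrite linearD /= col_mxKu.
have -> : dsubmx (ustar R + v) = qstar R + dsubmx v by rewrite linearD /= col_mxKd.
rewrite coords_state /iinit.
move: {hv} h0 h1 h2 h3; rewrite /coords4 ![nth 0%R _ _]/=.
move: (residual_bound) (icst unitS) (icst (- unitS)%BZ) hS hN => rb iS iN hS hN.
move: (nth 0%BZ center 0) (nth 0%BZ center 1) (nth 0%BZ center 2) (nth 0%BZ center 3) => c0 c1 c2 c3.
move: (usubmx v) (dsubmx v) => y q h0 h1 h2 h3.
have y0 (i : 'I_2) : (ystar R + y - ystar R) i 0 = y i 0.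
  by move: (ystar R) => w; rewrite !mxE; ring.
have q0 := enc_iadd h2 hN; have q1 := enc_iadd h3 hS.
have E0 : S * (qstar R + q) 0 0 = S * q 0 0 - S by rewrite /qstar /zstar /lstar !mxE /=; ring.
have E1 : S * (qstar R + q) 1 0 = S * q 1 0 + S by rewrite /qstar /zstar /lstar !mxE /=; ring.
rewrite -E0 in q0; rewrite -E1 in q1; move: (qstar R + q) q0 q1 {E0 E1} => p q0 q1.
have P0 : S * (pos_part p - zstar R) 0 0 = Num.max (S * p 0 0) 0.
  by rewrite /zstar !mxE /= subr0 mx.
have P1 : S * (pos_part p - zstar R) 1 0 = Num.max (S * p 1 0) 0 - S.
  by rewrite /zstar !mxE /= mulrBr mulr1 mx.
have N0 : S * (neg_part p - lstar R) 0 0 = Num.min (S * p 0 0) 0 + S.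
  by rewrite /lstar !mxE /= opprK mulrDr mulr1 mn.
have N1 : S * (neg_part p - lstar R) 1 0 = Num.min (S * p 1 0) 0.
  by rewrite /lstar !mxE /= subr0 mn.
rewrite /scaled !map_cons !y0 P0 P1 N0 N1; split; first exact: h0.
split; first exact: h1.
split; first exact: enc_imax0 q0.
split; first exact: enc_iadd (enc_imax0 q1) hN.
split; first exact: enc_iadd (enc_imin0 q0) hS.
by split; first exact: enc_imin0 q1.
Qed.

Lemma encs_iter_istep (tau : R) s (e : 'cV[R]_(2 + 2 + 2)) n : `|tau - 1 / 2| <= 10 ^- 10 ->
  encs s (scaled (coords e)) ->
  encs (iter n (istep unitS) s) (scaled (coords (iter n (err_step tau) e))).
Proof.
move=> ht es; elim: n => [//|n IH]; rewrite !iterS /scaled (coords_err_step _ _ (ltW S0)).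
exact: encs_istep.
Qed.

Lemma qform_iform s (v : seq R) : encs s v -> qform (qsum rows_A) v <= zr R (iform s).
Proof.
move=> es; rewrite qform_qsum /iform; elim: rows_A => [|c rows IH].
  by rewrite big_nil /= zr0.
rewrite big_cons /= zrD zrM; apply: lerD IH.
have h := enc_iabs (enc_idot c es); rewrite -real_normK ?num_real // expr2.
exact: ler_pM.
Qed.

(** The enclosure does not track the signs of [q]: the positive and negative
    parts are evaluated on intervals, so it follows the nonlinear step itself, for
    all [tau] of the range at once. *)
Lemma init66_enters (tau : R) : `|tau - 1 / 2| <= 10 ^- 10 ->
  normH (mxH R) (admm_seq tau (init66 R) entry_time - wstar R) <= radius R.
Proof.
move=> ht; have -> : init66 R = wstar R + (init66 R - wstar R) by rewrite [RHS]addrC subrK.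
rewrite admm_seq_err normH_form /radius ler_wsqrtr //.
have h := qform_iform (encs_iter_istep entry_time ht encs_iinit).
have := entry_small; rewrite -(zr_le R) => h2; have {h h2} := le_trans h h2.
move: (coords (iter _ _ _)) (radius2) => v r.
rewrite (zrM _ (r * unitS)) (zrM _ r) -(mulrA (zr R r)) (mulrC (zr R r)) !qform_qsum /scaled.
have -> : \sum_(c <- rows_A) dot c [seq S * x | x <- v] ^+ 2 = S * S * \sum_(c <- rows_A) dot c v ^+ 2.
  by rewrite mulr_sumr; apply: eq_bigr => c _; rewrite dot_scale exprMn expr2.
by rewrite (ler_pM2l (mulr_gt0 S0 S0)).
Qed.

End Trajectory.

(** * Convergence from the ball *)

Section Convergence.
Variable R : realType.
Implicit Types (tau kappa r : R) (e w : 'cV[R]_(2 + 2 + 2)).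

Lemma rate_lt1 : 0 < rate R < 1.
Proof.
have h0 : 0 < zr R 10000 by rewrite -zr0 zr_lt.
rewrite /rate ltr_pdivrMr // mul1r zr_lt andbT.
by rewrite divr_gt0 // -zr0 zr_lt.
Qed.

Lemma geometric_decay tau w : 49 / 100 <= tau <= 51 / 100 ->
  normH (mxH R) (w - wstar R) <= radius R ->
  forall k, normH (mxH R) (admm_seq tau w k - wstar R) <= radius R * rate R ^+ k.
Proof.
move=> ht hw; have /andP[r0 _] := rate_lt1.
have h := local_contraction (normH_is_norm (@mxH_posdef R)) rate_lt1
  (fun e => metric_contraction e ht) (@ball_in_region R) hw.
elim=> [|k IH]; first by rewrite expr0 mulr1.
by apply: le_trans (h k).2 _; rewrite exprS mulrCA ler_pM2l.
Qed.

Lemma mulmx2_bound (A : 'M[R]_2) (v : 'cV[R]_2) (b : R) i : (forall j, `|v j 0| <= b) ->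
  `|(A *m v) i 0| <= (\sum_k (`|A k 0| + `|A k 1|)) * b.
Proof.
move=> hv; have b0 := le_trans (normr_ge0 _) (hv 0).
rewrite mul2E; apply: le_trans (ler_normD _ _) _; rewrite !normrM.
apply: le_trans (_ : (`|A i 0| + `|A i 1|) * b <= _).
  by rewrite mulrDl lerD // ler_wpM2l.
by rewrite ler_wpM2r // (bigD1 i) //= lerDl sumr_ge0 // => k _; rewrite addr_ge0.
Qed.

(** The [x]-component is a linear function of the state error. *)
Lemma admm_x_lipschitz e (b : R) i : (forall i, `|e i 0| <= b) ->
  `|admm_x (wstar R + e) i 0 - xstar R i 0| <= (\sum_k (`|M R k 0| + `|M R k 1|)) * (3 * b).
Proof.
move=> he; rewrite admm_x_err.
have -> (u v : 'cV[R]_2) : (u + v) i 0 - u i 0 = v i 0 by rewrite mxE addrC addKr.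
apply: mulmx2_bound => j; rewrite /lpart /ypart /zpart !mxE.
have := he (rshift (2 + 2) j); have := he (lshift 2 (lshift 2 j)); have := he (lshift 2 (rshift 2 j)).
by rewrite !ler_norml => /andP[? ?] /andP[? ?] /andP[? ?]; apply/andP; split; lra.
Qed.

Lemma cvg_from_ball tau w n : 49 / 100 <= tau <= 51 / 100 ->
  normH (mxH R) (admm_seq tau w n - wstar R) <= radius R ->
  (fun k => admm_seq tau w k) @ \oo --> wstar R /\
  (fun k => admm_x (admm_seq tau w k)) @ \oo --> xstar R.
Proof.
move=> ht hn; have hd := geometric_decay ht hn.
have seqD k : admm_seq tau w (k + n) = admm_seq tau (admm_seq tau w n) k by rewrite /admm_seq iterD.
have he k i : `|(admm_seq tau w (k + n) - wstar R) i 0| <= radius R * rate R ^+ k.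
  by apply: le_trans (coord_le_norm _ i) _; rewrite seqD; apply: hd.
have r1 : `|rate R| < 1 by have /andP[? ?] := rate_lt1; rewrite gtr0_norm.
split.
  rewrite -(cvg_shiftn n); apply: (cvg_entries (g := geometric (radius R) (rate R))).
    by move=> k i; have := he k i; rewrite !mxE.
  exact: cvg_geometric.
rewrite -(cvg_shiftn n).
pose C := \sum_k (`|M R k 0| + `|M R k 1|).
apply: (cvg_entries (g := geometric (C * (3 * radius R)) (rate R))); last exact: cvg_geometric.
move=> k i /=.
have -> : admm_seq tau w (k + n) = wstar R + (admm_seq tau w (k + n) - wstar R) by rewrite [RHS]addrC subrK.
by rewrite -2!mulrA; apply: admm_x_lipschitz => j; apply: he.
Qed.

End Convergence.

(** * The theorem *)

Theorem theorem3p4 (R : realType) :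
  (* well-posedness of the data; the unique KKT point *)
  [/\ posdef (Q1 R), posdef (Q2 R), 1%:M - cycle66_P R \in unitmx,
      is_KKT (xstar R) (ystar R) (zstar R) (lstar R)
    & forall x y z l : 'cV[R]_2, is_KKT x y z l ->
        [/\ x = xstar R, y = ystar R, z = zstar R & l = lstar R]] /\
  (* 1 *)
  (exists (H : 'M[rat]_(2 + 2 + 2)) (r kappa : R),
      [/\ posdef (map_mx ratr H : 'M[R]_(2 + 2 + 2)), 0 < r, 0 < kappa < 1
        & forall tau : R, 49 / 100 <= tau <= 51 / 100 ->
          forall w0 : 'cV[R]_(2 + 2 + 2),
            normH (map_mx ratr H) (w0 - wstar R) <= r ->
            forall k : nat,
              normH (map_mx ratr H) (admm_seq tau w0 k.+1 - wstar R)
                <= kappa * normH (map_mx ratr H) (admm_seq tau w0 k - wstar R)]) /\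
  (exists U nrm kappa, forall tau : R, 49 / 100 <= tau <= 51 / 100 ->
      Qlin_attracting_on tau U nrm kappa) /\
  (* 2 *)
  (forall tau : R, `|tau - 1 / 2| <= 10 ^- 10 ->
      (fun k => admm_seq tau (init66 R) k) @ \oo --> wstar R /\
      (fun k => admm_x (admm_seq tau (init66 R) k)) @ \oo --> xstar R) /\
  (* 3 *)
  (exists tau_c : R,
      dec R [:: 9; 3; 6; 6; 0; 6; 1; 1; 1; 4]%N < tau_c
        < dec R [:: 9; 3; 6; 6; 0; 6; 1; 1; 1; 5]%N /\
      forall tau : R, 0 < tau < 1 ->
        (locally_Qlin_attracting tau <-> 0 < tau < tau_c) /\
        (schur_stable (T01 tau) <-> 0 < tau < tau_c)).
Proof.
split; first split.
- exact: Q1_posdef.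
- exact: Q2_posdef.
- exact: cycle66_unit.
- exact: KKT_star.
- by move=> x y z l h; apply: KKT_unique h (KKT_star R).
split.
  exists (mxH rat), (radius R), (rate R); rewrite map_mxH; split.
  - exact: mxH_posdef.
  - exact: radius_gt0.
  - exact: rate_lt1.
  move=> tau ht w0 hw k; apply: (local_contraction _ _ _ _ hw k).2.
  - exact: normH_is_norm (@mxH_posdef R).
  - exact: rate_lt1.
  - by move=> e; apply: metric_contraction.
  - exact: ball_in_region.
split.
  exists [set w | normH (mxH R) (w - wstar R) <= radius R], (normH (mxH R)), (rate R) => tau ht.
  apply: contraction_attracting.
  - exact: normH_is_norm (@mxH_posdef R).
  - exact: rate_lt1.
  - by move=> e; apply: metric_contraction.
  - exact: ball_in_region.
  - exact: radius_gt0.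
split.
  move=> tau ht; apply: (cvg_from_ball _ (init66_enters ht)).
  have h : (10 : R) ^- 10 <= 1 / 100.
    rewrite div1r lef_pV2 ?posrE ?exprn_gt0 //.
    by apply: le_trans (_ : 10 ^+ 2 <= _); [lra|rewrite ler_eXn2l //; lra].
  by move: (le_trans ht h); rewrite ler_norml => /andP[? ?]; apply/andP; split; lra.
have [tau_c /andP[lc ch] jc] := @juryf_root R.
have [l0 _ h1] := @tau_lo_hi R; have c0 := lt_trans l0 lc; have c1 := lt_trans ch h1.
exists tau_c; rewrite tau_loE tau_hiE lc ch; split=> // tau t01.
have S : schur_stable (T01 tau) <-> 0 < tau < tau_c.
  rewrite (schur_T01 t01); have /andP[t0 t1] := t01; rewrite t0 /=.
  split=> [jt|tc]; last by rewrite -jc; apply: juryf_decr => //; exact: ltW.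
  rewrite ltNge; apply/negP; rewrite le_eqVlt => /predU1P[ct|ct].
    by move: jt; rewrite -ct jc ltxx.
  by have := lt_trans jt (juryf_decr (ltW c0) ct (ltW t1)); rewrite jc ltxx.
by split=> //; rewrite attracting_schur.
Qed.
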